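(* Let $\Sigma$ be a support curve. There is a constant $C=C(\Sigma)>0$ such that the following holds. Let $c:[a,b]\times[0,T)\to\mathbb R^2$ be a solution of the area preserving curve shortening problem with Neumann free boundary conditions, where the initial curve $c_0$ satisfies: (A) $c_0$ has positive curvature, $\kappa_0>0$ on $[a,b]$; (B) $c_0$ has no self-intersection; (C) $c_0$ is contained in the outer domain created by $\Sigma$; (D) $L(c_0)<{}^{\Sigma}d:=\min\{|x-y|:x,y\in\Sigma,\ {}^{\Sigma}\vec\tau(x)=-{}^{\Sigma}\vec\tau(y)\}$. If $L_0:=L(c_0)<C(\Sigma)$, then, for each $t\in[0,T)$, the curve $c_t=c(\cdot,t)$ and the line segment from $c(b,t)$ to $c(a,t)$ trace out a convex domain in $\mathbb R^2$.
   Context: For a regular planar curve $f$: $\partial_s=|\partial_pf|^{-1}\partial_p$, $ds=|\partial_p f|\,dp$, $\tau=\partial_sf$ is the tangent, $\nu=J\tau$ the normal ($J$ = rotation by $+\frac{\pi}{2}$), $\kappa=\langle\partial_s^2f,\nu\rangle$ the curvature, $L(f)$ the length. $\angle_{\mathbb R^2}(v,w)$ is the oriented angle from $v$ to $w$. A support curve is a smooth, convex, simple, smoothly closed curve ${}^{\Sigma}f:[{}^{\Sigma}a,{}^{\Sigma}b]\to\mathbb R^2$ parametrized by arclength and positively oriented, so that its curvature satisfies ${}^{\Sigma}\kappa\ge 0$. $\Sigma$ denotes its image, ${}^{\Sigma}\vec\tau:\Sigma\to\mathbb S^1$ its unit tangent field, $G_\Sigma$ the bounded domain enclosed by $\Sigma$.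 The outer domain created by $\Sigma$ is $\mathbb R^2\setminus\overline{G_\Sigma}$; an initial curve is ''contained in the outer domain'' if, apart from its endpoints on $\Sigma$, it lies there. An initial curve is a smooth regular curve $c_0:[a,b]\to\mathbb R^2$ with $c_0(a),c_0(b)\in\Sigma$, $\angle_{\mathbb R^2}(\tau_0(a),{}^{\Sigma}\vec\tau(c_0(a)))=\frac{\pi}{2}$ and $\angle_{\mathbb R^2}(\tau_0(b),{}^{\Sigma}\vec\tau(c_0(b)))=-\frac{\pi}{2}$. A solution of the area preserving curve shortening problem with Neumann free boundary conditions with initial curve $c_0$ is a smooth family of smooth regular curves $c:[a,b]\times[0,T)\to\mathbb R^2$ (of class $C^{2+\alpha,1+\alpha/2}$ on $[a,b]\times[0,T)$ for every $\alpha\in(0,1)$ and $C^\infty$ on $[a,b]\times(0,T)$) such that $\partial_tc=(\kappa-\bar\kappa)\nu$, $c(\cdot,0)=c_0$, and for all $t\in[0,T)$: $c(a,t),c(b,t)\in\Sigma$, $\angle_{\mathbb R^2}(\tau(a,t),{}^{\Sigma}\vec\tau(c(a,t)))=\frac{\pi}{2}$, $\angle_{\mathbb R^2}(\tau(b,t),{}^{\Sigma}\vec\tau(c(b,t)))=-\frac{\pi}{2}$. Here $\bar\kappa(t)=\int_a^b\kappa(p,t)\,ds\big/\int_a^b ds$. ''Trace out a convex domain'' means that the closed curve assembled from $c_t$ and the segment is the boundary curve of a convex domain. *)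

(* Defs.v *)
From HB Require Import structures.
From mathcomp Require Import all_boot all_order all_algebra.
From mathcomp Require Import all_classical all_reals all_analysis.

Set Implicit Arguments.
Unset Strict Implicit.
Unset Printing Implicit Defensive.

Import Order.TTheory GRing.Theory Num.Theory.
Import numFieldNormedType.Exports.

Local Open Scope classical_set_scope.
Local Open Scope ring_scope.

(* Curves live on closed or half-open intervals, so derivatives are taken
   along the domain: at an endpoint they are one-sided and do not depend on
   the values of the (total) function outside the domain. *)
Section derivative_within.
Context {R : realType} {V : normedModType R}.
Implicit Types (A : set R) (f : R -> V).

Definition diff_quotient f (x y : R) : V := (y - x)^-1 *: (f y - f x).

Definition derivable_within A f (x : R) : Prop :=
  cvg (diff_quotient f x @ within A x^').

Definition derive_within A f (x : R) : V :=
  lim (diff_quotient f x @ within A x^').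

Definition smooth_within A f : Prop :=
  forall n x, A x -> derivable_within A (iter n (derive_within A) f) x.

End derivative_within.

Section space_time.
Context {R : realType} {V : normedModType R}.
Implicit Types (I J : set R) (c : R -> R -> V).

Definition dspace I c : R -> R -> V :=
  fun p t => derive_within I (fun q => c q t) p.

Definition dtime J c : R -> R -> V := fun p t => derive_within J (c p) t.

Definition dspace_able I J c : Prop :=
  forall p t, I p -> J t -> derivable_within I (fun q => c q t) p.

Definition dtime_able I J c : Prop :=
  forall p t, I p -> J t -> derivable_within J (c p) t.

Definition jointly_continuous I J c : Prop :=
  {within I `*` J, continuous (fun z : R * R => c z.1 z.2)}.

(* The word w lists the differentiations: true is d/dt, false is d/dp. *)
Definition mixed_partial I J (w : seq bool) c : R -> R -> V :=
  foldr (fun b g => if b then dtime J g else dspace I g) c w.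

Definition smooth_space_time I J c : Prop :=
  forall w, [/\ jointly_continuous I J (mixed_partial I J w c),
                dspace_able I J (mixed_partial I J w c)
              & dtime_able I J (mixed_partial I J w c)].

Definition hoelder_space I J c (e : R) : Prop :=
  exists K : R, forall p q t, I p -> I q -> J t ->
    `|c p t - c q t| <= K * `|p - q| `^ e.

Definition hoelder_time I J c (e : R) : Prop :=
  exists K : R, forall p t s, I p -> J t -> J s ->
    `|c p t - c p s| <= K * `|t - s| `^ e.

Definition time_interval (T : \bar R) : set R :=
  [set t | 0 <= t /\ (t%:E < T)%E].

Definition open_time_interval (T : \bar R) : set R :=
  [set t | 0 < t /\ (t%:E < T)%E].

(* The class C^{2+al,1+al/2} on I x [0,T).  The seminorms are those of the
   usual parabolic Hoelder norm; as the time interval is half-open (and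
   possibly infinite), they are required to be finite on I x [0,T'] for every
   T' < T. *)
Definition parabolic_hoelder I (T : \bar R) (al : R) c : Prop :=
  let J := time_interval T in
  let cp := dspace I c in
  let cpp := dspace I cp in
  let ct := dtime J c in
  [/\ [/\ dspace_able I J c, dspace_able I J cp & dtime_able I J c],
      [/\ jointly_continuous I J c, jointly_continuous I J cp,
          jointly_continuous I J cpp & jointly_continuous I J ct]
    & forall T' : R, (T'%:E < T)%E ->
      [/\ hoelder_space I `[0, T'] cpp al,
          hoelder_space I `[0, T'] ct al,
          hoelder_time I `[0, T'] cpp (al / 2),
          hoelder_time I `[0, T'] ct (al / 2)
        & hoelder_time I `[0, T'] cp ((1 + al) / 2)]].

End space_time.

(* The library norm on R * R is the sup norm; it is used only for the topology
   and in Hoelder bounds. *)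
Section plane.
Context {R : realType}.
Implicit Types (v w : R * R).

Definition dot v w : R := v.1 * w.1 + v.2 * w.2.

Definition enorm v : R := Num.sqrt (dot v v).

Definition rot (th : R) v : R * R :=
  (cos th * v.1 - sin th * v.2, sin th * v.1 + cos th * v.2).

Definition J v : R * R := (- v.2, v.1).

(* th is a determination, modulo 2 pi, of the oriented angle from v to w. *)
Definition oriented_angle v w (th : R) : Prop :=
  [/\ v != 0, w != 0 & (enorm w)^-1 *: w = rot th ((enorm v)^-1 *: v)].

Definition frontier (A : set (R * R)) : set (R * R) := closure A `\` A°.

(* The union of the bounded components of the complement; for a Jordan curve
   there is exactly one. *)
Definition enclosed (S : set (R * R)) : set (R * R) :=
  [set x | ~ S x /\ bounded_set (connected_component (~` S) x)].

Definition outer_domain (S : set (R * R)) : set (R * R) :=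
  ~` closure (enclosed S).

End plane.

Section curves.
Context {R : realType}.
Variables a b : R.
Implicit Types f : R -> R * R.

Definition regular f : Prop :=
  forall p, p \in `[a, b] -> derive_within `[a, b] f p != 0.

Definition speed f (p : R) : R := enorm (derive_within `[a, b] f p).

(* d/ds, where s is the arclength of f: differentiates g with respect to s *)
Definition darc f (g : R -> R * R) (p : R) : R * R :=
  (speed f p)^-1 *: derive_within `[a, b] g p.

Definition tangent f : R -> R * R := darc f f.

Definition normal f (p : R) : R * R := J (tangent f p).

Definition curvature f (p : R) : R := dot (darc f (darc f f) p) (normal f p).

Definition curve_length f : R :=
  \int[lebesgue_measure]_(p in `[a, b]) speed f p.

Definition mean_curvature f : R :=
  (\int[lebesgue_measure]_(p in `[a, b]) (curvature f p * speed f p))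
  / curve_length f.

Definition simple_closed f : Prop :=
  [/\ {within `[a, b], continuous f}, f a = f b
    & {in `[a, b[ &, injective f}].

Definition bounds_convex_domain f : Prop :=
  simple_closed f /\
  exists D : set (R * R),
    [/\ D !=set0, open D, convex_set D & f @` `[a, b] = frontier D].

(* f on [a, b], followed by the segment from f b to f a on [b, b + 1] *)
Definition close_by_segment f (p : R) : R * R :=
  if p <= b then f p else f b + (p - b) *: (f a - f b).

End curves.

Definition traces_out_convex_domain {R : realType} (a b : R)
    (f : R -> R * R) : Prop :=
  bounds_convex_domain a (b + 1) (close_by_segment a b f).

Record support_curve {R : realType} (a b : R) (f : R -> R * R) : Prop := {
  support_lt : a < b;
  support_smooth : smooth_within `[a, b] f;
  support_smoothly_closed : forall n,
    iter n (derive_within `[a, b]) f a = iter n (derive_within `[a, b]) f b;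
  support_arclength : forall p, p \in `[a, b] -> speed a b f p = 1;
  support_convex : bounds_convex_domain a b f;
  (* positively oriented: the normal points into the enclosed domain *)
  support_oriented : forall p, p \in `[a, b] ->
    \forall e \near 0^'+,
      enclosed (f @` `[a, b]) (f p + e *: normal a b f p);
  support_curvature : forall p, p \in `[a, b] -> 0 <= curvature a b f p }.

Section support.
Context {R : realType}.
Variables (sa sb : R) (sf : R -> R * R).

Let Sigma : set (R * R) := sf @` `[sa, sb].

(* The unit tangent as a field on the image; the choice of the parameter is
   immaterial because sf is simple and smoothly closed. *)
Definition support_tangent (x : R * R) : R * R :=
  tangent sa sb sf (xget sa [set p | p \in `[sa, sb] /\ sf p = x]).

(* The set of distances is nonempty and compact for a support curve, so the
   infimum is a minimum. *)
Definition support_width : R :=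
  inf [set d | exists x y, [/\ Sigma x, Sigma y,
    support_tangent x = - support_tangent y & d = enorm (x - y)]].

Definition neumann_free_boundary (a b : R) (f : R -> R * R) : Prop :=
  [/\ Sigma (f a), Sigma (f b),
      oriented_angle (tangent a b f a) (support_tangent (f a)) (pi / 2)
    & oriented_angle (tangent a b f b) (support_tangent (f b)) (- (pi / 2))].

Record initial_curve (a b : R) (c0 : R -> R * R) : Prop := {
  initial_lt : a < b;
  initial_smooth : smooth_within `[a, b] c0;
  initial_regular : regular a b c0;
  initial_boundary : neumann_free_boundary a b c0 }.

Record apcsf_solution (a b : R) (T : \bar R) (c0 : R -> R * R)
    (c : R -> R -> R * R) : Prop := {
  solution_time : (0 < T)%E;
  solution_hoelder : forall al : R, 0 < al -> al < 1 ->
    parabolic_hoelder `[a, b] T al c;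
  solution_smooth : smooth_space_time `[a, b] (open_time_interval T) c;
  solution_regular : forall t, time_interval T t -> regular a b (c^~ t);
  solution_flow : forall p t, p \in `[a, b] -> time_interval T t ->
    dtime (time_interval T) c p t =
    (curvature a b (c^~ t) p - mean_curvature a b (c^~ t))
      *: normal a b (c^~ t) p;
  solution_initial : forall p, p \in `[a, b] -> c p 0 = c0 p;
  solution_boundary : forall t, time_interval T t ->
    neumann_free_boundary a b (c^~ t) }.

End support.

(* Main.v *)
(* The curvature satisfies a parabolic equation, and at the endpoints the
   boundary condition determines the sign of its derivative, because a convex
   support curve lies on one side of each of its tangents; hence positive
   curvature is preserved, by the maximum principle.

   If the initial curve is short, then so are all the curves, since the length
   does not increase. The tangents of the support curve at the two endpoints are
   then close to each other, so that the cosine of the total turning of the curve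
   stays negative: by continuity the total turning remains between pi / 2 and
   3 pi / 2 if it starts below 2 pi. For the initial curve this is Hopf's
   argument on the secants of an embedded arc, applicable because the arc stays
   outside of the support curve while short normal segments at its endpoints go
   inside.

   Finally, a curve of positive curvature and total turning less than 2 pi, such
   that the chord makes angles less than pi with the end tangents on the
   appropriate sides, bounds together with its chord the intersection of the
   half planes defined by its tangents and the chord. *)

(* Later curves are not known in advance to be embedded, so embeddedness enters at time 0 only.
   Afterwards everything rests on the total turning, the integral of [K * V], which is continuous in
   time although angle functions are chosen separately at each time. The constant is the smaller of
   two lengths. Below the first, the support tangents at the endpoints have positive inner product,
   and this product is minus the cosine of the total turning. The second is a depth up to which
   points on the inner normals lie neither on the support curve nor in the outer domain. At the
   boundary, the support parameter of the moving endpoint is never differentiated, as it may jump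
   where the closed curve is cut open. The sign of the curvature derivative comes from monotonicity
   of the support lines, its size from a Lipschitz bound in space. The size matters because the
   maximum principle is run on a weighted curvature. The mean curvature is nonlocal, but lies
   between 0 and any upper bound of the curvature while the latter is nonnegative. *)
Require Import Defs.
From mathcomp Require Import all_boot all_order all_algebra.
From mathcomp Require Import all_classical all_reals all_analysis.
From mathcomp Require Import ring lra.

Import Order.TTheory GRing.Theory Num.Theory.
Import numFieldNormedType.Exports.

Local Open Scope classical_set_scope.
Local Open Scope ring_scope.
Set Implicit Arguments.
Unset Strict Implicit.
Unset Printing Implicit Defensive.

(** * Derivatives along a subset of the line *)

Section one_sided_calculus.
Context {R : realType}.
Implicit Types (A : set R) (x y : R).

(** [lim] has a default value when nothing converges, so the calculus is done with this relation and
    converted to [derive_within] only at limit points, where the derivative is unique. *)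
Definition has_derivative {V : normedModType R} A (f : R -> V) x (l : V) : Prop :=
  diff_quotient f x @ within A x^' --> l.

Definition limit_point_of A x : Prop :=
  forall e, 0 < e -> exists y, [/\ A y, y != x & `|y - x| < e].

Lemma within_dnbhs_proper A x : limit_point_of A x ->
  ProperFilter (within A x^').
Proof.
move=> h; apply: Build_ProperFilter_ex => P.
rewrite /within/= /dnbhs /within/= => /nbhs_ballP[e/= e0 eP].
have [y [Ay yx yxe]] := h _ e0.
exists y; apply: eP => //; first by rewrite /ball/= distrC.
Qed.

Lemma exists_segment_right (a b x e : R) : a <= x -> x < b -> 0 < e ->
  exists y, [/\ y \in `[a, b], x < y & y < x + e].
Proof.
move=> ax xb e0; exists (Num.min b (x + e / 2)); split.
- rewrite in_itv/= ge_min lexx/= andbT le_min; lra.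
- rewrite lt_min xb/=; lra.
- rewrite gt_min; apply/orP; right; lra.
Qed.

Lemma exists_segment_left (a b x e : R) : x <= b -> a < x -> 0 < e ->
  exists y, [/\ y \in `[a, b], y < x & x - e < y].
Proof.
move=> xb ax e0; exists (Num.max a (x - e / 2)); split.
- rewrite in_itv/= le_max lexx/= ge_max; lra.
- rewrite gt_max ax/=; lra.
- rewrite lt_max; apply/orP; right; lra.
Qed.

Lemma limit_point_segment (a b x : R) : a < b -> x \in `[a, b] ->
  limit_point_of `[a, b] x.
Proof.
move=> ab; rewrite in_itv/= => /andP[ax xb] e e0.
have [xltb|bx] := ltP x b.
  have [y [yI xy ye]] := exists_segment_right ax xltb e0.
  by exists y; split=> //; [rewrite gt_eqF|rewrite gtr0_norm; lra].
have [y [yI yx ye]] := exists_segment_left xb (lt_le_trans ab bx) e0.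
by exists y; split=> //; [rewrite lt_eqF|rewrite ltr0_norm; lra].
Qed.

Lemma limit_point_nbhs A x : nbhs x A -> limit_point_of A x.
Proof.
move=> /nbhs_ballP[d/= d0 dA] e e0.
exists (x + Num.min d e / 2).
have m0 : 0 < Num.min d e by rewrite lt_min d0.
have md : Num.min d e <= d by rewrite ge_min lexx.
have me : Num.min d e <= e by rewrite ge_min lexx orbT.
split; last by rewrite addrAC subrr add0r gtr0_norm; lra.
- apply: dA; rewrite /ball/= opprD addNKr normrN gtr0_norm; lra.
- by rewrite gt_eqF//; lra.
Qed.

Lemma within_dnbhs_interior A x : nbhs x A -> within A x^' = x^'.
Proof.
move=> nA; apply/seteqP; split => P; last exact: cvg_within.
rewrite /within/= /dnbhs /within/= => h.
by apply: filterS2 nA h => y Ay h yx; apply: h.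
Qed.

Section vector_valued.
Context {V : normedModType R}.
Implicit Types (f g : R -> V).

Lemma has_derivative_interior A B f x l : nbhs x A -> nbhs x B ->
  has_derivative A f x l -> has_derivative B f x l.
Proof.
by move=> nA nB; rewrite /has_derivative !within_dnbhs_interior.
Qed.

Lemma has_derivative_subset A B f x l : B `<=` A ->
  has_derivative A f x l -> has_derivative B f x l.
Proof.
move=> BA; apply: cvg_trans; apply: cvg_app => P.
rewrite /within/= /dnbhs /within/= => /nbhs_ballP[d d0 dP].
by apply/nbhs_ballP; exists d => // y yd yx By; apply: dP => //; exact: BA.
Qed.

Lemma has_derivative_unique A f x l m : limit_point_of A x ->
  has_derivative A f x l -> has_derivative A f x m -> l = m.
Proof.
move=> /within_dnbhs_proper pf hl hm; apply: cvg_unique hl hm.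
exact: norm_hausdorff.
Qed.

Lemma derive_withinP A f x : derivable_within A f x ->
  has_derivative A f x (derive_within A f x).
Proof. by []. Qed.

Lemma has_derivative_derive A f x l : limit_point_of A x ->
  has_derivative A f x l -> derive_within A f x = l.
Proof.
by move=> /within_dnbhs_proper pf hl; apply: cvg_lim.
Qed.

Lemma has_derivative_derivable A f x l :
  has_derivative A f x l -> derivable_within A f x.
Proof. by move=> h; apply/cvg_ex; exists l. Qed.

Lemma eq_has_derivative A f g x l : {in A, f =1 g} -> A x ->
  has_derivative A f x l -> has_derivative A g x l.
Proof.
move=> fg Ax; apply: cvg_trans; apply: near_eq_cvg.
rewrite /prop_near1/= /within/=; apply: nearW => y Ay.
by rewrite /diff_quotient !fg// inE.
Qed.

(** Multiplying out the quotient admits [y = x], so that punctured neighbourhoods disappear from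
    later estimates. *)
Lemma has_derivative_epsP A f x l : has_derivative A f x l <->
  forall e, 0 < e -> exists2 d, 0 < d & forall y, A y -> `|y - x| < d ->
    `|f y - f x - (y - x) *: l| <= e * `|y - x|.
Proof.
split.
  move=> /cvgrPdist_le h e e0; have := h _ e0.
  rewrite /prop_near1 /within/= => /nbhs_ballP[d/= d0 dP].
  exists d => // y Ay yxd.
  have [->|yx] := eqVneq y x; first by rewrite !subrr scale0r subr0 !normr0 mulr0.
  have := dP y; rewrite /ball/= distrC => /(_ yxd yx Ay).
  rewrite /diff_quotient distrC => H.
  have yx0 : y - x != 0 by rewrite subr_eq0.
  rewrite -[X in `|X - _|](scalerKV yx0) -scalerBr normrZ mulrC.
  by rewrite ler_wpM2r.
move=> h; apply/cvgrPdist_le => e e0.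
have [d d0 dP] := h _ e0.
rewrite /prop_near1 /within/=; apply/nbhs_ballP; exists d => //= y.
rewrite /ball/= distrC => yxd yx Ay; have H := dP y Ay yxd.
rewrite /diff_quotient distrC.
have yx0 : y - x != 0 by rewrite subr_eq0.
rewrite -[X in `|_ - X|](scalerK yx0) -scalerBr normrZ normfV.
by rewrite mulrC ler_pdivrMr ?normr_gt0.
Qed.

Lemma has_derivative_cvg_dnbhs A f x l : has_derivative A f x l ->
  f @ within A x^' --> f x.
Proof.
move=> h.
have -> : f x = f x + (x - x) *: l by rewrite subrr scale0r addr0.
have H : (fun y => f x + (y - x) *: diff_quotient f x y) @ within A x^' -->
    f x + (x - x) *: l.
  apply: cvgD; first exact: cvg_cst.
  apply: cvgZ => //; apply: cvgB; last exact: cvg_cst.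
  apply: cvg_trans (cvg_within _) _; exact: nbhs_dnbhs.
apply: cvg_trans H; apply: near_eq_cvg.
rewrite /prop_near1/= /within/=; apply/nbhs_ballP; exists 1 => //= y _ yx _.
by rewrite /diff_quotient scalerKV ?subr_eq0// addrC subrK.
Qed.

Lemma has_derivative_cvg A f x l : has_derivative A f x l ->
  f @ within A (nbhs x) --> f x.
Proof.
move=> /has_derivative_cvg_dnbhs h P nP; have := h P nP.
rewrite /= /nbhs/= /within/= /dnbhs /within/= => /nbhs_ballP[d d0 dP].
apply/nbhs_ballP; exists d => // y yd Ay.
have [->|yx] := eqVneq y x; first exact: nbhs_singleton.
exact: dP.
Qed.

Lemma has_derivative_continuous A f (df : R -> V) :
  (forall x, A x -> has_derivative A f x (df x)) -> {within A, continuous f}.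
Proof.
move=> h; apply/subspace_continuousP => x Ax; exact: has_derivative_cvg (h x Ax).
Qed.

End vector_valued.

Section scalar.
Implicit Types (f g : R -> R).

Lemma has_derivative_cst A (c : R) x : has_derivative A (fun=> c) x 0.
Proof.
rewrite /has_derivative.
suff -> : diff_quotient (fun=> c) x = (fun=> 0) by exact: cvg_cst.
by apply/funext => y; rewrite /diff_quotient subrr scaler0.
Qed.

Lemma has_derivative_id A x : has_derivative A (fun y : R => y) x 1.
Proof.
apply/has_derivative_epsP => e e0; exists 1 => // y _ _.
by rewrite /GRing.scale/= mulr1 subrr normr0 mulr_ge0// ltW.
Qed.

Lemma has_derivativeD A f g x l m : has_derivative A f x l ->
  has_derivative A g x m -> has_derivative A (fun y => f y + g y) x (l + m).
Proof.
move=> hf hg; rewrite /has_derivative.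
suff -> : diff_quotient (fun y => f y + g y) x =
  (fun y => diff_quotient f x y + diff_quotient g x y) by exact: cvgD.
by apply/funext => y; rewrite /diff_quotient -scalerDr; congr (_ *: _); ring.
Qed.

Lemma has_derivativeM A f g x l m : has_derivative A f x l ->
  has_derivative A g x m ->
  has_derivative A (fun y => f y * g y) x (l * g x + f x * m).
Proof.
move=> hf hg; rewrite /has_derivative.
suff -> : diff_quotient (fun y => f y * g y) x =
  (fun y => diff_quotient f x y * g y + f x * diff_quotient g x y).
  apply: cvgD; apply: cvgM => //; last exact: cvg_cst.
  exact: has_derivative_cvg_dnbhs hg.
by apply/funext => y; rewrite /diff_quotient /GRing.scale/=; ring.
Qed.

Lemma has_derivativeN A f x l : has_derivative A f x l ->
  has_derivative A (fun y => - f y) x (- l).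
Proof.
move=> hf; rewrite /has_derivative.
suff -> : diff_quotient (fun y => - f y) x = (fun y => - diff_quotient f x y).
  exact: cvgN.
by apply/funext => y; rewrite /diff_quotient /GRing.scale/=; ring.
Qed.

Lemma has_derivativeB A f g x l m : has_derivative A f x l ->
  has_derivative A g x m -> has_derivative A (fun y => f y - g y) x (l - m).
Proof. by move=> hf hg; apply: has_derivativeD => //; apply: has_derivativeN. Qed.

Lemma has_derivativeMl A f x l (k : R) : has_derivative A f x l ->
  has_derivative A (fun y => k * f y) x (k * l).
Proof.
move=> h; have := has_derivativeM (has_derivative_cst A k x) h.
by rewrite mul0r add0r.
Qed.

(** Caratheodory's form of the derivative of [g] avoids dividing by [f y - f x], which may
    vanish. *)
Lemma has_derivative_comp A f (g : R -> R) x l m : has_derivative A f x l ->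
  is_derive (f x) 1 g m -> has_derivative A (fun y => g (f y)) x (m * l).
Proof.
move=> hf /is_derive1_caratheodory[h [gE ch hm]]; rewrite /has_derivative.
suff -> : diff_quotient (fun y => g (f y)) x =
  (fun y => h (f y) * diff_quotient f x y).
  apply: cvgM => //; rewrite -hm.
  exact: cvg_comp (has_derivative_cvg_dnbhs hf) ch.
by apply/funext => y; rewrite /diff_quotient gE /GRing.scale/=; ring.
Qed.

Lemma has_derivativeV A f x l : f x != 0 -> has_derivative A f x l ->
  has_derivative A (fun y => (f y)^-1) x (- (l / f x ^+ 2)).
Proof.
move=> fx0 hf.
have := @has_derivative_comp A f (fun z => z^-1) x l (- (f x) ^- 2 *: 1) hf.
rewrite /GRing.scale/= mulr1 mulNr mulrC; apply.
rewrite -[- f x ^- 2]mulr1; exact: (@is_deriveV _ id).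
Qed.

Lemma has_derivative_sqrt A f x l : 0 < f x -> has_derivative A f x l ->
  has_derivative A (fun y => Num.sqrt (f y)) x (l / (2 * Num.sqrt (f x))).
Proof.
move=> fx0 hf; rewrite mulrC.
by apply: (has_derivative_comp hf); exact: is_derive1_sqrt.
Qed.

Lemma has_derivative_cos A f x l : has_derivative A f x l ->
  has_derivative A (fun y => cos (f y)) x (- sin (f x) * l).
Proof. by move=> hf; apply: (has_derivative_comp hf). Qed.

Lemma has_derivative_sin A f x l : has_derivative A f x l ->
  has_derivative A (fun y => sin (f y)) x (cos (f x) * l).
Proof. by move=> hf; apply: (has_derivative_comp hf). Qed.

Lemma has_derivative_exp A f x l : has_derivative A f x l ->
  has_derivative A (fun y => expR (f y)) x (expR (f x) * l).
Proof. by move=> hf; apply: (has_derivative_comp hf). Qed.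

Lemma has_derivative_is_derive A f x l : nbhs x A -> has_derivative A f x l ->
  is_derive x 1 f l.
Proof.
move=> nA; rewrite /has_derivative within_dnbhs_interior// => h.
have H : (fun h : R => h^-1 *: (f (h *: (1:R) + x) - f x)) @ 0^' --> l.
  have -> : (fun h : R => h^-1 *: (f (h *: (1:R) + x) - f x)) =
    diff_quotient f x \o (fun h => h + x).
    apply/funext => k; rewrite /diff_quotient /= addrK.
    by congr (_ *: (f _ - _)); rewrite /GRing.scale/= mulr1.
  apply: cvg_comp h => P.
  rewrite /nbhs/= /dnbhs /within/= => /nbhs_ballP[d/= d0 dP].
  apply/nbhs_ballP; exists d => //= y yd y0; apply: dP.
    rewrite /ball/= opprD addrCA subrr addr0.
    by move: yd; rewrite /ball/= sub0r.
  by rewrite -subr_eq0 addrK.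
apply: DeriveDef; first by apply/cvg_ex; exists l.
by apply: cvg_lim.
Qed.

End scalar.

Lemma has_derivative_pair A (f : R -> R * R) x l :
  has_derivative A (fun y => (f y).1) x l.1 ->
  has_derivative A (fun y => (f y).2) x l.2 -> has_derivative A f x l.
Proof.
move=> h1 h2; rewrite /has_derivative.
have -> : diff_quotient f x = (fun y => (diff_quotient (fun y => (f y).1) x y,
    diff_quotient (fun y => (f y).2) x y)).
  by apply/funext => y; rewrite /diff_quotient.
by rewrite [l]surjective_pairing; exact: (cvg_pair h1 h2).
Qed.

Lemma has_derivative_fst A (f : R -> R * R) x l :
  has_derivative A f x l -> has_derivative A (fun y => (f y).1) x l.1.
Proof.
move=> h; rewrite /has_derivative.
have -> : diff_quotient (fun y => (f y).1) x = fst \o diff_quotient f x.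
  by apply/funext => y; rewrite /diff_quotient.
exact: cvg_comp h cvg_fst.
Qed.

Lemma has_derivative_snd A (f : R -> R * R) x l :
  has_derivative A f x l -> has_derivative A (fun y => (f y).2) x l.2.
Proof.
move=> h; rewrite /has_derivative.
have -> : diff_quotient (fun y => (f y).2) x = snd \o diff_quotient f x.
  by apply/funext => y; rewrite /diff_quotient.
exact: cvg_comp h cvg_snd.
Qed.

End one_sided_calculus.

(** * Mean value theorem, minima, and functions that rise and then fall *)

Section mean_value.
Context {R : realType}.
Implicit Types (A : set R) (f df g dg : R -> R) (a b x y : R).

Lemma mean_value A f df x y : x < y -> `[x, y] `<=` A ->
  (forall z, A z -> has_derivative A f z (df z)) ->
  exists2 c, c \in `]x, y[ & f y - f x = df c * (y - x).
Proof.
move=> xy xyA hf.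
have hf' z : z \in `[x, y] -> has_derivative `[x, y] f z (df z).
  by move=> zxy; apply: has_derivative_subset (xyA) _; apply: hf; exact: xyA.
apply: MVT => //; last by apply: has_derivative_continuous => z; exact: hf'.
move=> z zxy; apply: (@has_derivative_is_derive _ `]x, y[).
  by apply: near_in_itvoo.
apply: has_derivative_subset (hf' z _).
  exact: subset_itv_oo_cc.
exact: subset_itv_oo_cc zxy.
Qed.

Lemma segment_subset_itv (I : interval R) x y : x \in I -> y \in I ->
  `[x, y] `<=` [set` I].
Proof.
by move=> xI yI z /=; rewrite in_itv/= => zxy; apply: (interval_is_interval xI yI).
Qed.

Lemma increasing_of_derivative A f df x y : x < y -> `[x, y] `<=` A ->
  (forall z, A z -> has_derivative A f z (df z)) ->
  (forall z, z \in `]x, y[ -> 0 < df z) -> f x < f y.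
Proof.
move=> xy xyA hf pf; have [c cxy E] := mean_value xy xyA hf.
by rewrite -subr_gt0 E mulr_gt0 ?pf// subr_gt0.
Qed.

Lemma nondecreasing_of_derivative A f df x y : x <= y -> `[x, y] `<=` A ->
  (forall z, A z -> has_derivative A f z (df z)) ->
  (forall z, z \in `]x, y[ -> 0 <= df z) -> f x <= f y.
Proof.
rewrite le_eqVlt => /predU1P[->//|xy] xyA hf pf.
have [c cxy E] := mean_value xy xyA hf.
by rewrite -subr_ge0 E mulr_ge0 ?pf// subr_ge0 ltW.
Qed.

Lemma constant_of_derivative A f x y : x <= y -> `[x, y] `<=` A ->
  (forall z, A z -> has_derivative A f z 0) -> f x = f y.
Proof.
rewrite le_eqVlt => /predU1P[->//|xy] xyA hf.
have [c cxy] := mean_value xy xyA hf.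
by rewrite mul0r => /eqP; rewrite subr_eq0 => /eqP.
Qed.

Lemma derivative_at_min A f x l : A x -> (forall y, A y -> f x <= f y) ->
  has_derivative A f x l ->
  ((forall e, 0 < e -> exists y, [/\ A y, x < y & y < x + e]) -> 0 <= l) /\
  ((forall e, 0 < e -> exists y, [/\ A y, y < x & x - e < y]) -> l <= 0).
Proof.
move=> Ax mf /has_derivative_epsP hf; split => lp.
- rewrite leNgt; apply/negP => l0.
  have [|d d0 dP] := hf (- l / 2); first by lra.
  have [y [Ay xy yx]] := lp _ d0.
  have yx0 : 0 < y - x by rewrite subr_gt0.
  have := dP y Ay; rewrite gtr0_norm// ltrBlDl => /(_ yx).
  rewrite ler_norml => /andP[_]; rewrite /GRing.scale/= => H.
  have := mf y Ay; nra.
- rewrite leNgt; apply/negP => l0.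
  have [|d d0 dP] := hf (l / 2); first by lra.
  have [y [Ay xy yx]] := lp _ d0.
  have yx0 : y - x < 0 by rewrite subr_lt0.
  have := dP y Ay; rewrite ltr0_norm// => /(_ _)/wrap[]; first by lra.
  rewrite ler_norml => /andP[_]; rewrite /GRing.scale/= => H.
  have := mf y Ay; nra.
Qed.

(** At an endpoint only one of the two inequalities survives; this is what the boundary cases of the
    maximum principle and of the envelope argument use. *)
Lemma derivative_at_min_segment a b f x l : x \in `[a, b] ->
  (forall y, y \in `[a, b] -> f x <= f y) -> has_derivative `[a, b] f x l ->
  (x < b -> 0 <= l) /\ (a < x -> l <= 0).
Proof.
move=> xI mf hf; have [H1 H2] := derivative_at_min xI mf hf.
have /andP[ax xb] : a <= x <= b by move: xI; rewrite in_itv.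
split=> h; [apply: H1|apply: H2] => e e0.
  exact: exists_segment_right.
exact: exists_segment_left.
Qed.

Lemma second_derivative_at_min a b f df x l : x \in `]a, b[ ->
  (forall y, y \in `[a, b] -> has_derivative `[a, b] f y (df y)) ->
  has_derivative `[a, b] df x l ->
  (forall y, y \in `[a, b] -> f x <= f y) -> df x = 0 /\ 0 <= l.
Proof.
move=> xab hf hdf mf.
have xab' : x \in `[a, b] by apply: subset_itv_oo_cc.
have /andP[ax xb] : a < x < b by move: xab; rewrite in_itv.
have df0 : df x = 0.
  have [H1 H2] := derivative_at_min_segment xab' mf (hf _ xab').
  by apply/eqP; rewrite eq_le H1// H2.
split => //; rewrite leNgt; apply/negP => l0.
move/has_derivative_epsP : hdf => hdf.
have [|d d0 dP] := hdf (- l / 2); first by lra.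
have [y [yab xy yd]] := exists_segment_right (ltW ax) xb d0.
have yb : y <= b by move: yab; rewrite in_itv => /andP[].
have [|c] := mean_value xy _ hf; first exact: segment_subset_itv.
rewrite in_itv/= => /andP[xc cy] E.
have cab : c \in `[a, b] by rewrite in_itv/=; lra.
have := dP c cab; rewrite gtr0_norm ?subr_gt0// => /(_ _)/wrap[]; first by lra.
rewrite ler_norml df0 subr0 => /andP[_]; rewrite /GRing.scale/= => H.
have := mf y yab.
have : df c < 0 by nra.
have : 0 < y - x by lra.
nra.
Qed.

(** The derivative has the sign of [sin (om z)] with [om] increasing inside [[0, 2 pi]]: the
    function rises, then falls, and so has no interior minimum. Heights of a convex arc above a line
    are of this kind. *)
Lemma hump f w (om : R -> R) x y p : x < p < y ->
  (forall z, z \in `[x, y] ->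
     has_derivative `[x, y] f z (w z * sin (om z))) ->
  (forall z, z \in `[x, y] -> 0 < w z) ->
  {in `[x, y] &, {homo om : u v / u < v}} ->
  0 <= om x -> om y <= pi *+ 2 ->
  Num.min (f x) (f y) < f p.
Proof.
move=> /andP[xp py] hf w0 om_inc om0 om2.
have xy : x < y by lra.
have cf : {within `[x, y], continuous f} by exact: has_derivative_continuous hf.
have [m mxy mf] := EVT_min (ltW xy) cf.
have xI : x \in `[x, y] by rewrite in_itv/= lexx ltW.
have yI : y \in `[x, y] by rewrite in_itv/= lexx ltW.
have pI : p \in `[x, y] by rewrite in_itv/= !ltW.
have nomin u : x < u < y -> ~ (forall t, t \in `[x, y] -> f u <= f t).
  move=> /andP[xu uy] um.
  have uI : u \in `[x, y] by rewrite in_itv/= !ltW.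
  have [H1 H2] := derivative_at_min_segment uI um (hf _ uI).
  have s0 : w u * sin (om u) = 0 by apply/eqP; rewrite eq_le H1// H2.
  have {}s0 : sin (om u) = 0.
    by move/eqP: s0; rewrite mulf_eq0 gt_eqF ?w0//= => /eqP.
  have ou0 : 0 < om u by apply: le_lt_trans om0 _; exact: om_inc.
  have ou2 : om u < pi *+ 2 by apply: lt_le_trans om2; exact: om_inc.
  (* Beyond [pi] the sine would be negative, not zero. Before [pi] it is positive, so [f] rises on
     [[x, u]] and [u] cannot be a minimum. *)
  have oupi : om u <= pi.
    rewrite leNgt; apply/negP => oupi.
    have : 0 < sin (om u - pi).
      by apply: sin_gt0_pi; rewrite subr_gt0 oupi ltrBlDr -mulr2n.
    by rewrite sinB sinpi cospi s0 mulr0 mul0r subr0 ltxx.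
  suff : f x < f u by rewrite ltNge um.
  apply: (increasing_of_derivative xu _ hf); first exact: segment_subset_itv.
  move=> z; rewrite in_itv/= => /andP[xz zu].
  have zI : z \in `[x, y] by rewrite in_itv/=; lra.
  rewrite mulr_gt0 ?w0//; apply: sin_gt0_pi; apply/andP; split.
    by apply: le_lt_trans om0 _; exact: om_inc.
  by apply: lt_le_trans oupi; exact: om_inc.
(* If the minimum sits at an end of the segment, the assumption on [p] makes [p] an interior minimum
   as well. *)
rewrite ltNge; apply/negP => fp.
have [xm|mx] := ltP x m; last first.
  have Em : m = x by apply/eqP; rewrite eq_le mx; move: mxy; rewrite in_itv => /andP[].
  apply: (nomin p); first by rewrite xp.
  move=> t tI; apply: le_trans fp _; apply: le_trans (mf t tI).
  by rewrite ge_min Em lexx.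
have [my|ym] := ltP m y; first by apply: (nomin m) => //; rewrite xm.
have Em : m = y by apply/eqP; rewrite eq_le ym andbT; move: mxy; rewrite in_itv => /andP[].
apply: (nomin p); first by rewrite xp.
move=> t tI; apply: le_trans fp _; apply: le_trans (mf t tI).
by rewrite ge_min Em lexx orbT.
Qed.

End mean_value.

(** * Integrals of continuous functions through antiderivatives *)

Section integrals.
Context {R : realType}.
Notation mu := (@lebesgue_measure R).
Implicit Types (f F : R -> R) (a b : R).

Lemma integral_antiderivative f F a b : a < b ->
  {within `[a, b], continuous f} ->
  (forall x, x \in `[a, b] -> has_derivative `[a, b] F x (f x)) ->
  \int[mu]_(x in `[a, b]) f x = F b - F a.
Proof.
move=> ab cf hF.
have cF : {within `[a, b], continuous F} by exact: has_derivative_continuous hF.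
have dF x : x \in `]a, b[ -> is_derive x 1 F (f x).
  move=> xab; apply: (@has_derivative_is_derive _ `]a, b[).
    exact: near_in_itvoo.
  apply: has_derivative_subset (hF x _); first exact: subset_itv_oo_cc.
  exact: subset_itv_oo_cc xab.
rewrite /Rintegral (continuous_FTC2 (F := F))//=.
- move/continuous_within_itvP : cF => /(_ ab)[H1 H2 H3].
  by split => // x xab; have [] := dF x xab.
- by move=> x xab; have := dF x xab; rewrite derive1E => ?; rewrite derive_val.
Qed.

Lemma exists_antiderivative f a b : a < b -> {within `[a, b], continuous f} ->
  exists F, forall x, x \in `[a, b] -> has_derivative `[a, b] F x (f x).
Proof.
move=> ab /subspace_continuousP cf.
(* Clamping extends [f] continuously to the line; integrating from [a - 1] then makes [a] and [b]
   interior points for the fundamental theorem. *)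
pose cl x := Num.max a (Num.min b x).
have cl_in x : cl x \in `[a, b].
  by rewrite in_itv/= le_max lexx/= ge_max (ltW ab) ge_min lexx.
have cl_id x : x \in `[a, b] -> cl x = x.
  by rewrite in_itv/= => /andP[ax xb]; rewrite /cl min_r// max_r.
have cl_lip x y : `|cl x - cl y| <= `|x - y|.
  rewrite /cl; case: (ltP b x) => ?; case: (ltP b y) => ?;
   rewrite ?(min_l _ _) ?(min_r _ _) //; case: (ltP a x) => ?; case: (ltP a y) => ?;
   rewrite ?[Num.max a b]max_r ?[Num.max a x]max_r ?[Num.max a y]max_r
    ?[Num.max a x]max_l ?[Num.max a y]max_l; try lra;
   rewrite ler_norml; apply/andP; split; have := ler_norm (x - y);
   have := ler_normr (x-y) ; have := lerNnormlW (lexx `|x - y|); lra.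
pose g x := f (cl x).
have cg : continuous g.
  move=> x; apply/cvgrPdist_lt => e e0.
  have /cvgrPdist_lt/(_ _ e0) := cf _ (cl_in x).
  rewrite /prop_near1 /within/= => /nbhs_ballP[d/= d0 dP].
  apply/nbhs_ballP; exists d => //= y yd; apply: dP; last exact: cl_in.
  by rewrite /ball/=; apply: le_lt_trans yd.
pose F x := \int[mu]_(t in `[a - 1, x]) g t.
exists F => x xab.
have ax : a <= x by move: xab; rewrite in_itv => /andP[].
have xb : x <= b by move: xab; rewrite in_itv => /andP[].
have [] := @continuous_FTC1_closed R g (a - 1) x (b + 1).
- lra.
- apply: continuous_compact_integrable; first exact: segment_compact.
  exact: continuous_subspaceT.
- lra.
- exact: cg.
rewrite derive1E -/F => dF F'.
have -> : f x = 'D_1 F x by rewrite F' /g cl_id.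
move/cvg_ex : dF => [l hl].
have El : 'D_1 F x = l by rewrite /derive; exact: cvg_lim hl.
rewrite El; apply/has_derivative_epsP => e e0.
move/cvgrPdist_le : hl => /(_ _ e0).
rewrite /prop_near1 /= => /nbhs_ballP[d/= d0 dP].
exists d => // y yab yd.
have [->|yx] := eqVneq y x; first by rewrite !subrr scale0r subr0 !normr0 mulr0.
have := dP (y - x); rewrite /ball/= sub0r normrN yd => /(_ isT).
rewrite subr_eq0 => /(_ yx); rewrite /GRing.scale/= mulr1 subrK => H.
have yx0 : y - x != 0 by rewrite subr_eq0.
rewrite -[F y - F x](mulVKf yx0) -mulrBr normrM mulrC distrC.
by rewrite ler_wpM2r.
Qed.

Lemma integral_bound f a b (k : R) : a < b -> {within `[a, b], continuous f} ->
  (forall x, x \in `[a, b] -> `|f x| <= k) ->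
  `|\int[mu]_(x in `[a, b]) f x| <= k * (b - a).
Proof.
move=> ab cf fk; have [F hF] := exists_antiderivative ab cf.
rewrite (integral_antiderivative ab cf hF).
have [//|c cab ->] := mean_value ab _ hF.
rewrite normrM (gtr0_norm (_ : 0 < b - a)) ?subr_gt0//.
by rewrite ler_wpM2r ?fk ?subr_ge0 1?ltW//; exact: subset_itv_oo_cc cab.
Qed.

Lemma integralB f g a b : a < b -> {within `[a, b], continuous f} ->
  {within `[a, b], continuous g} ->
  \int[mu]_(x in `[a, b]) (f x - g x) =
  \int[mu]_(x in `[a, b]) f x - \int[mu]_(x in `[a, b]) g x.
Proof.
move=> ab cf cg; rewrite RintegralB//;
  by apply: continuous_compact_integrable => //; exact: segment_compact.
Qed.

End integrals.

(** * Functions of space and time: continuity, integrals over space, mixed derivatives *)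

Section joint_continuity.
Context {R : realType}.
Implicit Types (I J : set R) (g h : R -> R -> R).

Lemma within_continuousP_eps {U V : normedModType R} (I : set U) (f : U -> V) :
  {within I, continuous f} <->
  forall p, I p -> forall e, 0 < e -> exists2 d, 0 < d &
    forall q, I q -> `|q - p| < d -> `|f q - f p| < e.
Proof.
split=> [/subspace_continuousP cf p Ip e e0|h].
  have /cvgrPdist_lt/(_ _ e0) := cf p Ip.
  rewrite /prop_near1 /within/= => /nbhs_normP[d/= d0 dP].
  exists d => // q Iq qp; rewrite distrC; apply: dP => //=.
  by rewrite distrC.
apply/subspace_continuousP => p Ip; apply/cvgrPdist_lt => e e0.
have [d d0 dP] := h p Ip e e0.
rewrite /prop_near1 /within/=; apply/nbhs_normP; exists d => //= q qp Iq.
by rewrite distrC; apply: dP => //; rewrite distrC.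
Qed.

Lemma jointly_continuousP {V : normedModType R} I J (g : R -> R -> V) :
  jointly_continuous I J g <->
  forall p t, I p -> J t -> forall e, 0 < e -> exists2 d, 0 < d &
    forall q s, I q -> J s -> `|q - p| < d -> `|s - t| < d ->
      `|g q s - g p t| < e.
Proof.
rewrite /jointly_continuous; split.
  move=> /subspace_continuousP cg p t Ip Jt e e0.
  have /cvgrPdist_lt/(_ _ e0) := cg (p, t) (conj Ip Jt).
  rewrite /prop_near1 /within/= => /nbhs_ballP[d/= d0 dP].
  exists d => // q s Iq Js qp st.
  rewrite distrC; apply: (dP (q, s)) => //; split; by rewrite /ball/= distrC.
move=> h; apply/subspace_continuousP => -[p t] [Ip Jt].
apply/cvgrPdist_lt => e e0; have [d d0 dP] := h p t Ip Jt e e0.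
rewrite /prop_near1 /within/=; apply/nbhs_ballP; exists d => //=.
move=> -[q s] [/= qp st] [/= Iq Js].
by rewrite distrC; apply: dP => //; rewrite distrC.
Qed.

Lemma jointly_continuousD I J g h : jointly_continuous I J g ->
  jointly_continuous I J h -> jointly_continuous I J (fun p t => g p t + h p t).
Proof. by move=> cg ch x; apply: cvgD; [exact: cg|exact: ch]. Qed.

Lemma jointly_continuousM I J g h : jointly_continuous I J g ->
  jointly_continuous I J h -> jointly_continuous I J (fun p t => g p t * h p t).
Proof. by move=> cg ch x; apply: cvgM; [exact: cg|exact: ch]. Qed.

Lemma jointly_continuousN I J g : jointly_continuous I J g ->
  jointly_continuous I J (fun p t => - g p t).
Proof. by move=> cg x; apply: cvgN; exact: cg. Qed.

Lemma jointly_continuous_comp I J g (f : R -> R) :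
  (forall p t, I p -> J t -> {for g p t, continuous f}) ->
  jointly_continuous I J g -> jointly_continuous I J (fun p t => f (g p t)).
Proof.
move=> cf /subspace_continuousP cg; apply/subspace_continuousP => -[p t] [/= Ip Jt].
exact: cvg_comp (cg (p, t) (conj Ip Jt)) (cf _ _ Ip Jt).
Qed.

Lemma jointly_continuousV I J g : (forall p t, I p -> J t -> g p t != 0) ->
  jointly_continuous I J g -> jointly_continuous I J (fun p t => (g p t)^-1).
Proof.
move=> g0; apply: jointly_continuous_comp => p t Ip Jt.
exact: inv_continuous (g0 _ _ Ip Jt).
Qed.

Lemma jointly_continuous_sqrt I J g : jointly_continuous I J g ->
  jointly_continuous I J (fun p t => Num.sqrt (g p t)).
Proof. by apply: jointly_continuous_comp => p t _ _; exact: sqrt_continuous. Qed.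

Lemma jointly_continuous_fst I J (g : R -> R -> R * R) :
  jointly_continuous I J g -> jointly_continuous I J (fun p t => (g p t).1).
Proof.
move=> /subspace_continuousP cg; apply/subspace_continuousP => z Iz.
exact: cvg_comp (cg z Iz) cvg_fst.
Qed.

Lemma jointly_continuous_snd I J (g : R -> R -> R * R) :
  jointly_continuous I J g -> jointly_continuous I J (fun p t => (g p t).2).
Proof.
move=> /subspace_continuousP cg; apply/subspace_continuousP => z Iz.
exact: cvg_comp (cg z Iz) cvg_snd.
Qed.

Lemma jointly_continuous_left I J (f : R -> R) : {within I, continuous f} ->
  jointly_continuous I J (fun p _ => f p).
Proof.
move=> /subspace_continuousP cf; apply/jointly_continuousP => p t Ip _ e e0.
have /cvgrPdist_lt/(_ _ e0) := cf p Ip.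
rewrite /prop_near1 /within/= => /nbhs_ballP[d/= d0 dP].
exists d => // q s Iq _ qp _; rewrite distrC; apply: dP => //.
by rewrite /ball/= distrC.
Qed.

Lemma jointly_continuous_right I J (f : R -> R) : {within J, continuous f} ->
  jointly_continuous I J (fun _ t => f t).
Proof.
move=> /subspace_continuousP cf; apply/jointly_continuousP => p t _ Jt e e0.
have /cvgrPdist_lt/(_ _ e0) := cf t Jt.
rewrite /prop_near1 /within/= => /nbhs_ballP[d/= d0 dP].
exists d => // q s _ Js _ st; rewrite distrC; apply: dP => //.
by rewrite /ball/= distrC.
Qed.

Lemma jointly_continuous_slice I J g t : J t -> jointly_continuous I J g ->
  {within I, continuous (g^~ t)}.
Proof.
move=> Jt /jointly_continuousP cg; apply/within_continuousP_eps => p Ip e e0.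
have [d d0 dP] := cg p t Ip Jt e e0.
by exists d => // q Iq qp; apply: dP; rewrite // subrr normr0.
Qed.

Lemma jointly_continuous_time I J g p : I p -> jointly_continuous I J g ->
  {within J, continuous (g p)}.
Proof.
move=> Ip /jointly_continuousP cg; apply/within_continuousP_eps => t Jt e e0.
have [d d0 dP] := cg p t Ip Jt e e0.
by exists d => // q Iq qp; apply: dP; rewrite // subrr normr0.
Qed.

Lemma jointly_continuousW {V : normedModType R} I J I' J' (g : R -> R -> V) :
  I' `<=` I -> J' `<=` J ->
  jointly_continuous I J g -> jointly_continuous I' J' g.
Proof.
move=> II JJ; apply: continuous_subspaceW => z [/= h1 h2]; split.
  exact: II.
exact: JJ.
Qed.

Lemma eq_jointly_continuous I J g h :
  (forall p t, I p -> J t -> g p t = h p t) ->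
  jointly_continuous I J g -> jointly_continuous I J h.
Proof.
move=> gh /jointly_continuousP cg; apply/jointly_continuousP.
move=> p t Ip Jt e e0; have [d d0 dP] := cg p t Ip Jt e e0.
by exists d => // q s Iq Js qp st; rewrite -!gh//; exact: dP.
Qed.

Lemma jointly_continuous_bounded a b c d g : jointly_continuous `[a, b] `[c, d] g ->
  exists2 k, 0 < k & forall p t, p \in `[a, b] -> t \in `[c, d] -> `|g p t| <= k.
Proof.
move=> cg.
have cK : compact (`[a, b] `*` `[c, d]).
  by apply: compact_setX; exact: segment_compact.
have /ex_strict_bound_gt0[k k0 /= kP] :
    bounded_set ((fun z : R * R => g z.1 z.2) @` (`[a, b] `*` `[c, d])).
  by apply: compact_bounded; apply: continuous_compact.
by exists k => // p t pI tI; rewrite ltW// kP//; exists (p, t).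
Qed.

(** Compactness is used in space only, because the time interval is half-open. *)
Lemma uniform_in_time a b J g t e : jointly_continuous `[a, b] J g -> J t ->
  0 < e -> exists2 d, 0 < d & forall p s, p \in `[a, b] -> J s -> `|s - t| < d ->
    `|g p s - g p t| < e.
Proof.
move=> /jointly_continuousP cg Jt e0.
have /compact_near_coveringP/(_ R (nbhs t)
  (fun s p => J s -> p \in `[a, b] -> `|g p s - g p t| < e)) :=
  @segment_compact R a b.
move=> /(_ _ _)/wrap[].
  move=> p pI; have [|d d0 dP] := cg p t pI Jt (e / 2); first by rewrite divr_gt0.
  exists (ball p d, ball t d) => /=; first by split; exact: nbhsx_ballx.
  move=> -[q s] [/= pq ts] Js qI.
  have := dP q s qI Js; have := dP q t qI Jt.
  rewrite subrr normr0 [`|q - p|]distrC => /(_ pq d0) h1.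
  rewrite [`|s - t|]distrC => /(_ pq ts) h2.
  rewrite -[g q s - _](subrKA (g p t)).
  apply: le_lt_trans (ler_normD _ _) _.
  rewrite [ltRHS](splitr e) ltrD// distrC//.
move=> /nbhs_ballP[d/= d0 dP]; exists d => // p s pI Js st.
by apply: dP => //; rewrite /ball/= distrC.
Qed.

Lemma integral_continuous a b J g : a < b -> jointly_continuous `[a, b] J g ->
  {within J, continuous (fun t => \int[lebesgue_measure]_(p in `[a, b]) g p t)}.
Proof.
move=> ab cg; apply/within_continuousP_eps => t Jt e e0.
have [|d d0 dP] := uniform_in_time (e := e / 2 / (b - a)) cg Jt.
  by rewrite !divr_gt0// subr_gt0.
exists d => // s Js st.
rewrite -integralB//; [|exact: jointly_continuous_slice cg..].
apply: (@le_lt_trans _ _ (e / 2 / (b - a) * (b - a))); last first.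
  by rewrite divfK ?subr_eq0 ?gt_eqF//; lra.
apply: integral_bound => //.
  move=> x; apply: continuousB; exact: (jointly_continuous_slice _ cg).
by move=> p pI; rewrite ltW// dP.
Qed.

Definition interval_like (A : set R) := forall x y, A x -> A y -> `[x, y] `<=` A.

Lemma mean_value_unordered (A : set R) (f df : R -> R) x y : interval_like A ->
  (forall z, A z -> has_derivative A f z (df z)) -> A x -> A y ->
  exists c, [/\ A c, `|c - x| <= `|y - x|, `|c - y| <= `|y - x| &
    f y - f x = df c * (y - x)].
Proof.
move=> cA hf Ax Ay; case: (ltgtP x y) => [xy|yx|->].
- have [|c] := mean_value xy _ hf; first exact: cA.
  rewrite in_itv/= => /andP[xc cy] ->; exists c.
  rewrite (gtr0_norm (_ : 0 < c - x)) ?subr_gt0//.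
  rewrite (gtr0_norm (_ : 0 < y - x)) ?subr_gt0//.
  rewrite (ltr0_norm (_ : c - y < 0)) ?subr_lt0//.
  split=> //; [|lra|lra].
  by apply: (cA _ _ Ax Ay); rewrite /= in_itv/= !ltW.
- have [|c] := mean_value yx _ hf; first exact: cA.
  rewrite in_itv/= => /andP[yc cx] E; exists c.
  rewrite (ltr0_norm (_ : c - x < 0)) ?subr_lt0//.
  rewrite (ltr0_norm (_ : y - x < 0)) ?subr_lt0//.
  rewrite (gtr0_norm (_ : 0 < c - y)) ?subr_gt0//.
  split=> //; [|lra|lra|].
    by apply: (cA _ _ Ay Ax); rewrite /= in_itv/= !ltW.
  by rewrite -opprB E; ring.
- by exists y; rewrite !subrr mulr0.
Qed.

(** The mean value theorem in time turns the error of the difference quotient into an oscillation of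
    [gt], which is small uniformly in [p]. *)
Lemma derivative_under_integral a b J g gt t : a < b -> interval_like J ->
  jointly_continuous `[a, b] J g -> jointly_continuous `[a, b] J gt ->
  (forall p s, p \in `[a, b] -> J s -> has_derivative J (g p) s (gt p s)) ->
  J t ->
  has_derivative J (fun t => \int[lebesgue_measure]_(p in `[a, b]) g p t) t
    (\int[lebesgue_measure]_(p in `[a, b]) gt p t).
Proof.
move=> ab cJ cg cgt hg Jt; apply/has_derivative_epsP => e e0.
have [|d d0 dP] := uniform_in_time (e := e / (b - a)) cgt Jt.
  by rewrite !divr_gt0// subr_gt0.
exists d => // s Js st.
have c1 u : J u -> {within `[a, b], continuous (g^~ u)}.
  by move=> Ju; exact: jointly_continuous_slice cg.
have c2 : {within `[a, b], continuous (gt^~ t)}.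
  exact: jointly_continuous_slice cgt.
have c3 : {within `[a, b], continuous (fun p => g p s - g p t)}.
  by move=> x; apply: continuousB; exact: c1.
have c4 : {within `[a, b], continuous (fun p => (s - t) * gt p t)}.
  by move=> x; apply: cvgM; [exact: cvg_cst|exact: c2].
rewrite -(integralB ab (c1 _ Js) (c1 _ Jt)).
rewrite /GRing.scale/= -RintegralZl//; last first.
  by apply: continuous_compact_integrable => //; exact: segment_compact.
rewrite -integralB//.
apply: le_trans (@integral_bound _ _ a b (e / (b - a) * `|s - t|) ab _ _) _.
- by move=> x; apply: cvgB; [exact: c3|exact: c4].
- move=> p pI.
  have [c [Jc ct _ ->]] := mean_value_unordered cJ (hg p ^~ pI) Jt Js.
  rewrite [_ * gt p t]mulrC -mulrBl normrM ler_wpM2r// ltW//.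
  by apply: dP => //; apply: le_lt_trans st.
- by rewrite mulrAC divfK// subr_eq0 gt_eqF.
Qed.

(** The second difference over a small rectangle with corner [(p, t)], taken in either order, is its
    area times a mixed derivative at an intermediate point. The rectangle may lie on any side, so
    boundary points are included. *)
Lemma mixed_derivatives_commute I J (f fp ft fpt ftp : R -> R -> R) :
  interval_like I -> interval_like J ->
  (forall p, I p -> limit_point_of I p) -> (forall t, J t -> limit_point_of J t) ->
  (forall p t, I p -> J t -> has_derivative I (f^~ t) p (fp p t)) ->
  (forall p t, I p -> J t -> has_derivative J (f p) t (ft p t)) ->
  (forall p t, I p -> J t -> has_derivative J (fp p) t (fpt p t)) ->
  (forall p t, I p -> J t -> has_derivative I (ft^~ t) p (ftp p t)) ->
  jointly_continuous I J fpt -> jointly_continuous I J ftp ->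
  forall p t, I p -> J t -> fpt p t = ftp p t.
Proof.
move=> cI cJ lI lJ hp ht hpt htp /jointly_continuousP c1 /jointly_continuousP c2.
move=> p t Ip Jt; apply/eqP; rewrite -subr_eq0; apply/negPn/negP => n0.
set e := `|fpt p t - ftp p t| in n0 *.
have e0 : 0 < e by rewrite /e normr_gt0.
have [|d1 d10 P1] := c1 p t Ip Jt (e / 2); first lra.
have [|d2 d20 P2] := c2 p t Ip Jt (e / 2); first lra.
pose d := Num.min d1 d2.
have d0 : 0 < d by rewrite lt_min d10.
have dd1 : d <= d1 by rewrite ge_min lexx.
have dd2 : d <= d2 by rewrite ge_min lexx orbT.
have [q [Iq qp qd]] := lI p Ip d d0.
have [s [Js ts sd]] := lJ t Jt d d0.
have hk u : J u -> has_derivative J (fun u => f q u - f p u) u (ft q u - ft p u).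
  by move=> Ju; apply: has_derivativeB; exact: ht.
have [u [Ju ut _ Eu]] := mean_value_unordered cJ hk Jt Js.
have [v [Iv vp _ Ev]] := mean_value_unordered cI (fun p Ip => htp p u Ip Ju) Ip Iq.
have hl u' : I u' -> has_derivative I (fun u => f u s - f u t) u' (fp u' s - fp u' t).
  by move=> Iu; apply: has_derivativeB; exact: hp.
have [x [Ix xp _ Ex]] := mean_value_unordered cI hl Ip Iq.
have [y [Jy yt _ Ey]] := mean_value_unordered cJ (fun u => hpt x u Ix) Jt Js.
have E : fpt x y = ftp v u.
  have : fpt x y * (s - t) * (q - p) = ftp v u * (q - p) * (s - t).
    by rewrite -Ey -Ex -Ev -Eu; ring.
  rewrite [RHS]mulrAC => /(mulIf _)/wrap[]; first by rewrite subr_eq0.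
  by move=> /(mulIf _)/wrap[]//; rewrite subr_eq0.
have h1 : `|fpt x y - fpt p t| < e / 2.
  apply: P1 => //; apply: lt_le_trans dd1; [exact: le_lt_trans qd|exact: le_lt_trans sd].
have h2 : `|ftp v u - ftp p t| < e / 2.
  apply: P2 => //; apply: lt_le_trans dd2; [exact: le_lt_trans qd|exact: le_lt_trans sd].
have : e < e / 2 + e / 2.
  rewrite {1}/e -(subrKA (fpt x y)) {2}E; apply: le_lt_trans (ler_normD _ _) _.
  by rewrite ltrD// distrC.
lra.
Qed.

End joint_continuity.

(** * Angles of unit vectors and their continuous lifts *)

Section angles.
Context {R : realType}.
Implicit Types (x y th : R).

Lemma exists_angle x y : x ^+ 2 + y ^+ 2 = 1 ->
  exists th, x = cos th /\ y = sin th.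
Proof.
move=> xy1.
have x1 : -1 <= x <= 1.
  by apply/andP; split; rewrite leNgt; apply/negP => ?; have := sqr_ge0 y; nra.
have cx : cos (acos x) = x by rewrite acosK// in_itv.
have s0 : 0 <= sin (acos x) by apply: sin_ge0_pi; rewrite acos_ge0// acos_lepi.
have s2 : sin (acos x) ^+ 2 = y ^+ 2.
  by apply/eqP; have := cos2Dsin2 (acos x); rewrite cx => ?; apply/eqP; lra.
have [y0|y0] := leP 0 y.
  exists (acos x); split=> //; apply/eqP.
  by rewrite -(eqrXn2 (n := 2))//; apply/eqP; rewrite s2.
exists (- acos x); rewrite cosN sinN; split=> //; apply/eqP.
rewrite -eqr_opp opprK -(eqrXn2 (n := 2))//; last by lra.
by rewrite s2 sqrrN.
Qed.

Lemma sin_eq0_small x : sin x = 0 -> `|x| < pi -> x = 0.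
Proof.
move=> sx; rewrite ltr_norml => /andP[x1 x2].
case: (ltgtP x 0) => // x0.
- have : 0 < sin (- x) by apply: sin_gt0_pi; lra.
  by rewrite sinN sx oppr0 ltxx.
- have : 0 < sin x by apply: sin_gt0_pi; lra.
  by rewrite sx ltxx.
Qed.

(** To leave []-pi, pi[], a continuous function must take one of the values [-pi] and [pi], where
    the cosine is [-1]. *)
Lemma continuous_angle_barrier (f : R -> R) a b x0 y :
  {within `[a, b], continuous f} -> x0 \in `[a, b] -> y \in `[a, b] ->
  `|f x0| < pi -> (forall x, x \in `[a, b] -> cos (f x) != -1) ->
  `|f y| < pi.
Proof.
move=> cf xI yI fx0 hc; rewrite ltNge; apply/negP => fy.
suff [z zI fz] : exists2 z, z \in `[a, b] & `|f z| = pi.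
  have := hc z zI; move: fz; have [f0|f0] := leP 0 (f z).
    by rewrite ger0_norm// => ->; rewrite cospi eqxx.
  by rewrite ltr0_norm// => fz; rewrite -cosN fz cospi eqxx.
have cg : {within `[a, b], continuous (fun z => `|f z|)}.
  by move=> z; apply: continuous_comp; [exact: cf|exact: norm_continuous].
have [xy|yx] := leP x0 y.
  have sub : `[x0, y] `<=` `[a, b] by exact: segment_subset_itv.
  have [|z zI E] := @IVT _ (fun z => `|f z|) x0 y pi xy (continuous_subspaceW sub cg).
    by rewrite ge_min le_max fy (ltW fx0)/= orbT.
  by exists z => //; exact: sub.
have sub : `[y, x0] `<=` `[a, b] by exact: segment_subset_itv.
have [|z zI E] := @IVT _ (fun z => `|f z|) y x0 pi (ltW yx) (continuous_subspaceW sub cg).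
  by rewrite ge_min le_max fy (ltW fx0)/= orbT.
by exists z => //; exact: sub.
Qed.

(* Subdivide the segments issued from z0 so finely that consecutive values of
   h make an angle less than pi / 2, then add up these angles. *)
Lemma exists_angle_lift (A : set (R * R)) (z0 : R * R) (h1 h2 : R * R -> R) :
  compact A -> A z0 ->
  (forall z (l : R), A z -> 0 <= l <= 1 -> A (z0 + l *: (z - z0))) ->
  {within A, continuous h1} -> {within A, continuous h2} ->
  (forall z, A z -> h1 z ^+ 2 + h2 z ^+ 2 = 1) ->
  exists th : R * R -> R, {within A, continuous th} /\
    forall z, A z -> h1 z = cos (th z) /\ h2 z = sin (th z).
Proof.
move=> cA A0 starA c1 c2 h12.
(* The inner product of two unit vectors is one minus half their squared distance. *)
have close z w : A z -> A w -> `|h1 z - h1 w| < 2^-1 -> `|h2 z - h2 w| < 2^-1 ->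
    0 < h1 z * h1 w + h2 z * h2 w.
  move=> Az Aw; rewrite !ltr_norml => /andP[? ?] /andP[? ?].
  have := h12 z Az; have := h12 w Aw; nra.
have [del del0 delP] : exists2 d : R, 0 < d & forall z w, A z -> A w ->
    `|z - w| < d -> 0 < h1 z * h1 w + h2 z * h2 w.
  have /compact_near_coveringP/(_ R (nbhs (0:R)) (fun d z => A z -> forall w, A w ->
     `|z - w| < d -> 0 < h1 z * h1 w + h2 z * h2 w)) := cA.
  move=> /(_ _ _)/wrap[].
    move=> z Az.
    have /within_continuousP_eps/(_ z Az (4^-1) _)/wrap[] := c1; first by rewrite invr_gt0.
    move=> [d1 d10 P1].
    have /within_continuousP_eps/(_ z Az (4^-1) _)/wrap[] := c2; first by rewrite invr_gt0.
    move=> [d2 d20 P2].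
    pose d := Num.min d1 d2 / 2.
    have d0 : 0 < d by rewrite divr_gt0// lt_min d10.
    have dd1 : d * 2 <= d1 by rewrite divfK// ge_min lexx.
    have dd2 : d * 2 <= d2 by rewrite divfK// ge_min lexx orbT.
    exists (ball z d, ball 0 d) => /=; first by split; exact: nbhsx_ballx.
    move=> -[z' e] [/= [zz1 zz2] e0] Az' w Aw z'w.
    have z'z : `|z' - z| < d by rewrite distrC prod_normE/= gt_max; apply/andP.
    have ed : e < d by move: e0; rewrite /ball/= sub0r normrN; apply: le_lt_trans (ler_norm _).
    have wz : `|w - z| < d * 2.
      rewrite -(subrKA z'); apply: le_lt_trans (ler_normD _ _) _.
      by rewrite mulr_natr mulr2n ltrD// distrC (lt_trans z'w).
    have half (g : R * R -> R) : `|g z' - g z| < 4^-1 -> `|g w - g z| < 4^-1 ->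
        `|g z' - g w| < 2^-1.
      rewrite !ltr_norml => /andP[? ?] /andP[? ?]; apply/andP; split; lra.
    apply: close => //; apply: half.
    - by apply: P1 => //; lra.
    - by apply: P1 => //; lra.
    - by apply: P2 => //; lra.
    - by apply: P2 => //; lra.
  move=> /nbhs_ballP[d/= d0 dP]; exists (d / 2); first by lra.
  move=> z w Az Aw zw; apply: (dP (d / 2)) => //.
  by rewrite /ball/= sub0r normrN gtr0_norm; lra.
have [B B0 BP] : exists2 B : R, 0 < B & forall z, A z -> `|z - z0| < B.
  have /ex_strict_bound_gt0[B B0 BP] := compact_bounded cA.
  exists (B + `|z0|); first by rewrite ltr_wpDr.
  by move=> z Az; apply: le_lt_trans (ler_normB _ _) _; rewrite ltrD2r; exact: BP.
(* One of [N] equal steps along a segment from [z0] is shorter than [B / N], hence than [del]; the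
   successor keeps [N] positive. *)
pose N := (Num.bound (B / del)).+1.
have NB : B / N%:R < del.
  rewrite ltr_pdivrMr ?ltr0n// mulrC -ltr_pdivrMr//.
  apply: lt_le_trans (archi_boundP _) _; first by rewrite divr_ge0 ?ltW.
  by rewrite ler_nat.
pose s n (z : R * R) := z0 + (n%:R / N%:R) *: (z - z0).
have N0 : (0 : R) < N%:R by rewrite ltr0n.
have sA n z : (n <= N)%N -> A z -> A (s n z).
  move=> nN Az; apply: starA => //; rewrite divr_ge0//= ler_pdivrMr// mul1r ler_nat//.
have cs (h : R * R -> R) n : (n <= N)%N -> {within A, continuous h} ->
    {within A, continuous (fun z => h (s n z))}.
  move=> nN /within_continuousP_eps ch; apply/within_continuousP_eps => z Az e e0.
  have [d d0 dP] := ch _ (sA n z nN Az) e e0.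
  exists d => // w Aw wz; apply: dP; first exact: sA.
  rewrite /s opprD addrACA subrr add0r -scalerBr opprB subrKA.
  rewrite normrZ ger0_norm; last by rewrite divr_ge0.
  apply: le_lt_trans wz; rewrite ler_piMl// ler_pdivrMr// mul1r ler_nat//.
suff H n : (n <= N)%N -> exists th : R * R -> R, {within A, continuous th} /\
    forall z, A z -> h1 (s n z) = cos (th z) /\ h2 (s n z) = sin (th z).
  have [th [cth thP]] := H N (leqnn N).
  exists th; split=> // z Az; have := thP z Az.
  by rewrite /s divff ?gt_eqF// scale1r addrC subrK.
elim: n => [_|n IH nN].
  have [t0 [E1 E2]] := exists_angle (h12 z0 A0).
  exists (fun=> t0); split; first by move=> z; exact: cvg_cst.
  by move=> z Az; rewrite /s mul0r scale0r addr0.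
have [th [cth thP]] := IH (ltnW nN).
(* [cr] and [dt] are the sine and cosine of the angle added in this step. As [dt] is positive, the
   angle is [asin (cr z)], with [cr z] inside the interval where [asin] is continuous. *)
pose cr z := h1 (s n z) * h2 (s n.+1 z) - h2 (s n z) * h1 (s n.+1 z).
pose dt z := h1 (s n z) * h1 (s n.+1 z) + h2 (s n z) * h2 (s n.+1 z).
have dt0 z : A z -> 0 < dt z.
  move=> Az; apply: delP; [exact/sA/Az/ltnW|exact: sA|].
  rewrite /s opprD addrACA subrr add0r -scalerBl -mulrBl -natr1 opprD addNKr.
  rewrite normrZ mulN1r normrN ger0_norm ?invr_ge0 ?ltW//.
  apply: lt_trans NB; rewrite mulrC ltr_pM2r ?invr_gt0//; exact: BP.
have crdt z : A z -> cr z ^+ 2 + dt z ^+ 2 = 1.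
  move=> Az; have e1 := h12 _ (sA n z (ltnW nN) Az); have e2 := h12 _ (sA n.+1 z nN Az).
  have -> : cr z ^+ 2 + dt z ^+ 2 = (h1 (s n z) ^+ 2 + h2 (s n z) ^+ 2) *
    (h1 (s n.+1 z) ^+ 2 + h2 (s n.+1 z) ^+ 2) by rewrite /cr /dt; ring.
  by rewrite e1 e2 mulr1.
have cr1 z : A z -> -1 < cr z < 1.
  move=> Az; have := crdt z Az; have := dt0 z Az => ? ?.
  by apply/andP; split; nra.
exists (fun z => th z + asin (cr z)); split.
  have ccr : {within A, continuous cr}.
    have a1 := cs h1 n (ltnW nN) c1; have a2 := cs h2 n (ltnW nN) c2.
    have b1 := cs h1 n.+1 nN c1; have b2 := cs h2 n.+1 nN c2.
    move=> z; apply: cvgB; apply: cvgM; [exact: a1|exact: b2|exact: a2|exact: b1].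
  move=> z; apply: cvgD; first exact: cth.
  move: z; apply/subspace_continuousP => z Az.
  move/subspace_continuousP : ccr => /(_ z Az) ccr.
  exact: cvg_comp ccr (continuous_asin (cr1 z Az)).
move=> z Az; have [E1 E2] := thP z Az.
have sE : sin (asin (cr z)) = cr z.
  by apply: asinK; have /andP[? ?] := cr1 z Az; rewrite in_itv/= !ltW.
have cE : cos (asin (cr z)) = dt z.
  have h0 : 0 <= cos (asin (cr z)).
    have /andP[? ?] := cr1 z Az.
    apply: cos_ge0_pihalf; apply/andP; split; [apply: asin_geNpi2|apply: asin_lepi2]; lra.
  apply/eqP; rewrite -(eqrXn2 (n := 2))//; last exact/ltW/dt0.
  have := cos2Dsin2 (asin (cr z)); rewrite sE => ?; have := crdt z Az => ?.
  by apply/eqP; lra.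
rewrite cosD sinD sE cE -E1 -E2 /cr /dt.
have := h12 _ (sA n z (ltnW nN) Az) => e1.
split.
- transitivity (h1 (s n.+1 z) * (h1 (s n z) ^+ 2 + h2 (s n z) ^+ 2)); last by ring.
  by rewrite e1 mulr1.
- transitivity (h2 (s n.+1 z) * (h1 (s n z) ^+ 2 + h2 (s n z) ^+ 2)); last by ring.
  by rewrite e1 mulr1.
Qed.

End angles.

(** * Tangent angles and the turning of embedded arcs *)

Section turning.
Context {R : realType}.
Variables (a b : R).
Hypothesis ab : a < b.

(** [(C, S)] and the unit vector of angle [om] solve the same linear system, so their scalar and
    cross products are constant; at [a] these are 1 and 0. *)
Lemma turning_angle (C S k ph : R -> R) :
  (forall p, p \in `[a, b] -> has_derivative `[a, b] C p (- (k p * S p))) ->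
  (forall p, p \in `[a, b] -> has_derivative `[a, b] S p (k p * C p)) ->
  (forall p, p \in `[a, b] -> has_derivative `[a, b] ph p (k p)) ->
  C a ^+ 2 + S a ^+ 2 = 1 ->
  exists th, forall p, p \in `[a, b] ->
    C p = cos (th + ph p) /\ S p = sin (th + ph p).
Proof.
move=> hC hS hp /exists_angle[t0 [Ca Sa]].
exists (t0 - ph a) => p pI.
have aI : a \in `[a, b] by rewrite in_itv/= lexx ltW.
have sub : `[a, p] `<=` `[a, b] by exact: segment_subset_itv.
have ap : a <= p by move: pI; rewrite in_itv => /andP[].
pose om q := t0 - ph a + ph q.
have hom q : q \in `[a, b] -> has_derivative `[a, b] om q (k q).
  move=> qI; rewrite -[k q]add0r; apply: has_derivativeD (hp _ qI).
  exact: has_derivative_cst.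
have oma : om a = t0 by rewrite /om subrK.
have E1 : C p * cos (om p) + S p * sin (om p) = 1.
  have -> : 1 = C a * cos (om a) + S a * sin (om a).
    by rewrite oma Ca Sa -!expr2 cos2Dsin2.
  apply/esym/(@constant_of_derivative _ `[a, b]
    (fun q => C q * cos (om q) + S q * sin (om q))) => // q qI.
  set l := (X in has_derivative _ _ _ X).
  have -> : l = (- (k q * S q)) * cos (om q) + C q * (- sin (om q) * k q) +
     ((k q * C q) * sin (om q) + S q * (cos (om q) * k q)) by rewrite /l; ring.
  apply: has_derivativeD; apply: has_derivativeM; [exact: hC| |exact: hS|].
    exact/has_derivative_cos/hom.
  exact/has_derivative_sin/hom.
have E2 : S p * cos (om p) - C p * sin (om p) = 0.
  have -> : 0 = S a * cos (om a) - C a * sin (om a).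
    by rewrite oma Ca Sa; ring.
  apply/esym/(@constant_of_derivative _ `[a, b]
    (fun q => S q * cos (om q) - C q * sin (om q))) => // q qI.
  set l := (X in has_derivative _ _ _ X).
  have -> : l = (k q * C q) * cos (om q) + S q * (- sin (om q) * k q) -
     ((- (k q * S q)) * sin (om q) + C q * (cos (om q) * k q)) by rewrite /l; ring.
  apply: has_derivativeB; apply: has_derivativeM; [exact: hS| |exact: hC|].
    exact/has_derivative_cos/hom.
  exact/has_derivative_sin/hom.
rewrite -/(om p); have E3 := cos2Dsin2 (om p).
split.
  transitivity (C p * (cos (om p) ^+ 2 + sin (om p) ^+ 2)); first by rewrite E3 mulr1.
  transitivity ((C p * cos (om p) + S p * sin (om p)) * cos (om p) -
    (S p * cos (om p) - C p * sin (om p)) * sin (om p)); first by ring.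
  by rewrite E1 E2; ring.
transitivity (S p * (cos (om p) ^+ 2 + sin (om p) ^+ 2)); first by rewrite E3 mulr1.
transitivity ((C p * cos (om p) + S p * sin (om p)) * sin (om p) +
  (S p * cos (om p) - C p * sin (om p)) * cos (om p)); first by ring.
by rewrite E1 E2; ring.
Qed.

(** Dividing by [t - s] makes the secant symmetric in its two parameters and continuous across the
    diagonal, so that Hopf's argument can run on a full square instead of a triangle. *)
Definition slope (f df : R -> R) (s t : R) : R :=
  if s == t then df s else (f t - f s) / (t - s).

Lemma slope_continuous (f df : R -> R) :
  (forall p, p \in `[a, b] -> has_derivative `[a, b] f p (df p)) ->
  {within `[a, b], continuous df} ->
  {within `[a, b] `*` `[a, b], continuous (fun z => slope f df z.1 z.2)}.
Proof.
move=> hf /within_continuousP_eps cdf.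
have cf : {within `[a, b], continuous f} by exact: has_derivative_continuous hf.
apply/(@jointly_continuousP R R `[a, b] `[a, b] (slope f df)) => s0 t0 sI tI e e0.
have [<-|st] := eqVneq s0 t0.
  have [d d0 dP] := cdf s0 sI e e0.
  exists d => // s t {}sI {}tI ss ts.
  rewrite {2}/slope eqxx /slope; case: eqVneq => [_|st]; first exact: dP.
  have [c [cI cs ct ->]] := mean_value_unordered (@segment_subset_itv _ _) hf sI tI.
  rewrite mulfK ?subr_eq0 1?eq_sym//; apply: dP => //.
  have /andP[h1 h2] : - d < c - s0 < d.
    move: ss ts cs ct; rewrite !ltr_norml !ler_norml => /andP[? ?] /andP[? ?].
    case: (leP s t) => h.
      by rewrite (ger0_norm (_ : 0 <= t - s)) ?subr_ge0// => /andP[? ?] /andP[? ?];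
       apply/andP; split; lra.
    by rewrite (ltr0_norm (_ : t - s < 0)) ?subr_lt0// => /andP[? ?] /andP[? ?];
       apply/andP; split; lra.
  by rewrite ltr_norml h1.
(* Within this radius the two parameters cannot meet, and [slope] is an ordinary quotient. *)
pose r := `|t0 - s0| / 2.
have r0 : 0 < r by rewrite divr_gt0// normr_gt0 subr_eq0 eq_sym.
have dis s t : `|s - s0| < r -> `|t - t0| < r -> t - s != 0.
  move=> ss tt; apply/negP => /eqP E.
  have : `|t0 - s0| < r + r.
    have -> : t0 - s0 = (s - s0) - (t - t0) by move: E; lra.
    by apply: le_lt_trans (ler_normB _ _) _; rewrite ltrD.
  by rewrite /r -splitr ltxx.
have : jointly_continuous (`[a, b] `&` [set s | `|s - s0| < r])
    (`[a, b] `&` [set t | `|t - t0| < r]) (fun s t => (f t - f s) * (t - s)^-1).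
  apply: jointly_continuousM.
    apply: jointly_continuousD.
      by apply: jointly_continuous_right; apply: continuous_subspaceW cf => ? [].
    apply/jointly_continuousN/jointly_continuous_left.
    by apply: continuous_subspaceW cf => ? [].
  apply: jointly_continuousV; first by move=> p t [_ h1] [_ h2]; exact: dis.
  apply: jointly_continuousD.
    by apply: jointly_continuous_right; apply: continuous_subspaceT => x; exact: cvg_id.
  apply/jointly_continuousN/jointly_continuous_left.
  by apply: continuous_subspaceT => x; exact: cvg_id.
move/jointly_continuousP => /(_ s0 t0 _ _ e e0)/wrap[].
- by split=> //=; rewrite subrr normr0.
- by split=> //=; rewrite subrr normr0.
move=> [d d0 dP]; exists (Num.min d r); first by rewrite lt_min d0.
move=> s t {}sI {}tI; rewrite !lt_min => /andP[s1 s2] /andP[t1 t2].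
have ts := dis s t s2 t2.
rewrite /slope (negbTE st) ifF; first exact: dP.
by apply/negP => /eqP E; rewrite E subrr eqxx in ts.
Qed.

(* Hopf's argument: the direction of f t - f s, extended by the tangent on the
   diagonal, lifts to a continuous angle on the square of parameters. The
   difference of the tangent angles at the endpoints is the sum of the changes
   of this angle along s = a and along t = b, and each of them is less than pi
   since the direction opposite to the tangent is avoided there. *)
Lemma embedded_turning_lt (f1 f2 v ph : R -> R) :
  (forall p, p \in `[a, b] -> 0 < v p) ->
  {within `[a, b], continuous v} -> {within `[a, b], continuous ph} ->
  (forall p, p \in `[a, b] -> has_derivative `[a, b] f1 p (v p * cos (ph p))) ->
  (forall p, p \in `[a, b] -> has_derivative `[a, b] f2 p (v p * sin (ph p))) ->
  (forall s t, s \in `[a, b] -> t \in `[a, b] -> f1 s = f1 t -> f2 s = f2 t -> s = t) ->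
  (forall t r, t \in `[a, b] -> 0 < r -> f1 t - f1 a = - (r * cos (ph a)) ->
     f2 t - f2 a = - (r * sin (ph a)) -> False) ->
  (forall s r, s \in `[a, b] -> 0 < r -> f1 b - f1 s = - (r * cos (ph b)) ->
     f2 b - f2 s = - (r * sin (ph b)) -> False) ->
  `|ph b - ph a| < pi *+ 2.
Proof.
move=> v0 cv cph hf1 hf2 inj rayA rayB.
have aI : a \in `[a, b] by rewrite in_itv/= lexx ltW.
have bI : b \in `[a, b] by rewrite in_itv/= lexx ltW.
have ccos : {within `[a, b], continuous (fun p => v p * cos (ph p))}.
  move=> p; apply: cvgM; first exact: cv.
  by apply: continuous_comp; [exact: cph|exact: continuous_cos].
have csin : {within `[a, b], continuous (fun p => v p * sin (ph p))}.
  move=> p; apply: cvgM; first exact: cv.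
  by apply: continuous_comp; [exact: cph|exact: continuous_sin].
have := slope_continuous hf1 ccos; set q1 := slope f1 _ => cq1.
have := slope_continuous hf2 csin; set q2 := slope f2 _ => cq2.
pose n2 (z : R * R) := q1 z.1 z.2 ^+ 2 + q2 z.1 z.2 ^+ 2.
(* The extended secant never vanishes: off the diagonal by injectivity, on it because the speed is
   positive. *)
have n20 z : (`[a, b] `*` `[a, b]) z -> 0 < n2 z.
  case: z => s t [/= sI tI]; rewrite /n2 lt_neqAle addr_ge0 ?sqr_ge0// andbT eq_sym.
  apply/negP; rewrite paddr_eq0 ?sqr_ge0// !sqrf_eq0 /q1 /q2 /slope/=.
  case: (eqVneq s t) => [_|st]; last first.
    rewrite !mulf_eq0 !invr_eq0 !subr_eq0 [t == s]eq_sym (negbTE st) !orbF.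
    by move=> /andP[/eqP E1 /eqP E2]; rewrite (inj s t) ?eqxx in st.
  rewrite !mulf_eq0 gt_eqF ?v0//= => /andP[/eqP E1 /eqP E2].
  by have := cos2Dsin2 (ph s); rewrite E1 E2 => /eqP; rewrite expr0n/= addr0 eq_sym oner_eq0.
pose h1 (z : R * R) := q1 z.1 z.2 * (Num.sqrt (n2 z))^-1.
pose h2 (z : R * R) := q2 z.1 z.2 * (Num.sqrt (n2 z))^-1.
have cn : jointly_continuous `[a, b] `[a, b] (fun s t => (Num.sqrt (n2 (s, t)))^-1).
  apply: jointly_continuousV; first by move=> p t pI tI; rewrite gt_eqF// sqrtr_gt0 n20.
  by apply: jointly_continuous_sqrt; apply: jointly_continuousD; apply: jointly_continuousM.
have ch1 : {within `[a, b] `*` `[a, b], continuous h1}.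
  by apply: (@eq_jointly_continuous _ `[a, b] `[a, b] (fun s t => q1 s t * (Num.sqrt (n2 (s, t)))^-1)
    (fun s t => h1 (s, t))); [by []|exact: jointly_continuousM].
have ch2 : {within `[a, b] `*` `[a, b], continuous h2}.
  by apply: (@eq_jointly_continuous _ `[a, b] `[a, b] (fun s t => q2 s t * (Num.sqrt (n2 (s, t)))^-1)
    (fun s t => h2 (s, t))); [by []|exact: jointly_continuousM].
have h12 z : (`[a, b] `*` `[a, b]) z -> h1 z ^+ 2 + h2 z ^+ 2 = 1.
  move=> zI; rewrite /h1 /h2 !exprMn -mulrDl exprVn sqr_sqrtr; last exact/ltW/n20.
  by rewrite divff// gt_eqF// n20.
have [||th [cth thP]] := exists_angle_lift _ (conj aI aI : (`[a, b] `*` `[a, b]) (a, a)) _ ch1 ch2 h12.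
- by apply: compact_setX; exact: segment_compact.
- have aux p l : p \in `[a, b] -> 0 <= l <= 1 -> a + l * (p - a) \in `[a, b].
    rewrite !in_itv/= => /andP[? ?] /andP[? ?]; apply/andP; split; nra.
  by move=> -[s t] l [/= sI tI] l01; split; exact: aux.
have jth : jointly_continuous `[a, b] `[a, b] (fun s t => th (s, t)).
  rewrite /jointly_continuous.
  by have -> : (fun z : R * R => th (z.1, z.2)) = th by apply/funext => -[].
have diag s : s \in `[a, b] -> cos (th (s, s)) = cos (ph s) /\ sin (th (s, s)) = sin (ph s).
  move=> sI; have [<- <-] := thP (s, s) (conj sI sI).
  have E : n2 (s, s) = v s ^+ 2.
    by rewrite /n2 /q1 /q2 /slope/= eqxx !exprMn -mulrDr cos2Dsin2 mulr1.
  rewrite /h1 /h2 E /q1 /q2 /slope/= eqxx sqrtr_sqr gtr0_norm ?v0//.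
  have vs : v s != 0 by rewrite gt_eqF// v0.
  by split; rewrite mulrAC divff ?mul1r.
have offd s t : s \in `[a, b] -> t \in `[a, b] -> s < t -> exists r, [/\ 0 < r,
    f1 t - f1 s = r * cos (th (s, t)) & f2 t - f2 s = r * sin (th (s, t))].
  move=> sI tI st; have [<- <-] := thP (s, t) (conj sI tI).
  have n0 := n20 (s, t) (conj sI tI).
  have ns : Num.sqrt (n2 (s, t)) != 0 by rewrite gt_eqF// sqrtr_gt0.
  have ts0 : t - s != 0 by rewrite subr_eq0 gt_eqF.
  exists ((t - s) * Num.sqrt (n2 (s, t))); split.
  - by rewrite mulr_gt0 ?subr_gt0// sqrtr_gt0.
  - by rewrite /h1 /q1 /slope/= lt_eqF//; field; rewrite ns.
  - by rewrite /h2 /q2 /slope/= lt_eqF//; field; rewrite ns.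
have leg1 : `|th (a, b) - th (a, a)| < pi.
  apply: (@continuous_angle_barrier _ (fun t => th (a, t) - th (a, a)) a b a b) => //.
  - move=> x; apply: cvgB; last exact: cvg_cst.
    exact: (jointly_continuous_time (p := a) _ jth).
  - by rewrite subrr normr0 pi_gt0.
  - move=> t tI; apply/eqP => ct1.
    have [cE sE] := diag a aI.
    have st0 : sin (th (a, t) - th (a, a)) = 0.
      apply/eqP; rewrite -sqrf_eq0; apply/eqP.
      by have := cos2Dsin2 (th (a, t) - th (a, a)); rewrite ct1; lra.
    have eth : th (a, t) = th (a, a) + (th (a, t) - th (a, a)) by rewrite addrC subrK.
    have E1 : cos (th (a, t)) = - cos (ph a).
      by rewrite eth cosD ct1 st0 cE; ring.
    have E2 : sin (th (a, t)) = - sin (ph a).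
      by rewrite eth sinD ct1 st0 sE; ring.
    have [Et|ta] := eqVneq t a.
      by move: ct1; rewrite Et subrr cos0; lra.
    have [|r [r0 e1 e2]] := offd a t aI tI.
      by rewrite lt_neqAle eq_sym ta; move: tI; rewrite in_itv => /andP[].
    by apply: (rayA t r tI r0); rewrite ?e1 ?e2 ?E1 ?E2 mulrN.
have leg2 : `|th (a, b) - th (b, b)| < pi.
  apply: (@continuous_angle_barrier _ (fun s => th (s, b) - th (b, b)) a b b a) => //.
  - move=> x; apply: cvgB; last exact: cvg_cst.
    exact: (jointly_continuous_slice (t := b) _ jth).
  - by rewrite subrr normr0 pi_gt0.
  - move=> t tI; apply/eqP => ct1.
    have [cE sE] := diag b bI.
    have st0 : sin (th (t, b) - th (b, b)) = 0.
      apply/eqP; rewrite -sqrf_eq0; apply/eqP.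
      by have := cos2Dsin2 (th (t, b) - th (b, b)); rewrite ct1; lra.
    have eth : th (t, b) = th (b, b) + (th (t, b) - th (b, b)) by rewrite addrC subrK.
    have E1 : cos (th (t, b)) = - cos (ph b).
      by rewrite eth cosD ct1 st0 cE; ring.
    have E2 : sin (th (t, b)) = - sin (ph b).
      by rewrite eth sinD ct1 st0 sE; ring.
    have [Et|tb] := eqVneq t b.
      by move: ct1; rewrite Et subrr cos0; lra.
    have [|r [r0 e1 e2]] := offd t b tI bI.
      by rewrite lt_neqAle tb; move: tI; rewrite in_itv => /andP[].
    by apply: (rayB t r tI r0); rewrite ?e1 ?e2 ?E1 ?E2 mulrN.
(* On the diagonal the lift and [ph] are angles of the same vector, so their difference is a
   continuous function with values in a discrete set, hence constant. *)
have diag0 : (th (b, b) - ph b) - (th (a, a) - ph a) = 0.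
  have cs s : s \in `[a, b] -> cos (th (s, s) - ph s) = 1 /\ sin (th (s, s) - ph s) = 0.
    move=> sI; have [E1 E2] := diag s sI.
    rewrite cosB sinB E1 E2; split; last by ring.
    by rewrite -!expr2 cos2Dsin2.
  have cs' s : s \in `[a, b] ->
      cos ((th (s, s) - ph s) - (th (a, a) - ph a)) = 1 /\
      sin ((th (s, s) - ph s) - (th (a, a) - ph a)) = 0.
    move=> sI; have [c1 s1] := cs s sI; have [c2 s2] := cs a aI.
    rewrite (cosB (th (s, s) - ph s)) (sinB (th (s, s) - ph s)) c1 s1 c2 s2.
    by split; ring.
  apply: sin_eq0_small; first exact: (cs' b bI).2.
  apply: (@continuous_angle_barrier _
    (fun s => (th (s, s) - ph s) - (th (a, a) - ph a)) a b a b) => //.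
  - move=> x; apply: cvgB; last exact: cvg_cst.
    apply: cvgB; last exact: cph.
    move: x; apply/within_continuousP_eps => s sI e e0.
    have /jointly_continuousP/(_ s s sI sI e e0)[d d0 dP] := jth.
    by exists d => // t tI ts; apply: dP.
  - by rewrite subrr normr0 pi_gt0.
  - by move=> s sI; rewrite (cs' s sI).1; apply/eqP; lra.
have -> : ph b - ph a = (th (a, b) - th (a, a)) - (th (a, b) - th (b, b)).
  by move: diag0; lra.
by apply: le_lt_trans (ler_normB _ _) _; rewrite mulr2n ltrD.
Qed.

End turning.

(** * Convexity and neighbourhoods in coordinates *)

Section plane_sets.
Context {R : realType}.

Lemma sin2pi_shift (x : R) : sin (x + pi *+ 2) = sin x.
Proof. by rewrite mulr2n addrA !sinDpi opprK. Qed.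

Lemma convex_combination (x y : R * R) (l m : R) :
  l *: x + m *: y = (l * x.1 + m * y.1, l * x.2 + m * y.2).
Proof. by []. Qed.

Lemma convex_planeP (A : set (R * R)) : convex_set A <->
  forall x y l, A x -> A y -> 0 <= l <= 1 -> A (l *: x + (1 - l) *: y).
Proof.
split=> [cA x y l Ax Ay /andP[l0 l1]|cA x y l].
  by have := cA x y (Itv01 l0 l1); rewrite !inE => /(_ Ax Ay).
rewrite !inE => Ax Ay; apply: cA => //.
by apply/andP; split; [exact: ge0|exact: le1].
Qed.

Lemma plane_nbhsP (z : R * R) (B : set (R * R)) : nbhs z B <->
  exists2 e, 0 < e & forall w : R * R,
    `|w.1 - z.1| < e -> `|w.2 - z.2| < e -> B w.
Proof.
split=> [/nbhs_ballP[e/= e0 eB]|[e e0 eB]].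
  exists e => // w w1 w2; apply: eB; split; by rewrite /ball/= distrC.
apply/nbhs_ballP; exists e => //= w [w1 w2].
by apply: eB; rewrite distrC.
Qed.

End plane_sets.

(** * A positively curved arc closed by its chord bounds a convex domain *)

Section convex_closure.
Context {R : realType}.
Variables (a b : R) (f : R -> R * R) (v ph k : R -> R) (rho ch : R).
Hypothesis ab : a < b.
Hypothesis v0 : forall p, p \in `[a, b] -> 0 < v p.
Hypothesis k0 : forall p, p \in `[a, b] -> 0 < k p.
Hypothesis hf1 : forall p, p \in `[a, b] ->
  has_derivative `[a, b] (fun q => (f q).1) p (v p * cos (ph p)).
Hypothesis hf2 : forall p, p \in `[a, b] ->
  has_derivative `[a, b] (fun q => (f q).2) p (v p * sin (ph p)).
Hypothesis hph : forall p, p \in `[a, b] -> has_derivative `[a, b] ph p (k p).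
Hypothesis turn : ph b - ph a < pi *+ 2.
Hypothesis rho0 : 0 < rho.
Hypothesis chord1 : (f b).1 - (f a).1 = rho * cos ch.
Hypothesis chord2 : (f b).2 - (f a).2 = rho * sin ch.
Hypothesis cha : ph a < ch < ph a + pi.
Hypothesis chb : ph b - pi < ch < ph b.

(* The signed distances to the tangent at q and to the line of the segment,
   positive on the side of the normal. *)
Definition tangent_height (q : R) (z : R * R) : R :=
  (z.2 - (f q).2) * cos (ph q) - (z.1 - (f q).1) * sin (ph q).

Definition chord_height (z : R * R) : R :=
  (z.1 - (f a).1) * sin ch - (z.2 - (f a).2) * cos ch.

Let aI : a \in `[a, b]. Proof. by rewrite in_itv/= lexx ltW. Qed.
Let bI : b \in `[a, b]. Proof. by rewrite in_itv/= lexx ltW. Qed.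

Let ph_inc : {in `[a, b] &, {homo ph : u w / u < w}}.
Proof.
move=> u w uI wI uw; apply: (increasing_of_derivative uw _ hph).
  exact: segment_subset_itv.
by move=> z zuw; apply: k0; apply: (segment_subset_itv uI wI); exact: subset_itv_oo_cc zuw.
Qed.

Let ph_le u w : u \in `[a, b] -> w \in `[a, b] -> u <= w -> ph u <= ph w.
Proof.
by move=> uI wI; rewrite le_eqVlt => /predU1P[->//|uw]; rewrite ltW// ph_inc.
Qed.

Lemma tangent_height_id q : tangent_height q (f q) = 0.
Proof. by rewrite /tangent_height !subrr !mul0r subr0. Qed.

Let h_der q p : p \in `[a, b] ->
  has_derivative `[a, b] (fun p => tangent_height q (f p)) p
    (v p * sin (ph p - ph q)).
Proof.
move=> pI; set l := (X in has_derivative _ _ _ X).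
have -> : l = cos (ph q) * (v p * sin (ph p) - 0) - sin (ph q) * (v p * cos (ph p) - 0).
  by rewrite /l sinB; ring.
have -> : (fun p => tangent_height q (f p)) =
  (fun p => cos (ph q) * ((f p).2 - (f q).2) - sin (ph q) * ((f p).1 - (f q).1)).
  by apply/funext => x; rewrite /tangent_height; ring.
by apply: has_derivativeB; apply: has_derivativeMl; apply: has_derivativeB;
  [exact: hf2|exact: has_derivative_cst|exact: hf1|exact: has_derivative_cst].
Qed.

Let h_chord q : tangent_height q (f b) = tangent_height q (f a) + rho * sin (ch - ph q).
Proof.
rewrite /tangent_height sinB.
transitivity (((f a).2 - (f q).2 + ((f b).2 - (f a).2)) * cos (ph q) -
  ((f a).1 - (f q).1 + ((f b).1 - (f a).1)) * sin (ph q)); first by ring.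
by rewrite chord1 chord2; ring.
Qed.

Let h_a_near q : q \in `[a, b] -> a < q -> ph q <= ph a + pi ->
  0 < tangent_height q (f a).
Proof.
move=> qI aq h.
have [|c caq E] := mean_value aq _ (fun p => @h_der q p); first exact: segment_subset_itv.
have cI : c \in `[a, b].
  by apply: (segment_subset_itv aI qI); exact: subset_itv_oo_cc caq.
move: (caq); rewrite in_itv/= => /andP[ac cq].
have s0 : 0 < sin (ph q - ph c).
  by apply: sin_gt0_pi; have := ph_inc aI cI ac; have := ph_inc cI qI cq; lra.
have : 0 < v c * sin (ph q - ph c) * (q - a) by rewrite !mulr_gt0 ?v0// subr_gt0.
by move: E; rewrite tangent_height_id -[ph c - ph q]opprB sinN; lra.
Qed.

Let h_b_near q : q \in `[a, b] -> q < b -> ph b <= ph q + pi ->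
  0 < tangent_height q (f b).
Proof.
move=> qI qb h; rewrite -[ltLHS](tangent_height_id q).
apply: (increasing_of_derivative qb _ (fun p => @h_der q p)); first exact: segment_subset_itv.
move=> c cqb; have cI : c \in `[a, b].
  by apply: (segment_subset_itv qI bI); exact: subset_itv_oo_cc cqb.
move: (cqb); rewrite in_itv/= => /andP[qc cb].
rewrite mulr_gt0 ?v0//; apply: sin_gt0_pi.
have := ph_inc qI cI qc; have := ph_inc cI bI cb; lra.
Qed.

(** If more than half a turn remains after [q], less than half a turn precedes it, so [f a] is not
    below the tangent at [q]; and the chord climbs from [f a] to [f b], because [ch - ph q] lies
    between 0 and [pi]. *)
Let h_b q : q \in `[a, b] -> q < b -> 0 < tangent_height q (f b).
Proof.
move=> qI qb; have [h|h] := leP (ph b) (ph q + pi); first exact: h_b_near.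
rewrite h_chord ltr_wpDl//.
  have [<-|aq] := eqVneq a q; first by rewrite tangent_height_id.
  apply/ltW/h_a_near => //; last by move: turn; rewrite mulr2n; lra.
  by rewrite lt_neqAle aq; move: qI; rewrite in_itv => /andP[].
rewrite mulr_gt0//; apply: sin_gt0_pi.
have : ph a <= ph q by apply: ph_le => //; move: qI; rewrite in_itv => /andP[].
by move: cha chb; lra.
Qed.

Let h_a q : q \in `[a, b] -> a < q -> 0 < tangent_height q (f a).
Proof.
move=> qI aq; have [h|h] := leP (ph q) (ph a + pi); first exact: h_a_near.
have -> : tangent_height q (f a) = tangent_height q (f b) + rho * sin (ph q - ch).
  by rewrite h_chord -[ph q - ch]opprB sinN; ring.
rewrite ltr_wpDl//.
  have [->|qb] := eqVneq q b; first by rewrite tangent_height_id.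
  apply/ltW/h_b => //.
  by rewrite lt_neqAle qb; move: qI; rewrite in_itv => /andP[].
rewrite mulr_gt0//; apply: sin_gt0_pi.
have : ph q <= ph b by apply: ph_le => //; move: qI; rewrite in_itv => /andP[].
by move: cha chb; lra.
Qed.

(** On either side of [q] the height is of the type treated in [hump], so its values at [q] and at
    the end of the arc decide. *)
Lemma tangent_height_gt0 q p : q \in `[a, b] -> p \in `[a, b] -> p != q ->
  0 < tangent_height q (f p).
Proof.
move=> qI pI; have [qa qb] : a <= q /\ q <= b by move: qI; rewrite in_itv => /andP.
have [pa pb] : a <= p /\ p <= b by move: pI; rewrite in_itv => /andP.
rewrite neq_lt => /orP[pq|qp].
- have [<-|ap] := eqVneq a p; first by apply: h_a => //; exact: le_lt_trans pq.
  have {}ap : a < p by rewrite lt_neqAle ap.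
  have sub : `[a, q] `<=` `[a, b] by exact: segment_subset_itv.
  (* Before [q] the angle relative to the tangent is negative; a full turn is added to bring it into
     the range of [hump]. *)
  have := @hump _ (fun p => tangent_height q (f p)) v (fun u => ph u - ph q + pi *+ 2)
    a q p _ _ _ _ _ _.
  rewrite tangent_height_id min_r; last by apply/ltW/h_a => //; exact: lt_trans pq.
  apply.
  + by rewrite ap.
  + move=> z zI; rewrite sin2pi_shift; apply: has_derivative_subset (sub) _.
    exact/h_der/sub.
  + by move=> z /sub; exact: v0.
  + by move=> x y /sub xI /sub yI xy; rewrite ltrD2r ltrD2r ph_inc.
  + by have := ph_le qI bI qb; move: turn => /=; rewrite mulr2n; lra.
  + by rewrite subrr add0r.
- have [->|pb'] := eqVneq p b; first by apply: h_b => //; exact: lt_le_trans pb.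
  have {}pb : p < b by rewrite lt_neqAle pb'.
  have sub : `[q, b] `<=` `[a, b] by exact: segment_subset_itv.
  have := @hump _ (fun p => tangent_height q (f p)) v (fun u => ph u - ph q)
    q b p _ _ _ _ _ _.
  rewrite tangent_height_id min_l; last by apply/ltW/h_b => //; exact: lt_trans pb.
  apply.
  + by rewrite qp.
  + move=> z zI; apply: has_derivative_subset (sub) _; exact/h_der/sub.
  + by move=> z /sub; exact: v0.
  + by move=> x y /sub xI /sub yI xy; rewrite ltrD2r ph_inc.
  + by rewrite subrr.
  + by have := ph_le aI qI qa; move: turn => /=; rewrite mulr2n; lra.
Qed.

Lemma chord_height_a : chord_height (f a) = 0.
Proof. by rewrite /chord_height !subrr !mul0r subr0. Qed.

Lemma chord_height_b : chord_height (f b) = 0.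
Proof. by rewrite /chord_height chord1 chord2; ring. Qed.

(** The upper bound of [cha] and the lower bound of [chb] keep [ph - ch + pi] within [[0, 2 pi]]. *)
Lemma chord_height_gt0 p : p \in `]a, b[ -> 0 < chord_height (f p).
Proof.
rewrite in_itv/= => pab.
have := @hump _ (fun p => chord_height (f p)) v (fun u => ph u - ch + pi)
    a b p pab _ v0 _ _ _.
rewrite chord_height_a chord_height_b minxx; apply.
- move=> z zI; rewrite sinDpi -sinN opprB sinB.
  set l := (X in has_derivative _ _ _ X).
  have -> : l = sin ch * (v z * cos (ph z) - 0) - cos ch * (v z * sin (ph z) - 0).
    by rewrite /l; ring.
  have -> : (fun p => chord_height (f p)) =
    (fun p => sin ch * ((f p).1 - (f a).1) - cos ch * ((f p).2 - (f a).2)).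
    by apply/funext => x; rewrite /chord_height; ring.
  by apply: has_derivativeB; apply: has_derivativeMl; apply: has_derivativeB;
    [exact: hf1|exact: has_derivative_cst|exact: hf2|exact: has_derivative_cst].
- by move=> x y xI yI xy; rewrite ltrD2r ltrD2r ph_inc.
- by move: cha; lra.
- by move: chb; rewrite mulr2n; lra.
Qed.

Definition convex_region : set (R * R) :=
  [set z | (forall q, q \in `[a, b] -> 0 < tangent_height q z) /\ 0 < chord_height z].

Let closed_region : set (R * R) :=
  [set z | (forall q, q \in `[a, b] -> 0 <= tangent_height q z) /\ 0 <= chord_height z].

Let th_affine q x y l :
  tangent_height q (l *: x + (1 - l) *: y) =
  l * tangent_height q x + (1 - l) * tangent_height q y.
Proof. by rewrite convex_combination /tangent_height/=; ring. Qed.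

Let chh_affine x y l :
  chord_height (l *: x + (1 - l) *: y) =
  l * chord_height x + (1 - l) * chord_height y.
Proof. by rewrite convex_combination /chord_height/=; ring. Qed.

Let lipschitz (c s x y : R) : c ^+ 2 + s ^+ 2 = 1 -> `|x * c - y * s| <= `|x| + `|y|.
Proof.
move=> cs; apply: le_trans (ler_normB _ _) _; rewrite !normrM.
have c1 : `|c| <= 1.
  by rewrite ler_norml; apply/andP; split; rewrite leNgt; apply/negP => ?;
    have := sqr_ge0 s; nra.
have s1 : `|s| <= 1.
  by rewrite ler_norml; apply/andP; split; rewrite leNgt; apply/negP => ?;
    have := sqr_ge0 c; nra.
by apply: lerD; apply: ler_piMr.
Qed.

Let th_lip q x y :
  `|tangent_height q x - tangent_height q y| <= `|x.1 - y.1| + `|x.2 - y.2|.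
Proof.
have -> : tangent_height q x - tangent_height q y =
  (x.2 - y.2) * cos (ph q) - (x.1 - y.1) * sin (ph q).
  by rewrite /tangent_height; ring.
by rewrite [leRHS]addrC; apply: lipschitz; exact: cos2Dsin2.
Qed.

Let chh_lip x y :
  `|chord_height x - chord_height y| <= `|x.1 - y.1| + `|x.2 - y.2|.
Proof.
have -> : chord_height x - chord_height y =
  (x.1 - y.1) * sin ch - (x.2 - y.2) * cos ch.
  by rewrite /chord_height; ring.
by apply: lipschitz; rewrite addrC cos2Dsin2.
Qed.

Let cph : {within `[a, b], continuous ph}.
Proof. exact: has_derivative_continuous hph. Qed.

(** An infinite intersection of open half planes, yet open: the heights of a point attain a positive
    minimum over the compact parameter interval, and all of them vary with one Lipschitz
    constant. *)
Let open_region : open convex_region.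
Proof.
rewrite openE => z [z1 z2]; apply/plane_nbhsP.
have cth : {within `[a, b], continuous (fun q => tangent_height q z)}.
  have cf1 := has_derivative_continuous hf1.
  have cf2 := has_derivative_continuous hf2.
  move=> q; apply: cvgB; apply: cvgM; first by apply: cvgB; [exact: cvg_cst|exact: cf2].
  - by apply: continuous_comp; [exact: cph|exact: continuous_cos].
  - by apply: cvgB; [exact: cvg_cst|exact: cf1].
  - by apply: continuous_comp; [exact: cph|exact: continuous_sin].
have [m mI mP] := EVT_min (ltW ab) cth.
have m0 := z1 m mI.
exists (Num.min (tangent_height m z) (chord_height z) / 2).
  by rewrite divr_gt0// lt_min m0.
set e := Num.min _ _ => w w1 w2.
have em : e <= tangent_height m z by rewrite ge_min lexx.
have es : e <= chord_height z by rewrite ge_min lexx orbT.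
have we : `|w.1 - z.1| + `|w.2 - z.2| < e by rewrite (splitr e) ltrD.
split=> [q qI|].
  have := mP q qI; have := th_lip q w z; rewrite ler_norml => /andP[? ?] ?.
  lra.
have := chh_lip w z; rewrite ler_norml => /andP[? ?]; lra.
Qed.

(** A point of the arc lies on its own tangent, but the midpoint of two distinct points is strictly
    above every tangent. *)
Let inner : R * R :=
  2^-1 *: f ((a + a + b) / 3) + (1 - 2^-1) *: f ((a + b + b) / 3).

Let inner_region : convex_region inner.
Proof.
have ? := ab.
have p1 : (a + a + b) / 3 \in `]a, b[ by rewrite in_itv/=; lra.
have p2 : (a + b + b) / 3 \in `]a, b[ by rewrite in_itv/=; lra.
have p1' : (a + a + b) / 3 \in `[a, b] by exact: subset_itv_oo_cc p1.
have p2' : (a + b + b) / 3 \in `[a, b] by exact: subset_itv_oo_cc p2.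
split=> [q qI|]; last first.
  by rewrite chh_affine; have := chord_height_gt0 p1; have := chord_height_gt0 p2; lra.
rewrite th_affine.
have [e1|n1] := eqVneq ((a + a + b) / 3) q.
  rewrite -{1}e1 tangent_height_id.
  have := tangent_height_gt0 qI p2'; rewrite -e1 => /(_ _)/wrap[].
    by rewrite gt_eqF//; lra.
  lra.
have := tangent_height_gt0 qI p1' n1.
have [->|n2] := eqVneq ((a + b + b) / 3) q; first by rewrite tangent_height_id; lra.
have := tangent_height_gt0 qI p2' n2; lra.
Qed.

(** A point satisfying the weak inequalities satisfies the strict ones after a small move towards
    [inner], as the heights are affine. *)
Let closure_region : closure convex_region = closed_region.
Proof.
apply/seteqP; split=> z.
  move=> cz; split=> [q qI|]; rewrite leNgt; apply/negP => h.
    have [|w [[w1 _]]] := cz [set w | `|w.1 - z.1| < - tangent_height q z / 2 /\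
      `|w.2 - z.2| < - tangent_height q z / 2].
      by apply/plane_nbhsP; exists (- tangent_height q z / 2) => //; lra.
    move=> [/= d1 d2]; have := th_lip q w z; have := w1 q qI.
    rewrite ler_norml => ? /andP[? ?]; lra.
  have [|w [[_ w1]]] := cz [set w | `|w.1 - z.1| < - chord_height z / 2 /\
      `|w.2 - z.2| < - chord_height z / 2].
    by apply/plane_nbhsP; exists (- chord_height z / 2) => //; lra.
  move=> [/= d1 d2]; have := chh_lip w z; move: w1.
  rewrite ler_norml => ? /andP[? ?]; lra.
move=> [z1 z2] B /plane_nbhsP[e e0 eB].
have [w [i1 i2]] : exists w, convex_region w by exists inner; exact: inner_region.
pose m := `|w.1 - z.1| + `|w.2 - z.2| + e.
have m0 : 0 < m by rewrite ltr_wpDl.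
have l0 : 0 < e / (m + m) by rewrite divr_gt0// addr_gt0.
have l1 : e / (m + m) < 1.
  have : e <= m by rewrite lerDr.
  move=> em; have mm0 : 0 < m + m by rewrite addr_gt0.
  by rewrite (ltr_pdivrMr _ _ mm0) mul1r (le_lt_trans em)// ltrDl.
have lm (x : R) : `|x| <= m -> `|e / (m + m) * x| < e.
  move=> xm; rewrite normrM gtr0_norm//.
  apply: (@le_lt_trans _ _ (e / (m + m) * m)); first by rewrite ler_wpM2l// ltW.
  have -> : e / (m + m) * m = e / 2 by field; rewrite -mulr2n mulrn_eq0/= gt_eqF.
  lra.
exists (e / (m + m) *: w + (1 - e / (m + m)) *: z); split.
  split=> [q qI|].
    rewrite th_affine; apply: ltr_pwDl; first by rewrite mulr_gt0 ?i1.
    by rewrite mulr_ge0 ?z1// subr_ge0 ltW.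
  rewrite chh_affine; apply: ltr_pwDl; first by rewrite mulr_gt0.
  by rewrite mulr_ge0// subr_ge0 ltW.
apply: eB; rewrite convex_combination/=.
  set x := (X in `|X|); have -> : x = e / (m + m) * (w.1 - z.1) by rewrite /x; ring.
  by apply: lm; rewrite /m -addrA lerDl addr_ge0// ltW.
set x := (X in `|X|); have -> : x = e / (m + m) * (w.2 - z.2) by rewrite /x; ring.
by apply: lm; rewrite /m addrAC lerDr addr_ge0// ltW.
Qed.

Let closing_point (u : R) :
  f b + u *: (f a - f b) = u *: f a + (1 - u) *: f b.
Proof. by rewrite scalerBr scalerBl scale1r; rewrite addrCA. Qed.

Let chord_abscissa (z : R * R) : R :=
  (z.1 - (f a).1) * cos ch + (z.2 - (f a).2) * sin ch.

Let absc_affine x y l :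
  chord_abscissa (l *: x + (1 - l) *: y) =
  l * chord_abscissa x + (1 - l) * chord_abscissa y.
Proof. by rewrite convex_combination /chord_abscissa/=; ring. Qed.

Let absc_a : chord_abscissa (f a) = 0.
Proof. by rewrite /chord_abscissa !subrr !mul0r addr0. Qed.

Let absc_b : chord_abscissa (f b) = rho.
Proof.
rewrite /chord_abscissa chord1 chord2.
transitivity (rho * (cos ch ^+ 2 + sin ch ^+ 2)); first by ring.
by rewrite cos2Dsin2 mulr1.
Qed.

(** A point on the line of the chord is confined to the segment by the two end tangents. A point off
    that line lies on some tangent, and since the arc is the envelope of its tangents, it must be
    the point of contact. *)
Let frontier_point z : closed_region z -> ~ convex_region z ->
  exists2 p, p \in `[a, b + 1] & close_by_segment a b f p = z.
Proof.
move=> [z1 z2] nz.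
have cs := cos2Dsin2 (ch).
have Ib p : p \in `[a, b] -> p \in `[a, b + 1].
  by rewrite !in_itv/= => /andP[-> pb] /=; lra.
have Fb p : p \in `[a, b] -> close_by_segment a b f p = f p.
  by rewrite in_itv/= /close_by_segment => /andP[_ ->].
have [s0|s0] := eqVneq (chord_height z) 0.
  pose lam := chord_abscissa z.
  have e1 : z.1 - (f a).1 = lam * cos ch.
    transitivity ((z.1 - (f a).1) * (cos ch ^+ 2 + sin ch ^+ 2)); first by rewrite cs mulr1.
    transitivity (lam * cos ch + chord_height z * sin ch); last by rewrite s0; ring.
    by rewrite /lam /chord_abscissa /chord_height; ring.
  have e2 : z.2 - (f a).2 = lam * sin ch.
    transitivity ((z.2 - (f a).2) * (cos ch ^+ 2 + sin ch ^+ 2)); first by rewrite cs mulr1.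
    transitivity (lam * sin ch - chord_height z * cos ch); last by rewrite s0; ring.
    by rewrite /lam /chord_abscissa /chord_height; ring.
  have ha : tangent_height a z = lam * sin (ch - ph a).
    by rewrite /tangent_height e1 e2 sinB; ring.
  have hb : tangent_height b z = (rho - lam) * sin (ph b - ch).
    rewrite /tangent_height.
    have -> : z.1 - (f b).1 = (lam - rho) * cos ch.
      by rewrite mulrBl -e1 -chord1; ring.
    have -> : z.2 - (f b).2 = (lam - rho) * sin ch.
      by rewrite mulrBl -e2 -chord2; ring.
    by rewrite sinB; ring.
  have sa : 0 < sin (ch - ph a) by apply: sin_gt0_pi; move: cha; lra.
  have sb : 0 < sin (ph b - ch) by apply: sin_gt0_pi; move: chb; lra.
  have lam0 : 0 <= lam by have := z1 a aI; rewrite ha pmulr_lge0.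
  have lam1 : lam <= rho by have := z1 b bI; rewrite hb pmulr_lge0// subr_ge0.
  (* [lam] is measured from [f a], while the closing segment starts at [f b]. *)
  pose u := 1 - lam / rho.
  have u1 : u <= 1 by rewrite /u gerBl divr_ge0// ltW.
  have u0 : 0 <= u by rewrite /u subr_ge0 ler_pdivrMr// mul1r.
  exists (b + u); first by rewrite in_itv/= lerD2l u1 andbT; have := ab; lra.
  have -> : close_by_segment a b f (b + u) = f b + u *: (f a - f b).
    rewrite /close_by_segment; case: ifPn => [h|_]; last by rewrite addrAC subrr add0r.
    by have -> : u = 0 by [lra]; rewrite scale0r !addr0.
  rewrite closing_point [z]surjective_pairing convex_combination.
  have r0 : rho != 0 by rewrite gt_eqF.
  congr (_, _); rewrite /u.
    transitivity ((f a).1 + lam / rho * ((f b).1 - (f a).1)); first by ring.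
    by rewrite chord1 mulrA divfK// -e1; ring.
  transitivity ((f a).2 + lam / rho * ((f b).2 - (f a).2)); first by ring.
  by rewrite chord2 mulrA divfK// -e2; ring.
have {}s0 : 0 < chord_height z by rewrite lt_neqAle eq_sym s0.
have [q qI hq] : exists2 q, q \in `[a, b] & tangent_height q z = 0.
  apply: contrapT => h; apply: nz; split=> // q qI.
  rewrite lt_neqAle z1// andbT eq_sym; apply/eqP => hq.
  by apply: h; exists q.
pose r := (z.1 - (f q).1) * cos (ph q) + (z.2 - (f q).2) * sin (ph q).
have csq := cos2Dsin2 (ph q).
have e1 : z.1 - (f q).1 = r * cos (ph q).
  transitivity ((z.1 - (f q).1) * (cos (ph q) ^+ 2 + sin (ph q) ^+ 2)); first by rewrite csq mulr1.
  transitivity (r * cos (ph q) - tangent_height q z * sin (ph q)); last by rewrite hq; ring.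
  by rewrite /r /tangent_height; ring.
have e2 : z.2 - (f q).2 = r * sin (ph q).
  transitivity ((z.2 - (f q).2) * (cos (ph q) ^+ 2 + sin (ph q) ^+ 2)); first by rewrite csq mulr1.
  transitivity (r * sin (ph q) + tangent_height q z * cos (ph q)); last by rewrite hq; ring.
  by rewrite /r /tangent_height; ring.
(* As the point of contact moves, the terms with the speed cancel. Since [q] minimises the height of
   [z] over all tangents, this derivative has a known sign. *)
have hder : has_derivative `[a, b] (fun q => tangent_height q z) q (- (k q * r)).
  set l := (X in has_derivative _ _ _ X).
  have -> : l = ((0 - v q * sin (ph q)) * cos (ph q) + (z.2 - (f q).2) * (- sin (ph q) * k q))
    - ((0 - v q * cos (ph q)) * sin (ph q) + (z.1 - (f q).1) * (cos (ph q) * k q)).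
    by rewrite /l /r; ring.
  have hq0 := hph qI.
  apply: has_derivativeB; apply: has_derivativeM.
  - by apply: has_derivativeB; [exact: has_derivative_cst|exact: hf2].
  - exact: has_derivative_cos.
  - by apply: has_derivativeB; [exact: has_derivative_cst|exact: hf1].
  - exact: has_derivative_sin.
have [|D1 D2] := derivative_at_min_segment qI _ hder; first by move=> y yI; rewrite hq z1.
have /andP[aq qb] : a <= q <= b by move: qI; rewrite in_itv.
have rle : q < b -> r <= 0.
  by move=> /D1; rewrite oppr_ge0 pmulr_rle0// k0.
have rge : a < q -> 0 <= r.
  by move=> /D2; rewrite oppr_le0 pmulr_rge0// k0.
suff r0 : r = 0.
  exists q; first exact: Ib.
  rewrite Fb// [f q]surjective_pairing [z]surjective_pairing.
  move: e1 e2; rewrite r0 !mul0r => /eqP; rewrite subr_eq0 => /eqP-> /eqP.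
  by rewrite subr_eq0 => /eqP->.
(* At an end only one sign of [r] is known, and it contradicts that [z] lies strictly above the
   chord. *)
have [qa|qa] := eqVneq q a.
  have := rle; rewrite qa => /(_ ab) r1.
  have E : chord_height z = r * sin (ch - ph q).
    by rewrite /chord_height -qa e1 e2 sinB; ring.
  have sp : 0 < sin (ch - ph q) by rewrite qa; apply: sin_gt0_pi; move: cha; lra.
  by move: s0; rewrite E pmulr_lgt0// => r2; have : r <= 0 by []; lra.
have [qb'|qb'] := eqVneq q b.
  have := rge; rewrite qb' => /(_ ab) r1.
  have E : chord_height z = - (r * sin (ph q - ch)).
    transitivity (chord_height (f b) +
       ((z.1 - (f q).1) * sin ch - (z.2 - (f q).2) * cos ch)).
      by rewrite qb' /chord_height; ring.
    by rewrite chord_height_b e1 e2 sinB; ring.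
  have sp : 0 < sin (ph q - ch) by rewrite qb'; apply: sin_gt0_pi; move: chb; lra.
  by move: s0; rewrite E oppr_gt0 pmulr_llt0// => r2; have : 0 <= r by []; lra.
apply/eqP; rewrite eq_le rle ?rge// lt_neqAle.
- by rewrite eq_sym qa.
- by rewrite qb'.
Qed.

Let curve_in_closed p : p \in `[a, b] -> closed_region (f p).
Proof.
move=> pI; split=> [q qI|].
  have [->|n] := eqVneq p q; first by rewrite tangent_height_id.
  by rewrite ltW// tangent_height_gt0.
have [->|pa] := eqVneq p a; first by rewrite chord_height_a.
have [->|pb] := eqVneq p b; first by rewrite chord_height_b.
rewrite ltW// chord_height_gt0// in_itv/= !lt_neqAle pb eq_sym pa/=.
by move: pI; rewrite in_itv.
Qed.

Lemma convex_closure_of_arc : traces_out_convex_domain a b f.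
Proof.
have Fb p : p \in `[a, b] -> close_by_segment a b f p = f p.
  by rewrite in_itv/= /close_by_segment => /andP[_ ->].
have Fs p : b < p -> close_by_segment a b f p = (p - b) *: f a + (1 - (p - b)) *: f b.
  by move=> bp; rewrite /close_by_segment leNgt bp/= closing_point.
split; last first.
  exists convex_region; split.
  - by exists inner.
  - exact: open_region.
  - apply/convex_planeP => x y l [x1 x2] [y1 y2] /andP[l0 l1].
    have pos (s t : R) : 0 < s -> 0 < t -> 0 < l * s + (1 - l) * t.
      by move=> s0 t0; nra.
    by split=> [q qI|]; rewrite ?th_affine ?chh_affine; apply: pos; rewrite ?x1 ?y1.
  - have E : convex_region° = convex_region by apply/interior_id; exact: open_region.
    rewrite /frontier E closure_region.
    apply/seteqP; split=> z; last by move=> [h1 h2]; have [p] := frontier_point h1 h2; exists p.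
    move=> [p /= pI <-].
    have [pb|bp] := leP p b.
      have {}pI : p \in `[a, b] by move: pI; rewrite !in_itv/= pb => /andP[->].
      rewrite Fb//; split; first exact: curve_in_closed.
      by move=> [/(_ p pI)]; rewrite tangent_height_id ltxx.
    have p1 : p <= b + 1 by move: pI; rewrite in_itv => /andP[].
    have u0 : 0 <= p - b by lra.
    have u1 : 0 <= 1 - (p - b) by lra.
    rewrite Fs//; have [A1 A2] := curve_in_closed aI; have [B1 B2] := curve_in_closed bI.
    split.
      by split=> [q qI|]; rewrite ?th_affine ?chh_affine addr_ge0// mulr_ge0 ?A1 ?B1.
    by move=> [_]; rewrite chh_affine chord_height_a chord_height_b !mulr0 addr0 ltxx.
split.
- have cf : {within `[a, b], continuous f}.
    have h : forall p, p \in `[a, b] ->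
        has_derivative `[a, b] f p (v p * cos (ph p), v p * sin (ph p)).
      by move=> p pI; apply: has_derivative_pair; [exact: hf1|exact: hf2].
    exact: has_derivative_continuous h.
  (* A single formula for both pieces, so that continuity at the junction [b] needs no separate
     treatment. *)
  have E p : p \in `[a, b + 1] -> close_by_segment a b f p =
      f (Num.min p b) + (p - Num.min p b) *: (f a - f b).
    rewrite /close_by_segment => _; case: (leP p b) => [pb|bp].
      by rewrite subrr scale0r addr0.
    by [].
  apply/within_continuousP_eps => p pI e e0.
  have mI q : q \in `[a, b + 1] -> Num.min q b \in `[a, b].
    by rewrite !in_itv/= => /andP[aq _]; rewrite le_min aq ltW//= ge_min lexx orbT.
  have mlip q r : `|Num.min q b - Num.min r b| <= `|q - r|.
    case: (leP q b) => h1; case: (leP r b) => h2 //.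
    - rewrite ler_norml; apply/andP; split; have := ler_norm (q - r);
       have := lerNnormlW (lexx `|q - r|); lra.
    - rewrite ler_norml; apply/andP; split; have := ler_norm (q - r);
       have := lerNnormlW (lexx `|q - r|); lra.
    - by rewrite subrr normr0.
  move/within_continuousP_eps : cf => /(_ _ (mI p pI) (e / 2) _)/wrap[]; first by lra.
  move=> [d d0 dP].
  pose m := `|f a - f b| + 1.
  have m0 : 0 < m by rewrite ltr_wpDl.
  exists (Num.min d (e / 4 / m)).
    by rewrite lt_min d0 !divr_gt0.
  move=> q qI; rewrite lt_min => /andP[qd qe].
  rewrite !E// opprD addrACA -scalerBl; apply: le_lt_trans (ler_normD _ _) _.
  rewrite (splitr e); apply: ltr_leD.
    by apply: dP; [exact: mI|exact: le_lt_trans (mlip _ _) qd].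
  rewrite normrZ.
  have h1 : `|q - Num.min q b - (p - Num.min p b)| <= `|q - p| + `|q - p|.
    have -> : q - Num.min q b - (p - Num.min p b) =
      (q - p) + (Num.min p b - Num.min q b) by ring.
    apply: le_trans (ler_normD _ _) _.
    by rewrite lerD2l; apply: le_trans (mlip _ _) _; rewrite distrC.
  apply: (@le_trans _ _ ((`|q - p| + `|q - p|) * m)).
    by apply: ler_pM => //; rewrite lerDl.
  move: qe; rewrite ltr_pdivlMr// => qe; nra.
- rewrite Fb// Fs ?ltrDl//.
  have -> : b + 1 - b = 1 by ring.
  by rewrite subrr scale1r scale0r addr0.
(* The arc meets the line of the chord at its two endpoints only. *)
- have seg u p : 0 < u < 1 -> p \in `[a, b] ->
    f p = u *: f a + (1 - u) *: f b -> False.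
    move=> /andP[u0 u1] pI E.
    have : chord_height (f p) = 0.
      by rewrite E chh_affine chord_height_a chord_height_b !mulr0 addr0.
    have : chord_abscissa (f p) = (1 - u) * rho.
      by rewrite E absc_affine absc_a absc_b mulr0 add0r.
    have [->|pa] := eqVneq p a; first by rewrite absc_a; have := rho0; nra.
    have [->|pb] := eqVneq p b; first by rewrite absc_b; have := rho0; nra.
    have /chord_height_gt0 : p \in `]a, b[.
      by rewrite in_itv/= !lt_neqAle pb eq_sym pa/=; move: pI; rewrite in_itv.
    lra.
  move=> p q; rewrite !in_itv/= => /andP[ap pb1] /andP[aq qb1].
  have [pb|bp] := leP p b; have [qb|bq] := leP q b.
  + have pI : p \in `[a, b] by rewrite in_itv/= ap.
    have qI : q \in `[a, b] by rewrite in_itv/= aq.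
    rewrite !Fb// => E; apply/eqP/negPn/negP => pq.
    by have := tangent_height_gt0 qI pI pq; rewrite E tangent_height_id ltxx.
  + have pI : p \in `[a, b] by rewrite in_itv/= ap.
    rewrite Fb// Fs// => E; exfalso; apply: seg pI E.
    by apply/andP; split; lra.
  + have qI : q \in `[a, b] by rewrite in_itv/= aq.
    rewrite Fs// Fb// => /esym E; exfalso; apply: seg qI E.
    by apply/andP; split; lra.
  + rewrite !Fs// => /(congr1 chord_abscissa).
    by rewrite !absc_affine absc_a absc_b !mulr0 !add0r => /(mulIf (lt0r_neq0 rho0)); lra.
Qed.

End convex_closure.

(** * Open convex sets, their closures, and the set enclosed by their frontier *)

Section convex_sets.
Context {R : realType}.
Implicit Types (D A : set (R * R)) (x y z u : R * R).

Lemma norm_plane_lt x (e : R) : `|x| < e <-> `|x.1| < e /\ `|x.2| < e.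
Proof. by rewrite prod_normE/= gt_max; split=> /andP. Qed.

Lemma norm_plane_le x (e : R) : `|x| <= e <-> `|x.1| <= e /\ `|x.2| <= e.
Proof. by rewrite prod_normE/= ge_max; split=> /andP. Qed.

Lemma closure_planeP D x : closure D x <-> forall e, 0 < e ->
  exists y, [/\ D y, `|y.1 - x.1| < e & `|y.2 - x.2| < e].
Proof.
split=> [cx e e0|h B /plane_nbhsP[e e0 eB]].
  have [|y [Dy [y1 y2]]] :=
      cx [set y | `|y.1 - x.1| < e /\ `|y.2 - x.2| < e].
    by apply/plane_nbhsP; exists e.
  by exists y.
have [y [Dy y1 y2]] := h e e0.
by exists y; split=> //; exact: eB.
Qed.

(** Replace [x] by a nearby [x'] in [D] and shift [y] so that the combination is unchanged; the
    shifted point is still in the open set [D]. *)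
Lemma convex_open_closure D x y l : open D -> convex_set D -> closure D x ->
  D y -> 0 < l <= 1 -> D (l *: y + (1 - l) *: x).
Proof.
rewrite openE => oD /convex_planeP cD /closure_planeP cx Dy /andP[l0 l1].
have /plane_nbhsP[e e0 eD] := oD _ Dy.
have [|x' [Dx' x1 x2]] := cx (l * e); first by rewrite mulr_gt0.
pose y' : R * R := (y.1 + (1 - l) / l * (x.1 - x'.1), y.2 + (1 - l) / l * (x.2 - x'.2)).
have small (s t : R) : `|t - s| < l * e -> `|(1 - l) / l * (s - t)| < e.
  move=> st; rewrite normrM ger0_norm; last by rewrite divr_ge0 ?subr_ge0// ltW.
  rewrite mulrAC ltr_pdivrMr//.
  apply: (@le_lt_trans _ _ `|t - s|); last by rewrite mulrC.
  by rewrite distrC ler_piMl//; lra.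
have Dy' : D y'.
  by apply: eD; rewrite /y' /= addrAC subrr add0r; exact: small.
have l1' : 0 <= l <= 1 by rewrite ltW.
have := cD _ _ l Dy' Dx' l1'.
rewrite !convex_combination /y'/=.
have E (s t r : R) : l * (s + (1 - l) / l * (t - r)) + (1 - l) * r = l * s + (1 - l) * t.
  by field; rewrite gt_eqF.
by rewrite !E.
Qed.

Lemma convex_open_closure3 D x y z u (a1 a2 a3 : R) :
  open D -> convex_set D -> closure D z -> closure D y -> D u ->
  0 <= a1 -> 0 <= a2 -> 0 < a3 -> a1 + a2 + a3 = 1 ->
  x.1 = a1 * z.1 + a2 * y.1 + a3 * u.1 ->
  x.2 = a1 * z.2 + a2 * y.2 + a3 * u.2 -> D x.
Proof.
move=> oD cD cz cy Du a10 a20 a30 a1E x1 x2.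
have s0 : 0 < a1 + a3 by rewrite ltr_wpDl.
have Dv : D (a3 / (a1 + a3) *: u + (1 - a3 / (a1 + a3)) *: z).
  apply: convex_open_closure => //; rewrite divr_gt0//= ler_pdivrMr// mul1r.
  by rewrite lerDr.
have := @convex_open_closure D y _ (a1 + a3) oD cD cy Dv.
rewrite s0 => /(_ _)/wrap[]; first by rewrite -a1E addrAC lerDl.
rewrite [x]surjective_pairing x1 x2 !convex_combination/=.
have E (s t r : R) : (a1 + a3) * (a3 / (a1 + a3) * r + (1 - a3 / (a1 + a3)) * s)
    + (1 - (a1 + a3)) * t = a1 * s + a2 * t + a3 * r.
  have -> : 1 - (a1 + a3) = a2 by rewrite -a1E; ring.
  by field; rewrite gt_eqF.
by rewrite !E.
Qed.

Lemma affine_path_component A x w (I : set R) (s : R) : is_interval I -> I 0 -> I s ->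
  (forall r, I r -> A (x + r *: w)) -> connected_component A x (x + s *: w).
Proof.
move=> iI I0 Is AI.
apply: (@connected_component_max _ A ((fun r => x + r *: w) @` I)).
- by exists 0 => //; rewrite scale0r addr0.
- by move=> _ [r Ir <-]; exact: AI.
- apply: connected_continuous_connected; first exact/connected_intervalP.
  apply: continuous_subspaceT => r.
  by apply: cvgD; [exact: cvg_cst|apply: cvgZ; [exact: cvg_id|exact: cvg_cst]].
- by exists s.
Qed.

(* A point outside the closure of D lies on a ray that leaves D behind, hence
   in an unbounded component of the complement of the frontier. *)
Lemma enclosed_convex D : open D -> convex_set D -> D !=set0 ->
  enclosed (frontier D) `<=` D.
Proof.
move=> oD cD [d0 Dd0] x [nx bx].
have iD : D° = D by apply/interior_id.
have [//|nDx] := pselect (D x).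
have ncx : ~ closure D x by move=> cx; apply: nx; split; rewrite ?iD.
exfalso.
have ray s : 0 <= s -> ~ closure D (x + s *: (x - d0)).
  move=> s0 cs; apply: nDx.
  have s1 : 0 < 1 + s by rewrite ltr_pwDl.
  have -> : x = (s / (1 + s)) *: d0 + (1 - s / (1 + s)) *: (x + s *: (x - d0)).
    rewrite [x]surjective_pairing convex_combination/=.
    have E (p q : R) : s / (1 + s) * q + (1 - s / (1 + s)) * (p + s * (p - q)) = p.
      by field; rewrite gt_eqF.
    by congr (_, _); rewrite E.
  have [s00|s00] := eqVneq s 0.
    by exfalso; apply: ncx; move: cs; rewrite s00 scale0r addr0.
  apply: convex_open_closure => //; rewrite divr_gt0//=; last first.
    by rewrite lt_neqAle eq_sym s00.
  by rewrite ler_pdivrMr// mul1r lerDr ler01.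
have comp s : 0 <= s ->
    connected_component (~` frontier D) x (x + s *: (x - d0)).
  move=> s0; apply: (@affine_path_component _ _ _ [set r | 0 <= r]) => //=.
  - by move=> p q /= p0 q0 r /andP[pr _]; exact: le_trans pr.
  - by move=> r r0 [cr _]; exact: (ray r r0).
have [M M0 /= MP] := ex_strict_bound_gt0 bx.
have xd : 0 < `|x - d0|.
  rewrite normr_gt0 subr_eq0; apply/eqP => E; apply: nDx; rewrite E//.
pose s := (M + `|x|) / `|x - d0|.
have s0 : 0 <= s by rewrite divr_ge0// addr_ge0// ltW.
have := MP _ (comp s s0); rewrite ltNge => /negP; apply.
have -> : M = s * `|x - d0| - `|x| by rewrite /s divfK ?gt_eqF// addrK.
have <- : `|s *: (x - d0)| = s * `|x - d0| by rewrite normrZ ger0_norm.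
have := ler_normB (x + s *: (x - d0)) x.
by rewrite addrAC subrr add0r lerBlDr.
Qed.

(** Segments inside [D] avoid the frontier, so all of [D] lies in one component of its complement,
    and a single enclosed point suffices. *)
Lemma convex_enclosed D x : open D -> convex_set D -> enclosed (frontier D) x ->
  D x -> D `<=` enclosed (frontier D).
Proof.
move=> oD cD [nx bx] Dx y Dy.
have iD : D° = D by apply/interior_id.
have nf z : D z -> ~ frontier D z by move=> Dz [_]; rewrite iD.
split; first exact: nf.
suff cc : connected_component (~` frontier D) x y.
  by rewrite -(same_connected_component cc).
suff : connected_component (~` frontier D) x (x + 1 *: (y - x)).
  by rewrite scale1r addrC subrK.
apply: (@affine_path_component _ _ _ `[0, 1]) => /=.
- exact: interval_is_interval.
- by rewrite in_itv/= lexx ler01.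
- by rewrite in_itv/= lexx ler01.
- move=> r rI; apply: nf; move/convex_planeP : cD => cD.
  have := cD y x r Dy Dx; move: rI; rewrite in_itv/= => -> /(_ isT).
  suff -> : r *: y + (1 - r) *: x = x + r *: (y - x) by [].
  by rewrite scalerBr scalerBl scale1r addrCA addrA.
Qed.

Lemma max_pos (x : R) : 0 < x + `|x| -> 0 < x.
Proof. by move=> h; rewrite ltNge; apply/negP => x0; move: h; rewrite ler0_norm// subrr ltxx. Qed.

(** The sum of [|g|] and twice the positive part of [h] vanishes nowhere; its minimum over the
    compact square serves as [d]. *)
Lemma positive_near_zeros a b (g h : R -> R -> R) : a <= b ->
  jointly_continuous `[a, b] `[a, b] g -> jointly_continuous `[a, b] `[a, b] h ->
  (forall p q, p \in `[a, b] -> q \in `[a, b] -> g p q = 0 -> 0 < h p q) ->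
  exists2 d, 0 < d & forall p q, p \in `[a, b] -> q \in `[a, b] ->
    `|g p q| < d -> 0 < h p q.
Proof.
move=> ab cg ch gh.
have cnorm (f : R -> R -> R) : jointly_continuous `[a, b] `[a, b] f ->
    jointly_continuous `[a, b] `[a, b] (fun p q => `|f p q|).
  by apply: jointly_continuous_comp => p q _ _; exact: norm_continuous.
pose G p q := `|g p q| + (h p q + `|h p q|).
have cG : jointly_continuous `[a, b] `[a, b] G.
  apply: jointly_continuousD; first exact: cnorm.
  by apply: jointly_continuousD => //; exact: cnorm.
have nz : (`[a, b] `*` `[a, b]) !=set0.
  by exists (a, a); split; rewrite /= in_itv/= lexx.
have cK : compact (`[a, b] `*` `[a, b]).
  by apply: compact_setX; exact: segment_compact.
have [[p0 q0] + dP] := compact_EVT_min nz cK cG.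
rewrite inE => -[/= pI qI].
have d0 : 0 < G p0 q0.
  rewrite /G; have [g0|g0] := eqVneq (g p0 q0) 0.
    by have := gh _ _ pI qI g0 => h0; rewrite ltr_wpDl// ltr_pwDl.
  rewrite ltr_pwDl ?normr_gt0//.
  by rewrite -lerBlDl sub0r (le_trans (ler_norm _))// normrN.
exists (G p0 q0) => // p q {}pI {}qI gpq.
have := dP (p, q); rewrite inE /= => /(_ (conj pI qI)) H.
by apply: max_pos; move: H gpq; rewrite /G/=; lra.
Qed.

End convex_sets.

(** * Inner products against the sup norm of the plane *)

Section plane_vectors.
Context {R : realType}.
Implicit Types (v w t : R * R).

Lemma dot_orthonormal t w : dot t t = 1 ->
  w = dot w t *: t + dot w (J t) *: J t.
Proof.
rewrite /dot => tt; rewrite convex_combination/= [LHS]surjective_pairing.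
congr (_, _).
  transitivity (w.1 * (t.1 * t.1 + t.2 * t.2)); first by rewrite tt mulr1.
  by ring.
transitivity (w.2 * (t.1 * t.1 + t.2 * t.2)); first by rewrite tt mulr1.
by ring.
Qed.

Lemma unit_coordinates t : dot t t = 1 -> `|t.1| <= 1 /\ `|t.2| <= 1.
Proof.
rewrite /dot => tt; have := sqr_ge0 t.1; have := sqr_ge0 t.2; rewrite !expr2 => ? ?.
split; rewrite ler_norml; apply/andP; split; rewrite leNgt; apply/negP => ?; nra.
Qed.

Lemma dot_bound t w (e : R) : dot t t = 1 -> `|w| <= e -> `|dot w t| <= e + e.
Proof.
move=> /unit_coordinates[t1 t2] /norm_plane_le[w1 w2].
rewrite /dot; apply: le_trans (ler_normD _ _) _; rewrite !normrM.
apply: lerD.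
  by apply: le_trans w1; exact: ler_piMr.
by apply: le_trans w2; exact: ler_piMr.
Qed.

Lemma dot_J t : dot t t = 1 -> dot (J t) (J t) = 1.
Proof. by rewrite /dot /J/= mulrNN addrC. Qed.

Lemma dotBZl (k : R) v w t : dot (v - k *: w) t = dot v t - k * dot w t.
Proof.
have -> : v - k *: w = (v.1 - k * w.1, v.2 - k * w.2) by [].
by rewrite /dot/=; ring.
Qed.

Lemma norm_unit_ge t : dot t t = 1 -> 2^-1 <= `|t|.
Proof.
move=> tt; rewrite leNgt; apply/negP => /norm_plane_lt[].
rewrite !ltr_norml => /andP[? ?] /andP[? ?]; move: tt; rewrite /dot => ?; nra.
Qed.

(** Converts an error relative to the parameter step [h] into one relative to the progress [d] along
    the tangent. The doubled [e * h] comes from [dot_bound]. *)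
Lemma relative_error (e eps h d : R) : e <= 4^-1 -> e <= eps / 4 -> 0 < eps ->
  0 < h -> h - (e * h + e * h) <= d -> e * h + e * h <= eps * d.
Proof.
move=> e1 e2 eps0 h0 hd; have h2 : h / 2 <= d by nra.
have h3 : eps * (h / 2) <= eps * d by rewrite ler_wpM2l// ltW.
nra.
Qed.

Lemma enorm_unit t : enorm t = 1 -> dot t t = 1.
Proof.
move=> h; have t0 : 0 <= dot t t by rewrite /dot addr_ge0// -expr2 sqr_ge0.
by have := sqr_sqrtr t0; rewrite -/(enorm t) h expr1n.
Qed.

End plane_vectors.

(** * Closed curves that are the frontier of an open convex set *)

Section convex_curve.
Context {R : realType}.
Variables (sa sb : R) (sf tau kap : R -> R * R) (st : R * R -> R * R).
Variable (D : set (R * R)).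

Notation Sigma := (sf @` `[sa, sb]).

Hypothesis sab : sa < sb.
Hypothesis hsf : forall p, p \in `[sa, sb] -> has_derivative `[sa, sb] sf p (tau p).
Hypothesis htau : forall p, p \in `[sa, sb] -> has_derivative `[sa, sb] tau p (kap p).
Hypothesis ckap : {within `[sa, sb], continuous kap}.
Hypothesis tau_unit : forall p, p \in `[sa, sb] -> dot (tau p) (tau p) = 1.
Hypothesis tau_closed : tau sa = tau sb.
Hypothesis sf_closed : sf sa = sf sb.
Hypothesis tau_fiber : forall p q, p \in `[sa, sb] -> q \in `[sa, sb] ->
  sf p = sf q -> tau p = tau q.
Hypothesis stE : forall p, p \in `[sa, sb] -> st (sf p) = tau p.
Hypothesis oD : open D.
Hypothesis cD : convex_set D.
Hypothesis ED : Sigma = frontier D.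
Hypothesis DE : D `<=` enclosed Sigma.
Hypothesis inner : forall p, p \in `[sa, sb] ->
  exists e, 0 < e /\ D (sf p + e *: J (tau p)).

Let saI : sa \in `[sa, sb]. Proof. by rewrite in_itv/= lexx ltW. Qed.
Let sbI : sb \in `[sa, sb]. Proof. by rewrite in_itv/= lexx ltW. Qed.

Let csf : {within `[sa, sb], continuous sf}.
Proof. exact: has_derivative_continuous hsf. Qed.

Let ctau : {within `[sa, sb], continuous tau}.
Proof. exact: has_derivative_continuous htau. Qed.

Lemma convex_curve_unit x : Sigma x -> dot (st x) (st x) = 1.
Proof. by move=> [p pI <-]; rewrite stE// tau_unit. Qed.

(** Points of the curve ahead of or behind [sf p], of arbitrarily small slope against the tangent.
    Where the parameter interval ends, the other parameter of the same point supplies the missing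
    direction. *)
Let approach s (p : R) (eps : R) : (s = 1 \/ s = -1) -> p \in `[sa, sb] -> 0 < eps ->
  exists q, [/\ q \in `[sa, sb], 0 < s * dot (sf q - sf p) (tau p) &
    `|dot (sf q - sf p) (J (tau p))| <= eps * (s * dot (sf q - sf p) (tau p))].
Proof.
move=> s1 pI eps0.
suff [p' [p'I E1 E2 hp]] : exists p', [/\ p' \in `[sa, sb], sf p' = sf p,
    tau p' = tau p & forall d, 0 < d -> exists q, [/\ q \in `[sa, sb],
      0 < s * (q - p') & `|q - p'| < d]].
  rewrite -E1 -E2.
  pose e := Num.min (4^-1) (eps / 4).
  have e0 : 0 < e by rewrite lt_min invr_gt0 divr_gt0// ltr0n.
  have e4 : e <= 4^-1 by rewrite ge_min lexx.
  have ee : e <= eps / 4 by rewrite ge_min lexx orbT.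
  have /has_derivative_epsP/(_ _ e0)[d d0 dP] := hsf p'I.
  have [q [qI sq qd]] := hp d d0.
  exists q; split=> //.
    have := dot_bound (tau_unit p'I) (dP q qI qd).
    rewrite (dotBZl (q - p') (sf q - sf p') (tau p')) tau_unit// mulr1.
    move: sq; case: s1 => ->; rewrite ?mul1r ?mulN1r ?oppr_gt0 => sq.
      rewrite (gtr0_norm sq) ler_norml => /andP[? _]; nra.
    rewrite (ltr0_norm sq) ler_norml => /andP[_ ?]; nra.
  have H1 := dot_bound (tau_unit p'I) (dP q qI qd).
  have := dot_bound (dot_J (tau_unit p'I)) (dP q qI qd).
  have dJ : dot (tau p') (J (tau p')) = 0 by rewrite /dot /J/=; ring.
  rewrite (dotBZl (q - p') (sf q - sf p') (tau p')) dJ mulr0 subr0 => H2; apply: le_trans H2 _.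
  move: H1; rewrite (dotBZl (q - p') (sf q - sf p') (tau p')) tau_unit// mulr1.
  move: sq; case: s1 => ->; rewrite ?mul1r ?mulN1r ?oppr_gt0 => sq.
    rewrite (gtr0_norm sq) ler_norml => /andP[? _].
    by apply: relative_error => //; lra.
  rewrite (ltr0_norm sq) ler_norml => /andP[_ ?].
  by apply: relative_error => //; lra.
have /andP[ap pb] : sa <= p <= sb by move: pI; rewrite in_itv.
have forward p' : sa <= p' < sb -> forall d, 0 < d -> exists q, [/\ q \in `[sa, sb],
      0 < 1 * (q - p') & `|q - p'| < d].
  move=> /andP[ap' pb'] d /(exists_segment_right ap' pb')[q [qI q1 q2]].
  exists q; rewrite mul1r subr_gt0 gtr0_norm ?subr_gt0//; split=> //; lra.
have backward p' : sa < p' <= sb -> forall d, 0 < d -> exists q, [/\ q \in `[sa, sb],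
      0 < -1 * (q - p') & `|q - p'| < d].
  move=> /andP[ap' pb'] d /(exists_segment_left pb' ap')[q [qI q1 q2]].
  exists q; rewrite mulN1r oppr_gt0 subr_lt0 ltr0_norm ?subr_lt0//; split=> //; lra.
case: s1 => ->.
  have [->|pb'] := eqVneq p sb.
    by exists sa; split=> //; apply: forward; rewrite lexx.
  by exists p; split=> //; apply: forward; rewrite ap lt_neqAle pb'.
have [->|pa'] := eqVneq p sa.
  by exists sb; split=> //; apply: backward; rewrite lexx sab.
by exists p; split=> //; apply: backward; rewrite pb lt_neqAle eq_sym pa' ap.
Qed.

(* If z were on the wrong side of the tangent at x, then x would be an interior
   point of the triangle formed by z, a point of the curve near x and an
   enclosed point above x. *)
Lemma convex_curve_line x z : Sigma x -> Sigma z -> 0 <= dot (z - x) (J (st x)).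
Proof.
move=> Sx Sz; case: (Sx) => p pI px; move: (Sx) Sz => Sx' Sz.
rewrite -px stE// px leNgt; apply/negP => zneg.
have uu := tau_unit pI.
have [e [e0 De]] : exists e, 0 < e /\ D (x + e *: J (tau p)).
  by rewrite -px; exact: inner.
pose al := dot (z - x) (tau p).
pose be := - dot (z - x) (J (tau p)).
have be0 : 0 < be by rewrite oppr_gt0.
(* The auxiliary point of the curve is sought on the side of the normal at [x] away from [z]. *)
have [s [s1 sal]] : exists s : R, (s = 1 \/ s = -1) /\ s * al <= 0.
  have [a0|a0] := leP al 0; first by exists 1; split; [left|rewrite mul1r].
  by exists (-1); split; [right|rewrite mulN1r oppr_le0 ltW].
pose A := - (s * al).
have A0 : 0 <= A by rewrite oppr_ge0.
(* With this slope [A * |g|] is at most [be / 2 * h], which makes the weight [a3] below positive. *)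
have [|q [qI]] := @approach s p (be / 2 / (A + 1)) s1 pI.
  by rewrite !divr_gt0// ltr_wpDl.
rewrite px; set h := s * _; set g := dot _ (J _) => h0 gh.
have cz : closure D z by move: Sz; rewrite ED => -[].
have cy : closure D (sf q) by have : Sigma (sf q) by [exists q]; rewrite ED => -[].
have ss : s * s = 1 by case: s1 => ->; ring.
have num0 : 0 < h * be - A * g.
  have Ag : `|A * g| <= be / 2 * h.
    rewrite normrM (ger0_norm A0).
    apply: (@le_trans _ _ (A * (be / 2 / (A + 1) * h))); first by rewrite ler_wpM2l.
    rewrite mulrA; apply: ler_wpM2r; first exact: ltW.
    rewrite mulrA ler_pdivrMr; last by rewrite ltr_wpDl.
    nra.
  by move: Ag; rewrite ler_norml => /andP[_ ?]; nra.
(* With weights [h], [A], [a3] on [z], [sf q] and the point of [D] above [x], the tangential parts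
   cancel as [h * al + A * s * h = 0], and [a3] is chosen to cancel the normal parts. Divided by
   their sum [S'], they represent [x]. *)
pose a3 := (h * be - A * g) / e.
have a30 : 0 < a3 by rewrite divr_gt0.
pose S' := h + A + a3.
have S0 : 0 < S' by rewrite /S' addr_gt0// ltr_pwDl.
have zE : z - x = al *: tau p - be *: J (tau p).
  by rewrite {1}(dot_orthonormal (z - x) uu) /be scaleNr opprK.
have yE : sf q - x = (s * h) *: tau p + g *: J (tau p).
  by rewrite {1}(dot_orthonormal (sf q - x) uu) /h mulrA ss mul1r.
have aE : al = - (s * A) by rewrite /A mulrN opprK mulrA ss mul1r.
have Dx : D x.
  have S1 : S' != 0 by rewrite gt_eqF.
  have e1 : e != 0 by rewrite gt_eqF.
  have key (xx zz yy t n : R) : zz - xx = al * t - be * n ->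
      yy - xx = s * h * t + g * n ->
      xx = h / S' * zz + A / S' * yy + a3 / S' * (xx + e * n).
    move=> /eqP; rewrite subr_eq => /eqP -> /eqP; rewrite subr_eq => /eqP ->.
    have -> : h / S' * (al * t - be * n + xx) + A / S' * (s * h * t + g * n + xx) +
      a3 / S' * (xx + e * n) = xx * ((h + A + a3) / S') + (h * al + A * s * h) / S' * t +
        (a3 * e - (h * be - A * g)) / S' * n by ring.
    rewrite aE /a3 divfK// -/a3 -/S' divff//.
    by ring.
  apply: (@convex_open_closure3 _ D x (sf q) z _ (h / S') (A / S') (a3 / S')
    oD cD cz cy De).
  - by rewrite divr_ge0// ltW.
  - by rewrite divr_ge0// ltW.
  - by rewrite divr_gt0.
  - by rewrite -!mulrDl -/S' divff.
  - by apply: (key _ _ _ (tau p).1); [move: (congr1 fst zE)|move: (congr1 fst yE)].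
  - by apply: (key _ _ _ (tau p).2); [move: (congr1 snd zE)|move: (congr1 snd yE)].
by move: Sx'; rewrite ED => -[_]; apply; move/interior_id : oD => ->.
Qed.

(** [inner] gives a depth for each point. Continuity of the normal carries it to neighbouring
    points, convexity puts the whole normal segment into [D], and compactness makes the depth
    uniform. *)
Lemma convex_curve_inner : exists2 r0, 0 < r0 & forall x r, Sigma x ->
  0 < r <= r0 -> ~ outer_domain Sigma (x + r *: J (st x)) /\
    ~ Sigma (x + r *: J (st x)).
Proof.
suff [r0 r00 rP] : exists2 r0, 0 < r0 & forall p r, p \in `[sa, sb] ->
    0 < r < r0 -> D (sf p + r *: J (tau p)).
  exists (r0 / 2); first by rewrite divr_gt0.
  move=> x r [p pI <-] /andP[r1 r2]; rewrite stE//.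
  have Dr : D (sf p + r *: J (tau p)) by apply: rP => //; rewrite r1/=; lra.
  split; first by apply; apply: subset_closure; exact: DE.
  by rewrite ED => -[_]; apply; move/interior_id : oD => ->.
have /compact_near_coveringP/(_ R (nbhs (0:R))
   (fun r p => p \in `[sa, sb] -> 0 < r -> D (sf p + r *: J (tau p)))) :=
   @segment_compact R sa sb.
move=> /(_ _ _)/wrap[].
  move=> p pI.
  have [e [e0 De]] := inner pI.
  move: (oD); rewrite openE => /(_ _ De)/plane_nbhsP[d d0 dP].
  have d20 : 0 < d / 2 by rewrite divr_gt0.
  move/within_continuousP_eps : (csf) => /(_ p pI _ d20)[d1 d10 P1].
  have de0 : 0 < d / 2 / e by rewrite divr_gt0.
  move/within_continuousP_eps : (ctau) => /(_ p pI _ de0)[d2 d20' P2].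
  exists (ball p (Num.min d1 d2), ball 0 e) => /=.
    by split; apply: nbhsx_ballx => //; rewrite lt_min d10.
  move=> -[q r] [/= pq re] qI r0.
  have {}re : r < e by move: re; rewrite /ball/= sub0r normrN; exact: le_lt_trans (ler_norm _).
  have {}pq : `|q - p| < Num.min d1 d2 by rewrite distrC.
  have /norm_plane_lt[f1 f2] : `|sf q - sf p| < d / 2.
    by apply: P1 => //; apply: lt_le_trans pq _; rewrite ge_min lexx.
  have /norm_plane_lt[t1 t2] : `|tau q - tau p| < d / 2 / e.
    by apply: P2 => //; apply: lt_le_trans pq _; rewrite ge_min lexx orbT.
  have small (u v : R) : `|u| < d / 2 -> `|v| < d / 2 / e -> `|u + e * v| < d.
    move=> u1 v1; apply: le_lt_trans (ler_normD _ _) _; rewrite (splitr d) ltrD//.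
    by rewrite normrM gtr0_norm// mulrC -ltr_pdivlMr.
  have key (u v w t : R) : u + e * v - (w + e * t) = (u - w) + e * (v - t) by ring.
  have De' : D (sf q + e *: J (tau q)).
    apply: dP.
      rewrite -[X in `|X|]/((sf q).1 + e * - (tau q).2 - ((sf p).1 + e * - (tau p).2)).
      by rewrite key; apply: small => //; rewrite -opprD normrN.
    rewrite -[X in `|X|]/((sf q).2 + e * (tau q).1 - ((sf p).2 + e * (tau p).1)).
    by rewrite key; apply: small.
  have cq : closure D (sf q) by have : Sigma (sf q) by [exists q]; rewrite ED => -[].
  have re1 : 0 < r / e <= 1.
    by rewrite (divr_gt0 r0 e0) (ler_pdivrMr _ _ e0) mul1r (ltW re).
  have := convex_open_closure oD cD cq De' re1.
  suff -> : r / e *: (sf q + e *: J (tau q)) + (1 - r / e) *: sf q =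
    sf q + r *: J (tau q) by [].
  rewrite scalerDr scalerA divfK; last by rewrite (gt_eqF e0).
  rewrite addrAC -scalerDl addrC.
  by rewrite [r / e + _]addrC subrK scale1r addrC.
move=> /nbhs_ballP[d/= d0 dP]; exists d => // p r pI /andP[r0 rd].
by apply: (dP r) => //; rewrite /ball/= sub0r normrN gtr0_norm.
Qed.

Let jtau : jointly_continuous `[sa, sb] `[sa, sb] (fun p q => dot (tau p) (tau q)).
Proof.
have c1 : {within `[sa, sb], continuous (fun p => (tau p).1)}.
  exact: has_derivative_continuous (fun p pI => has_derivative_fst (htau pI)).
have c2 : {within `[sa, sb], continuous (fun p => (tau p).2)}.
  exact: has_derivative_continuous (fun p pI => has_derivative_snd (htau pI)).
apply: jointly_continuousD; apply: jointly_continuousM.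
- exact: jointly_continuous_left.
- exact: jointly_continuous_right.
- exact: jointly_continuous_left.
- exact: jointly_continuous_right.
Qed.

(** Points close in the plane may have distant parameters, so continuity of the tangent in the
    parameter is not enough; compactness is applied to pairs of parameters. *)
Lemma convex_curve_close : exists2 C, 0 < C & forall x y, Sigma x -> Sigma y ->
  `|x - y| < C -> 0 < dot (st x) (st y).
Proof.
have c1 : {within `[sa, sb], continuous (fun p => (sf p).1)}.
  exact: has_derivative_continuous (fun p pI => has_derivative_fst (hsf pI)).
have c2 : {within `[sa, sb], continuous (fun p => (sf p).2)}.
  exact: has_derivative_continuous (fun p pI => has_derivative_snd (hsf pI)).
pose g p q := `|(sf p).1 - (sf q).1| + `|(sf p).2 - (sf q).2|.
have cg : jointly_continuous `[sa, sb] `[sa, sb] g.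
  have aux (f : R -> R) : {within `[sa, sb], continuous f} ->
      jointly_continuous `[sa, sb] `[sa, sb] (fun p q => `|f p - f q|).
    move=> cf; apply: (@jointly_continuous_comp _ _ _ (fun p q => f p - f q)
      (fun r => `|r|)) => [p q _ _|]; first exact: norm_continuous.
    apply: jointly_continuousD; first exact: jointly_continuous_left.
    by apply: jointly_continuousN; exact: jointly_continuous_right.
  by apply: jointly_continuousD; exact: aux.
have [|d d0 dP] := positive_near_zeros (ltW sab) cg jtau.
  move=> p q pI qI /eqP; rewrite paddr_eq0// !normr_eq0 !subr_eq0.
  move=> /andP[/eqP E1 /eqP E2].
  have -> : tau p = tau q.
    by apply: tau_fiber => //; rewrite [LHS]surjective_pairing E1 E2 -surjective_pairing.
  by rewrite tau_unit.
exists (d / 2); first by rewrite divr_gt0.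
move=> _ _ [p pI <-] [q qI <-] /norm_plane_lt[n1 n2]; rewrite !stE//.
apply: dP => //; rewrite ger0_norm; last by rewrite addr_ge0.
by rewrite /g (splitr d) ltrD.
Qed.

(** [M] is uniform, whereas [eta] may depend on [x]. Covering all parameters by compactness handles
    the two parameters of the junction point together. *)
Lemma convex_curve_lipschitz : exists2 M, 0 < M & forall x, Sigma x ->
  exists2 eta, 0 < eta & forall y, Sigma y -> `|y - x| < eta ->
    `|st y - st x| <= M * `|y - x|.
Proof.
have cnk : {within `[sa, sb], continuous (fun p => `|kap p|)}.
  apply/within_continuousP_eps => p pI e e0.
  move/within_continuousP_eps : (ckap) => /(_ p pI e e0)[d d0 dP].
  exists d => // q qI qp; apply: le_lt_trans (dP q qI qp).
  exact: ler_dist_dist.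
have [m mI mP] := EVT_max (ltW sab) cnk.
pose K := `|kap m|.
have K0 : 0 <= K by exact: normr_ge0.
(* Near a parameter of [x] the tangent changes by at most [K + 1] per unit of parameter. The
   position changes by at least [1/4]: a unit vector has sup norm at least [1/2], and [1/4] is given
   up to the linearisation error. *)
exists (4 * (K + 1)); first by rewrite mulr_gt0// ltr_wpDl.
move=> x Sx; have [p pI px] := Sx.
have /compact_near_coveringP/(_ R (nbhs (0:R))
   (fun eta q => q \in `[sa, sb] -> `|sf q - x| < eta ->
     `|tau q - st x| <= 4 * (K + 1) * `|sf q - x|)) :=
   @segment_compact R sa sb.
move=> /(_ _ _)/wrap[]; last first.
  move=> /nbhs_ballP[d/= d0 dP]; exists (d / 2); first by rewrite divr_gt0.
  move=> _ [q qI <-] qx; rewrite stE//; apply: (dP (d / 2)) => //.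
  by rewrite /ball/= sub0r normrN gtr0_norm; lra.
move=> q0 q0I; have [E|n0] := eqVneq (sf q0) x.
  have tE : st x = tau q0 by rewrite -E stE.
  have /has_derivative_epsP/(_ 1 ltr01)[d1 d10 P1] := htau q0I.
  have e40 : (0 : R) < 4^-1 by rewrite invr_gt0.
  have /has_derivative_epsP/(_ _ e40)[d2 d20 P2] := hsf q0I.
  exists (ball q0 (Num.min d1 d2), setT) => /=.
    by split; [apply: nbhsx_ballx; rewrite lt_min d10|exact: filterT].
  move=> -[q r] [/= qq _] qI _.
  have {}qq : `|q - q0| < Num.min d1 d2 by rewrite distrC.
  have := P1 q qI (lt_le_trans qq _); rewrite ge_min lexx => /(_ isT) h1.
  have := P2 q qI (lt_le_trans qq _); rewrite ge_min lexx orbT => /(_ isT) h2.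
  rewrite tE -E.
  have u1 : `|tau q - tau q0| <= (K + 1) * `|q - q0|.
    rewrite -[tau q - _](subrK ((q - q0) *: kap q0)).
    apply: le_trans (ler_normD _ _) _; rewrite normrZ.
    have kK : `|kap q0| <= K by exact: mP.
    apply: le_trans (lerD h1 (ler_wpM2l (normr_ge0 _) kK)) _.
    by rewrite mulrDl addrC mulrC.
  have u2 : `|q - q0| <= 4 * `|sf q - sf q0|.
    have := ler_normB (sf q - sf q0) (sf q - sf q0 - (q - q0) *: tau q0).
    rewrite opprB addrCA subrr addr0 normrZ => h3.
    have t2 := norm_unit_ge (tau_unit q0I).
    have := ler_wpM2l (normr_ge0 (q - q0)) t2; lra.
  apply: le_trans u1 _; rewrite [4 * _]mulrC -mulrA ler_wpM2l//.
  by rewrite addr_ge0.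
(* Parameters near [q0] are mapped away from [x], so for small [eta] there is nothing to prove. *)
pose n := `|sf q0 - x|.
have n00 : 0 < n by rewrite normr_gt0 subr_eq0.
have n20 : 0 < n / 2 by rewrite divr_gt0.
move/within_continuousP_eps : (csf) => /(_ q0 q0I _ n20)[d d0 dP].
exists (ball q0 d, ball 0 (n / 2)) => /=.
  by split; apply: nbhsx_ballx.
move=> -[q r] [/= qq re] qI qr; exfalso.
have {}re : r < n / 2 by move: re; rewrite /ball/= sub0r normrN; exact: le_lt_trans (ler_norm _).
have := dP q qI; rewrite distrC => /(_ qq) h1.
have : n < n / 2 + n / 2.
  rewrite {1}/n -(subrKA (sf q)); apply: le_lt_trans (ler_normD _ _) _.
  by rewrite ltrD ?(lt_trans qr)// distrC.
by rewrite -splitr ltxx.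
Qed.

End convex_curve.

(** * Geometry of the support curve *)

Section support_curves.
Context {R : realType}.
Variables (sa sb : R) (sf : R -> R * R).
Hypothesis hS : support_curve sa sb sf.

Notation Sigma := (sf @` `[sa, sb]).
Notation st := (support_tangent sa sb sf).
Notation tau := (derive_within `[sa, sb] sf).

Lemma support_derivative p : p \in `[sa, sb] ->
  has_derivative `[sa, sb] sf p (tau p).
Proof. by move=> pI; have := support_smooth hS (n := 0) pI. Qed.

Lemma support_derivative2 p : p \in `[sa, sb] ->
  has_derivative `[sa, sb] tau p (derive_within `[sa, sb] tau p).
Proof. by move=> pI; have := support_smooth hS (n := 1) pI. Qed.

Lemma support_derivative2_continuous :
  {within `[sa, sb], continuous (derive_within `[sa, sb] tau)}.
Proof.
apply: (@has_derivative_continuous _ _ _ _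
  (derive_within `[sa, sb] (derive_within `[sa, sb] tau))) => p pI.
by have := support_smooth hS (n := 2) pI.
Qed.

Lemma support_unit p : p \in `[sa, sb] -> dot (tau p) (tau p) = 1.
Proof. by move=> pI; apply: enorm_unit; exact: (support_arclength hS pI). Qed.

Lemma support_tangentE p : p \in `[sa, sb] -> tangent sa sb sf p = tau p.
Proof.
by move=> pI; rewrite /tangent /darc (support_arclength hS pI) invr1 scale1r.
Qed.

Lemma support_tau_closed : tau sa = tau sb.
Proof. exact: (support_smoothly_closed hS 1). Qed.

Lemma support_closed : sf sa = sf sb.
Proof. exact: (support_smoothly_closed hS 0). Qed.

(** The only repeated point is the junction, where smooth closedness matches the derivatives. Hence
    the choice made by [xget] in [support_tangent] is harmless. *)
Lemma support_tau_fiber p q : p \in `[sa, sb] -> q \in `[sa, sb] ->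
  sf p = sf q -> tau p = tau q.
Proof.
have sab := support_lt hS.
have sf_inj : {in `[sa, sb[ &, injective sf} by have [[]] := support_convex hS.
have wlog_lt (u : R) : u \in `[sa, sb] -> exists u', [/\ u' \in `[sa, sb[,
    sf u' = sf u & tau u' = tau u].
  move=> uI; have [->|ub] := eqVneq u sb.
    exists sa; split; [by rewrite in_itv/= lexx sab|exact: support_closed|].
    exact: support_tau_closed.
  exists u; split=> //; move: uI; rewrite !in_itv/= => /andP[-> /=].
  by rewrite lt_neqAle ub.
move=> /wlog_lt[p' [p'I pE <-]] /wlog_lt[q' [q'I qE <-]] E.
by rewrite (sf_inj p' q')// pE qE.
Qed.

Lemma support_tangent_fieldE p : p \in `[sa, sb] -> st (sf p) = tau p.
Proof.
move=> pI; rewrite /support_tangent.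
set P := [set q | _].
have [qI E] : P (xget sa P) by apply: xgetPex; exists p.
by rewrite (support_tangentE qI); exact: (support_tau_fiber qI pI E).
Qed.

(** Orientation is stated with [enclosed], convexity with some set [D]. Points just inside along the
    normal are enclosed, hence in [D], and one such point makes all of [D] enclosed. *)
Lemma support_domain : exists D : set (R * R), [/\ open D, convex_set D,
  Sigma = frontier D, D `<=` enclosed Sigma &
  forall p, p \in `[sa, sb] -> exists e, 0 < e /\ D (sf p + e *: J (tau p))].
Proof.
have [_ [D [D0 oD cD E]]] := support_convex hS.
have sab := support_lt hS.
have inD p : p \in `[sa, sb] ->
    exists e, [/\ 0 < e, enclosed Sigma (sf p + e *: J (tau p)) &
       D (sf p + e *: J (tau p))].
  move=> pI; have h := support_oriented hS pI.
  have [e [e0]] := filter_ex (filterI (nbhs_right_gt (0 : R)) h).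
  rewrite /normal (support_tangentE pI) => he.
  exists e; split=> //; apply: (enclosed_convex oD cD D0).
  by rewrite -E.
exists D; split=> //; last first.
  by move=> p /inD[e [e0 _ De]]; exists e.
have saI : sa \in `[sa, sb] by rewrite in_itv/= lexx ltW.
have [e [_ he De]] := inD sa saI.
by move: he; rewrite E => he; exact: (convex_enclosed oD cD he De).
Qed.

Lemma support_tangent_unit x : Sigma x -> dot (st x) (st x) = 1.
Proof. exact: convex_curve_unit support_unit support_tangent_fieldE x. Qed.

Lemma support_line x z : Sigma x -> Sigma z -> 0 <= dot (z - x) (J (st x)).
Proof.
have [D [oD cD ED DE inner]] := support_domain.
apply: (convex_curve_line (support_lt hS) support_derivative support_unit
  support_tau_closed support_closed support_tangent_fieldE oD cD ED inner).
Qed.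

Lemma support_inner : exists2 r0, 0 < r0 & forall x r, Sigma x ->
  0 < r <= r0 -> ~ outer_domain Sigma (x + r *: J (st x)) /\
    ~ Sigma (x + r *: J (st x)).
Proof.
have [D [oD cD ED DE inner]] := support_domain.
exact: (convex_curve_inner support_derivative support_derivative2
  support_tangent_fieldE oD cD ED DE inner).
Qed.

Lemma support_tangents_close : exists2 C, 0 < C & forall x y, Sigma x -> Sigma y ->
  `|x - y| < C -> 0 < dot (st x) (st y).
Proof.
exact: (convex_curve_close (support_lt hS) support_derivative support_derivative2
  support_unit support_tau_fiber support_tangent_fieldE).
Qed.

Lemma support_tangent_lipschitz : exists2 M, 0 < M & forall x, Sigma x ->
  exists2 eta, 0 < eta & forall y, Sigma y -> `|y - x| < eta ->
    `|st y - st x| <= M * `|y - x|.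
Proof.
exact: (convex_curve_lipschitz (support_lt hS) support_derivative support_derivative2
  support_derivative2_continuous support_unit support_tangent_fieldE).
Qed.

End support_curves.

(** * Speed, frame and curvature in coordinates *)

Section moving_frame.
Context {R : realType}.
Implicit Types (A : set R) (X Y dX dY : R -> R).

Definition length2 (x y : R) : R := Num.sqrt (x ^+ 2 + y ^+ 2).

(** Curvature from velocity [(x, y)] and acceleration [(dx, dy)]. Unlike the nested arclength
    derivatives, this form is readily differentiated in space and in time. *)
Definition curvature2 (x y dx dy : R) : R := (x * dy - y * dx) / length2 x y ^+ 3.

Lemma length2_gt0 x y : 0 < x ^+ 2 + y ^+ 2 -> 0 < length2 x y.
Proof. by move=> h; rewrite sqrtr_gt0. Qed.

Lemma sqr_length2 x y : length2 x y ^+ 2 = x ^+ 2 + y ^+ 2.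
Proof. by rewrite sqr_sqrtr// addr_ge0 ?sqr_ge0. Qed.

Lemma has_derivative_length2 A X Y t x y : 0 < X t ^+ 2 + Y t ^+ 2 ->
  has_derivative A X t x -> has_derivative A Y t y ->
  has_derivative A (fun s => length2 (X s) (Y s)) t
    ((X t * x + Y t * y) / length2 (X t) (Y t)).
Proof.
move=> n0 hX hY; set l := (X in has_derivative _ _ _ X).
have -> : l = (x * X t + X t * x + (y * Y t + Y t * y)) /
    (2 * Num.sqrt (X t * X t + Y t * Y t)).
  rewrite /l /length2 -!expr2; have : Num.sqrt (X t ^+ 2 + Y t ^+ 2) != 0.
    by rewrite gt_eqF// sqrtr_gt0.
  by move=> ?; field.
apply: (@has_derivative_sqrt _ _ (fun s => X s * X s + Y s * Y s)).
  by rewrite -!expr2.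
by apply: has_derivativeD; apply: has_derivativeM.
Qed.

Lemma has_derivative_curvature2 A X Y dX dY t x y dx dy :
  0 < X t ^+ 2 + Y t ^+ 2 ->
  has_derivative A X t x -> has_derivative A Y t y ->
  has_derivative A dX t dx -> has_derivative A dY t dy ->
  has_derivative A (fun s => curvature2 (X s) (Y s) (dX s) (dY s)) t
    ((x * dY t + X t * dy - y * dX t - Y t * dx) / length2 (X t) (Y t) ^+ 3 -
     3 * curvature2 (X t) (Y t) (dX t) (dY t) *
     ((X t * x + Y t * y) / length2 (X t) (Y t)) / length2 (X t) (Y t)).
Proof.
move=> n0 hX hY hdX hdY; have hV := has_derivative_length2 n0 hX hY.
have V0 := length2_gt0 n0; set V := length2 _ _ in hV V0 *.
set l := (X in has_derivative _ _ _ X); set V1 := (_ / V) in hV l *.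
have Vn : V != 0 by rewrite gt_eqF.
have h3 := has_derivativeM hV (has_derivativeM hV hV).
have h3n : length2 (X t) (Y t) * (length2 (X t) (Y t) * length2 (X t) (Y t)) != 0.
  by rewrite !mulf_neq0.
have h := has_derivativeM (has_derivativeB (has_derivativeM hX hdY)
  (has_derivativeM hY hdX)) (@has_derivativeV _ A (fun s => length2 (X s) (Y s) *
    (length2 (X s) (Y s) * length2 (X s) (Y s))) t _ h3n h3).
have -> : l = (x * dY t + X t * dy - (y * dX t + Y t * dx)) /
    (length2 (X t) (Y t) * (length2 (X t) (Y t) * length2 (X t) (Y t))) +
    (X t * dY t - Y t * dX t) *
    - ((V1 * (length2 (X t) (Y t) * length2 (X t) (Y t)) +
        length2 (X t) (Y t) * (V1 * length2 (X t) (Y t) + length2 (X t) (Y t) * V1)) /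
       (length2 (X t) (Y t) * (length2 (X t) (Y t) * length2 (X t) (Y t))) ^+ 2).
  by rewrite /l /curvature2 -/V; field.
by under eq_fun do rewrite /curvature2 exprS expr2.
Qed.

Lemma frame_unit x y : 0 < x ^+ 2 + y ^+ 2 ->
  (x / length2 x y) ^+ 2 + (y / length2 x y) ^+ 2 = 1.
Proof.
move=> n0; rewrite !expr_div_n -mulrDl sqr_length2 divff// gt_eqF//.
Qed.

(** The Frenet equations. They serve for the time variable too, where [K * V] is the angular
    velocity of the tangent. *)
Lemma frame_derivative A X Y t x y : 0 < X t ^+ 2 + Y t ^+ 2 ->
  has_derivative A X t x -> has_derivative A Y t y ->
  let V := length2 (X t) (Y t) in let K := curvature2 (X t) (Y t) x y in
  has_derivative A (fun s => X s / length2 (X s) (Y s)) t (- (K * V * (Y t / V))) /\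
  has_derivative A (fun s => Y s / length2 (X s) (Y s)) t (K * V * (X t / V)).
Proof.
move=> n0 hX hY V K; have hV := has_derivative_length2 n0 hX hY.
have V0 := length2_gt0 n0; have Vn : V != 0 by rewrite gt_eqF.
have hVi := @has_derivativeV _ A (fun s => length2 (X s) (Y s)) t _ Vn hV.
have V2 : V ^+ 2 = X t ^+ 2 + Y t ^+ 2 by exact: sqr_length2.
split.
  have := has_derivativeM hX hVi; rewrite -/V.
  set l1 := (X in has_derivative _ _ _ X); set l2 := (X in _ -> has_derivative _ _ _ X).
  suff -> : l2 = l1 by [].
  rewrite /l1 /l2 /K /curvature2 -/V.
  transitivity ((x * V ^+ 2 - X t * (X t * x + Y t * y)) / V ^+ 3); last by field.
  by rewrite V2; field.
have := has_derivativeM hY hVi; rewrite -/V.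
set l1 := (X in has_derivative _ _ _ X); set l2 := (X in _ -> has_derivative _ _ _ X).
suff -> : l2 = l1 by [].
rewrite /l1 /l2 /K /curvature2 -/V.
transitivity ((y * V ^+ 2 - Y t * (X t * x + Y t * y)) / V ^+ 3); last by field.
by rewrite V2; field.
Qed.

Lemma frame_acceleration x y dx dy : 0 < x ^+ 2 + y ^+ 2 ->
  let V := length2 x y in let K := curvature2 x y dx dy in
  let V1 := (x * dx + y * dy) / V in
  dx = V1 * (x / V) - K * V ^+ 2 * (y / V) /\
  dy = V1 * (y / V) + K * V ^+ 2 * (x / V).
Proof.
move=> n0 V K V1; have V0 := length2_gt0 n0; have Vn : V != 0 by rewrite gt_eqF.
have V2 : V ^+ 2 = x ^+ 2 + y ^+ 2 by exact: sqr_length2.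
rewrite /V1 /K /curvature2 -/V; split.
  transitivity (dx * (x ^+ 2 + y ^+ 2) / V ^+ 2); first by rewrite -V2 mulfK// expf_neq0.
  by field.
transitivity (dy * (x ^+ 2 + y ^+ 2) / V ^+ 2); first by rewrite -V2 mulfK// expf_neq0.
by field.
Qed.

(* Here k1, k2 and V1 stand for the derivatives of the curvature and of the speed
   in the space parameter; B differs from the curvature by a function of time
   only, so that k1 is also the derivative of B. *)
Lemma normal_motion_evolution A X Y dX dY t (B k1 k2 : R) :
  0 < X t ^+ 2 + Y t ^+ 2 ->
  let V := length2 (X t) (Y t) in
  let K := curvature2 (X t) (Y t) (dX t) (dY t) in
  let V1 := (X t * dX t + Y t * dY t) / V in
  let C := X t / V in let S := Y t / V in
  let m := k1 * K * V + B * k1 * V + B * K * V1 in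
  has_derivative A X t (- (k1 * S + B * K * V * C)) ->
  has_derivative A Y t (k1 * C - B * K * V * S) ->
  has_derivative A dX t
    (- (k2 * S + k1 * (K * V * C) + (m * C + B * K * V * - (K * V * S)))) ->
  has_derivative A dY t
    (k2 * C + k1 * - (K * V * S) - (m * S + B * K * V * (K * V * C))) ->
  has_derivative A (fun s => length2 (X s) (Y s)) t (- (B * K * V)) /\
  has_derivative A (fun s => curvature2 (X s) (Y s) (dX s) (dY s)) t
    (k2 / V ^+ 2 - V1 * k1 / V ^+ 3 + B * K ^+ 2).
Proof.
move=> n0 V K V1 C S m hX hY hdX hdY.
have CS : C ^+ 2 + S ^+ 2 = 1 by exact: frame_unit.
have V0 := length2_gt0 n0; have Vn : V != 0 by rewrite gt_eqF.
have XE : X t = V * C by rewrite /C mulrC divfK.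
have YE : Y t = V * S by rewrite /S mulrC divfK.
have [dXE dYE] := frame_acceleration (dX t) (dY t) n0.
rewrite -/V -/K -/V1 -/C -/S in dXE dYE.
have E1 : (X t * - (k1 * S + B * K * V * C) + Y t * (k1 * C - B * K * V * S)) / V =
    - (B * K * V).
  transitivity (- (B * K * V) * (C ^+ 2 + S ^+ 2)); last by rewrite CS mulr1.
  by rewrite XE YE; field.
split.
  have := has_derivative_length2 n0 hX hY; rewrite -/V.
  by rewrite E1.
have := has_derivative_curvature2 n0 hX hY hdX hdY; rewrite -/V -/K.
set l1 := (X in has_derivative _ _ _ X); set l2 := (X in _ -> has_derivative _ _ _ X).
suff -> : l2 = l1 by [].
rewrite /l1 /l2 E1 dXE dYE XE YE; clearbody m V K V1 C S.
(* The part of the acceleration rate containing [m] is tangential and drops out of the cross product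
   with the velocity. *)
set N := (X in X / V ^+ 3 - _).
have -> : N = (k2 * V - V1 * k1 - 2 * B * K ^+ 2 * V ^+ 3 +
    m * 0) * (C ^+ 2 + S ^+ 2) by rewrite /N; ring.
by rewrite CS; field.
Qed.

Section plane_curve.
Variables (a b : R) (f : R -> R * R) (X Y dX dY : R -> R).
Hypothesis ab : a < b.
Hypothesis hf1 : forall p, p \in `[a, b] ->
  has_derivative `[a, b] (fun q => (f q).1) p (X p).
Hypothesis hf2 : forall p, p \in `[a, b] ->
  has_derivative `[a, b] (fun q => (f q).2) p (Y p).
Hypothesis hX : forall p, p \in `[a, b] -> has_derivative `[a, b] X p (dX p).
Hypothesis hY : forall p, p \in `[a, b] -> has_derivative `[a, b] Y p (dY p).
Hypothesis n0 : forall p, p \in `[a, b] -> 0 < X p ^+ 2 + Y p ^+ 2.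

Lemma derive_curve p : p \in `[a, b] -> derive_within `[a, b] f p = (X p, Y p).
Proof.
move=> pI; apply: has_derivative_derive; first exact: limit_point_segment.
by apply: has_derivative_pair => /=; [exact: hf1|exact: hf2].
Qed.

Lemma speed_curve p : p \in `[a, b] -> speed a b f p = length2 (X p) (Y p).
Proof. by move=> pI; rewrite /speed derive_curve// /enorm /dot/= -!expr2. Qed.

Lemma tangent_curve p : p \in `[a, b] ->
  tangent a b f p = (X p / length2 (X p) (Y p), Y p / length2 (X p) (Y p)).
Proof.
move=> pI; rewrite /tangent /darc speed_curve// derive_curve//.
by congr (_, _); rewrite /GRing.scale/= mulrC.
Qed.

Lemma curvature_curve p : p \in `[a, b] ->
  curvature a b f p = curvature2 (X p) (Y p) (dX p) (dY p).
Proof.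
move=> pI; have [h1 h2] := frame_derivative (n0 pI) (hX pI) (hY pI).
have V0 := length2_gt0 (n0 pI).
set V := length2 _ _ in h1 h2 V0; set K := curvature2 _ _ _ _ in h1 h2 *.
have D : derive_within `[a, b] (darc a b f f) p =
    (- (K * V * (Y p / V)), K * V * (X p / V)).
  apply: has_derivative_derive; first exact: limit_point_segment.
  apply: (@eq_has_derivative _ _ _
    (fun q => (X q / length2 (X q) (Y q), Y q / length2 (X q) (Y q)))) => //.
    by move=> q; rewrite inE => qI; rewrite -/(tangent a b f q) tangent_curve.
  exact: has_derivative_pair.
have CS := frame_unit (n0 pI); rewrite -/V in CS.
have Vn : V != 0 by rewrite gt_eqF.
rewrite /curvature /normal {1}/darc D tangent_curve// speed_curve// -/V.
rewrite /dot /J/= /GRing.scale/=.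
transitivity (K * ((X p / V) ^+ 2 + (Y p / V) ^+ 2)); last by rewrite CS mulr1.
by field.
Qed.

End plane_curve.

End moving_frame.

(** * Derivability of composite expressions *)

Section derivability.
Context {R : realType}.
Implicit Types (A : set R) (f g : R -> R).

Lemma derivable_withinD A f g x : derivable_within A f x ->
  derivable_within A g x -> derivable_within A (fun y => f y + g y) x.
Proof.
move=> hf hg; apply: has_derivative_derivable.
exact: has_derivativeD (derive_withinP hf) (derive_withinP hg).
Qed.

Lemma derivable_withinM A f g x : derivable_within A f x ->
  derivable_within A g x -> derivable_within A (fun y => f y * g y) x.
Proof.
move=> hf hg; apply: has_derivative_derivable.
exact: has_derivativeM (derive_withinP hf) (derive_withinP hg).
Qed.

Lemma derivable_withinN A f x : derivable_within A f x ->
  derivable_within A (fun y => - f y) x.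
Proof.
move=> hf; apply: has_derivative_derivable.
exact: has_derivativeN (derive_withinP hf).
Qed.

Lemma derivable_withinV A f x : f x != 0 -> derivable_within A f x ->
  derivable_within A (fun y => (f y)^-1) x.
Proof.
move=> fx hf; apply: has_derivative_derivable.
exact: has_derivativeV fx (derive_withinP hf).
Qed.

Lemma derivable_within_cst A (k : R) x : derivable_within A (fun=> k) x.
Proof. exact: has_derivative_derivable (has_derivative_cst A k x). Qed.

Lemma derivable_withinX A f x n : derivable_within A f x ->
  derivable_within A (fun y => f y ^+ n) x.
Proof.
move=> hf; elim: n => [|n IH]; first exact: derivable_within_cst.
under eq_fun do rewrite exprS; exact: derivable_withinM.
Qed.

(** The expression is the space derivative of the curvature. Its own derivative is never written
    out, so existence is all that is shown. *)
Lemma derivable_quotient_formula A (x y dx dy x3 y3 V K V1 : R -> R) p :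
  derivable_within A x p -> derivable_within A y p ->
  derivable_within A dx p -> derivable_within A dy p ->
  derivable_within A x3 p -> derivable_within A y3 p ->
  derivable_within A V p -> derivable_within A K p -> derivable_within A V1 p ->
  V p != 0 ->
  derivable_within A (fun q => (dx q * dy q + x q * y3 q - dy q * dx q - y q * x3 q)
    / V q ^+ 3 - 3 * K q * V1 q / V q) p.
Proof.
move=> dx1 dy1 dx2 dy2 dx3 dy3 dV dK dV1 V0.
have dM f g := @derivable_withinM A f g p.
apply: derivable_withinD.
  apply: (dM (fun q => _) (fun q => (V q ^+ 3)^-1)).
    apply: derivable_withinD; last by apply: derivable_withinN; exact: dM.
    apply: derivable_withinD; last by apply: derivable_withinN; exact: dM.
    by apply: derivable_withinD; exact: dM.
  apply: (@derivable_withinV A (fun q => V q ^+ 3)); first exact: expf_neq0.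
  exact: derivable_withinX.
apply: derivable_withinN; apply: (dM (fun q => _) (fun q => (V q)^-1)).
  apply: (dM (fun q => 3 * K q) V1 _ dV1).
  apply: (dM (fun=> 3) K _ dK); exact: derivable_within_cst.
exact: derivable_withinV.
Qed.

End derivability.

(** * Regularity of the solution and time derivatives of position and velocity *)

Section solution.
Context {R : realType}.
Variables (sa sb : R) (sf : R -> R * R) (a b : R) (T : \bar R).
Variables (c0 : R -> R * R) (c : R -> R -> R * R).
Hypothesis ab : a < b.
Hypothesis sol : apcsf_solution sa sb sf a b T c0 c.

Notation J0 := (time_interval T).
Notation J1 := (open_time_interval T).
Notation cp := (dspace `[a, b] c).
Notation cpp := (dspace `[a, b] cp).

Lemma open_time_sub : J1 `<=` J0.
Proof. by move=> t [t0 tT]; split=> //; exact: ltW. Qed.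

Lemma open_time_nbhs t : J1 t -> nbhs t J1.
Proof.
move=> [t0 tT].
have tTn : \forall s \near t, (s%:E < T)%E.
  case: T tT => [r||] //=.
  - rewrite lte_fin => tr; near=> s; rewrite lte_fin; near: s; exact: lt_nbhsl.
  - by move=> _; near=> s; exact: ltry.
near=> s; split; near: s => //; exact: lt_nbhsr.
Unshelve. all: by end_near. Qed.

Lemma time_nbhs t : J1 t -> nbhs t J0.
Proof. by move=> /open_time_nbhs; apply: filterS; exact: open_time_sub. Qed.

Lemma open_time_interval_like : interval_like J1.
Proof.
move=> x y [x0 xT] [y0 yT] z /=; rewrite in_itv/= => /andP[xz zy]; split.
  exact: lt_le_trans xz.
by apply: le_lt_trans yT; rewrite lee_fin.
Qed.

Lemma time_interval_like : interval_like J0.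
Proof.
move=> x y [x0 xT] [y0 yT] z /=; rewrite in_itv/= => /andP[xz zy]; split.
  exact: le_trans xz.
by apply: le_lt_trans yT; rewrite lee_fin.
Qed.

Lemma open_time_limit t : J1 t -> limit_point_of J1 t.
Proof. by move=> /open_time_nbhs; exact: limit_point_nbhs. Qed.

Let half_lt1 : (0 : R) < 2^-1 /\ 2^-1 < (1 : R).
Proof. by split; [rewrite invr_gt0|rewrite invf_lt1// ltr1n]. Qed.

Lemma solution_space_derivative p t : p \in `[a, b] -> J0 t ->
  has_derivative `[a, b] (c^~ t) p (cp p t).
Proof.
move=> pI Jt; have [h0 h1] := half_lt1.
by have [[+ _ _] _ _] := solution_hoelder sol h0 h1; apply.
Qed.

Lemma solution_space_derivative2 p t : p \in `[a, b] -> J0 t ->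
  has_derivative `[a, b] (cp^~ t) p (cpp p t).
Proof.
move=> pI Jt; have [h0 h1] := half_lt1.
by have [[_ + _] _ _] := solution_hoelder sol h0 h1; apply.
Qed.

Lemma solution_continuous : [/\ jointly_continuous `[a, b] J0 c,
  jointly_continuous `[a, b] J0 cp & jointly_continuous `[a, b] J0 cpp].
Proof.
have [h0 h1] := half_lt1.
by have [_ [? ? ? _] _] := solution_hoelder sol h0 h1.
Qed.

Definition vx p t := (cp p t).1.
Definition vy p t := (cp p t).2.
Definition ax p t := (cpp p t).1.
Definition ay p t := (cpp p t).2.
Definition flow_speed p t := length2 (vx p t) (vy p t).
Definition flow_curvature p t := curvature2 (vx p t) (vy p t) (ax p t) (ay p t).
Definition flow_speed1 p t := (vx p t * ax p t + vy p t * ay p t) / flow_speed p t.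

Lemma solution_velocity_neq0 p t : p \in `[a, b] -> J0 t ->
  0 < vx p t ^+ 2 + vy p t ^+ 2.
Proof.
move=> pI Jt; have := solution_regular sol Jt pI.
rewrite -[derive_within _ _ _]/(cp p t) => nz.
rewrite lt_neqAle addr_ge0 ?sqr_ge0// andbT eq_sym.
rewrite paddr_eq0 ?sqr_ge0// !sqrf_eq0 /vx /vy; apply: contra nz.
by move=> /andP[/eqP E1 /eqP E2]; apply/eqP; rewrite [LHS]surjective_pairing E1 E2.
Qed.

Lemma flow_speed_gt0 p t : p \in `[a, b] -> J0 t -> 0 < flow_speed p t.
Proof. by move=> pI Jt; apply: length2_gt0; exact: solution_velocity_neq0. Qed.

Section fixed_time.
Variable t : R.
Hypothesis Jt : J0 t.

Let h1 p (pI : p \in `[a, b]) := has_derivative_fst (solution_space_derivative pI Jt).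
Let h2 p (pI : p \in `[a, b]) := has_derivative_snd (solution_space_derivative pI Jt).
Let h3 p (pI : p \in `[a, b]) := has_derivative_fst (solution_space_derivative2 pI Jt).
Let h4 p (pI : p \in `[a, b]) := has_derivative_snd (solution_space_derivative2 pI Jt).
Let n0 p (pI : p \in `[a, b]) := solution_velocity_neq0 pI Jt.

Lemma flow_speedE p : p \in `[a, b] -> speed a b (c^~ t) p = flow_speed p t.
Proof. exact: (speed_curve ab h1 h2). Qed.

Lemma flow_tangentE p : p \in `[a, b] -> tangent a b (c^~ t) p =
  (vx p t / flow_speed p t, vy p t / flow_speed p t).
Proof. exact: (tangent_curve ab h1 h2). Qed.

Lemma flow_curvatureE p : p \in `[a, b] ->
  curvature a b (c^~ t) p = flow_curvature p t.
Proof. exact: (curvature_curve ab h1 h2 h3 h4 n0). Qed.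

Lemma flow_speed_derivative p : p \in `[a, b] ->
  has_derivative `[a, b] (flow_speed^~ t) p (flow_speed1 p t).
Proof. by move=> pI; apply: has_derivative_length2; [exact: n0|exact: h3|exact: h4]. Qed.

Lemma flow_frame_derivative p : p \in `[a, b] ->
  has_derivative `[a, b] (fun q => vx q t / flow_speed q t) p
    (- (flow_curvature p t * flow_speed p t * (vy p t / flow_speed p t))) /\
  has_derivative `[a, b] (fun q => vy q t / flow_speed q t) p
    (flow_curvature p t * flow_speed p t * (vx p t / flow_speed p t)).
Proof. by move=> pI; apply: frame_derivative; [exact: n0|exact: h3|exact: h4]. Qed.

End fixed_time.

Lemma flow_continuous : [/\ jointly_continuous `[a, b] J0 vx,
  jointly_continuous `[a, b] J0 vy, jointly_continuous `[a, b] J0 flow_speed,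
  jointly_continuous `[a, b] J0 flow_curvature &
  jointly_continuous `[a, b] J0 flow_speed1].
Proof.
have [_ c1 c2] := solution_continuous.
have cvx : jointly_continuous `[a, b] J0 vx by exact: jointly_continuous_fst c1.
have cvy : jointly_continuous `[a, b] J0 vy by exact: jointly_continuous_snd c1.
have cax : jointly_continuous `[a, b] J0 ax by exact: jointly_continuous_fst c2.
have cay : jointly_continuous `[a, b] J0 ay by exact: jointly_continuous_snd c2.
have cV : jointly_continuous `[a, b] J0 flow_speed.
  apply: jointly_continuous_sqrt.
  by apply: jointly_continuousD; apply: jointly_continuousM.
have cVi : jointly_continuous `[a, b] J0 (fun p t => (flow_speed p t)^-1).
  by apply: jointly_continuousV => // p t pI Jt; rewrite gt_eqF// flow_speed_gt0.
split=> //.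
- apply: jointly_continuousM.
    apply: jointly_continuousD; first exact: jointly_continuousM.
    by apply: jointly_continuousN; exact: jointly_continuousM.
  apply: (@eq_jointly_continuous _ _ _ (fun p t =>
    (flow_speed p t)^-1 * ((flow_speed p t)^-1 * (flow_speed p t)^-1))).
    by move=> p t _ _; rewrite -!invfM !exprS expr0 mulr1.
  by do 2 apply: jointly_continuousM => //.
- apply: jointly_continuousM => //.
  by apply: jointly_continuousD; exact: jointly_continuousM.
Qed.

Notation mp := (mixed_partial `[a, b] J1).

Lemma mixed_partial_commute w p t : p \in `[a, b] -> J1 t ->
  mp [:: true, false & w] c p t = mp [:: false, true & w] c p t.
Proof.
move=> pI Jt.
have [_ sp tm] := solution_smooth sol w.
have [_ _ spt] := solution_smooth sol (false :: w).
have [_ tps _] := solution_smooth sol (true :: w).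
have [cj1 _ _] := solution_smooth sol [:: true, false & w].
have [cj2 _ _] := solution_smooth sol [:: false, true & w].
have iI : interval_like `[a, b] by move=> x y xI yI; exact: segment_subset_itv.
have lI q : q \in `[a, b] -> limit_point_of `[a, b] q by exact: limit_point_segment.
have E1 := @mixed_derivatives_commute R `[a, b] J1
  (fun p t => (mp w c p t).1) (fun p t => (mp (false :: w) c p t).1)
  (fun p t => (mp (true :: w) c p t).1) (fun p t => (mp [:: true, false & w] c p t).1)
  (fun p t => (mp [:: false, true & w] c p t).1) iI open_time_interval_like lI
  open_time_limit
  (fun p t pI Jt => has_derivative_fst (derive_withinP (sp p t pI Jt)))
  (fun p t pI Jt => has_derivative_fst (derive_withinP (tm p t pI Jt)))
  (fun p t pI Jt => has_derivative_fst (derive_withinP (spt p t pI Jt)))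
  (fun p t pI Jt => has_derivative_fst (derive_withinP (tps p t pI Jt)))
  (jointly_continuous_fst cj1) (jointly_continuous_fst cj2) p t pI Jt.
have E2 := @mixed_derivatives_commute R `[a, b] J1
  (fun p t => (mp w c p t).2) (fun p t => (mp (false :: w) c p t).2)
  (fun p t => (mp (true :: w) c p t).2) (fun p t => (mp [:: true, false & w] c p t).2)
  (fun p t => (mp [:: false, true & w] c p t).2) iI open_time_interval_like lI
  open_time_limit
  (fun p t pI Jt => has_derivative_snd (derive_withinP (sp p t pI Jt)))
  (fun p t pI Jt => has_derivative_snd (derive_withinP (tm p t pI Jt)))
  (fun p t pI Jt => has_derivative_snd (derive_withinP (spt p t pI Jt)))
  (fun p t pI Jt => has_derivative_snd (derive_withinP (tps p t pI Jt)))
  (jointly_continuous_snd cj1) (jointly_continuous_snd cj2) p t pI Jt.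
by rewrite [LHS]surjective_pairing E1 E2 -surjective_pairing.
Qed.

Definition flow_curvature1 p t :=
  let x3 := (dspace `[a, b] cpp p t).1 in let y3 := (dspace `[a, b] cpp p t).2 in
  (ax p t * ay p t + vx p t * y3 - ay p t * ax p t - vy p t * x3) / flow_speed p t ^+ 3
  - 3 * flow_curvature p t * flow_speed1 p t / flow_speed p t.

Definition flow_curvature2 p t := derive_within `[a, b] (flow_curvature1^~ t) p.

Definition normal_velocity p t :=
  flow_curvature p t - mean_curvature a b (c^~ t).

Section positive_time.
Variable t : R.
Hypothesis Jt : J1 t.

Let Jt0 : J0 t := open_time_sub Jt.

Let d3 p : p \in `[a, b] -> derivable_within `[a, b] (cpp^~ t) p.
Proof. by move=> pI; have [_ + _] := solution_smooth sol [:: false; false]; apply. Qed.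

Let d4 p : p \in `[a, b] -> derivable_within `[a, b] ((dspace `[a, b] cpp)^~ t) p.
Proof. by move=> pI; have [_ + _] := solution_smooth sol [:: false; false; false]; apply. Qed.

Lemma flow_curvature_derivative p : p \in `[a, b] ->
  has_derivative `[a, b] (flow_curvature^~ t) p (flow_curvature1 p t).
Proof.
move=> pI; apply: (@has_derivative_curvature2 _ _ (vx^~ t) (vy^~ t) (ax^~ t) (ay^~ t)).
- exact: solution_velocity_neq0.
- exact: (has_derivative_fst (solution_space_derivative2 pI Jt0)).
- exact: (has_derivative_snd (solution_space_derivative2 pI Jt0)).
- exact: (has_derivative_fst (derive_withinP (d3 pI))).
- exact: (has_derivative_snd (derive_withinP (d3 pI))).
Qed.

Lemma flow_curvature1_derivative p : p \in `[a, b] ->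
  has_derivative `[a, b] (flow_curvature1^~ t) p (flow_curvature2 p t).
Proof.
move=> pI; apply: derive_withinP.
have e1 : derivable_within `[a, b] (vx^~ t) p.
  exact: has_derivative_derivable (has_derivative_fst (solution_space_derivative2 pI Jt0)).
have e2 : derivable_within `[a, b] (vy^~ t) p.
  exact: has_derivative_derivable (has_derivative_snd (solution_space_derivative2 pI Jt0)).
have e3 : derivable_within `[a, b] (ax^~ t) p.
  exact: has_derivative_derivable (has_derivative_fst (derive_withinP (d3 pI))).
have e4 : derivable_within `[a, b] (ay^~ t) p.
  exact: has_derivative_derivable (has_derivative_snd (derive_withinP (d3 pI))).
have e5 : derivable_within `[a, b] (fun q => (dspace `[a, b] cpp q t).1) p.
  exact: has_derivative_derivable (has_derivative_fst (derive_withinP (d4 pI))).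
have e6 : derivable_within `[a, b] (fun q => (dspace `[a, b] cpp q t).2) p.
  exact: has_derivative_derivable (has_derivative_snd (derive_withinP (d4 pI))).
have e7 : derivable_within `[a, b] (flow_speed^~ t) p.
  exact: has_derivative_derivable (flow_speed_derivative Jt0 pI).
have e8 : derivable_within `[a, b] (flow_curvature^~ t) p.
  exact: has_derivative_derivable (flow_curvature_derivative pI).
have Vn : flow_speed p t != 0 by rewrite gt_eqF// flow_speed_gt0.
have e10 : derivable_within `[a, b] (flow_speed1^~ t) p.
  apply: (@derivable_withinM _ _ (fun q => vx q t * ax q t + vy q t * ay q t)
    (fun q => (flow_speed q t)^-1)).
    apply: (@derivable_withinD _ _ (fun q => vx q t * ax q t)).
      exact: (@derivable_withinM _ _ (vx^~ t) (ax^~ t)).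
    exact: (@derivable_withinM _ _ (vy^~ t) (ay^~ t)).
  exact: (@derivable_withinV _ _ (flow_speed^~ t)).
exact: (derivable_quotient_formula e1 e2 e3 e4 e5 e6 e7 e8 e10 Vn).
Qed.

Notation Cx := (fun p t => vx p t / flow_speed p t).
Notation Sx := (fun p t => vy p t / flow_speed p t).

Lemma solution_time_derivative p : p \in `[a, b] ->
  has_derivative J1 (c p) t
    (- (normal_velocity p t * Sx p t), normal_velocity p t * Cx p t).
Proof.
move=> pI; have [h0 h1] := half_lt1.
have [[_ _ dt] _ _] := solution_hoelder sol h0 h1.
apply: (has_derivative_interior (time_nbhs Jt) (open_time_nbhs Jt)).
suff <- : dtime J0 c p t =
    (- (normal_velocity p t * Sx p t), normal_velocity p t * Cx p t).
  exact: derive_withinP (dt p t pI Jt0).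
rewrite (solution_flow sol pI Jt0) flow_curvatureE// /normal flow_tangentE//.
have scale_pair (k u v : R) : k *: (u, v) = (k * u, k * v) by [].
by rewrite -/(normal_velocity p t) /J/= scale_pair mulrN.
Qed.

(** Commuting the derivatives reduces this to the space derivative of [B] times the normal. The mean
    curvature is constant in space, so [B] has the same space derivative as [K]. *)
Lemma solution_velocity_time_derivative p : p \in `[a, b] ->
  let K := flow_curvature p t in let V := flow_speed p t in
  let B := normal_velocity p t in let k1 := flow_curvature1 p t in
  has_derivative J1 (vx p) t (- (k1 * Sx p t + B * K * V * Cx p t)) /\
  has_derivative J1 (vy p) t (k1 * Cx p t - B * K * V * Sx p t).
Proof.
move=> pI K V B k1.
have [_ _ dt] := solution_smooth sol [:: false].
have D := derive_withinP (dt p t pI Jt).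
have E : dtime J1 cp p t = (- (k1 * Sx p t + B * K * V * Cx p t),
    k1 * Cx p t - B * K * V * Sx p t).
  have := @mixed_partial_commute [::] p t pI Jt; rewrite /= => ->.
  apply: has_derivative_derive; first exact: limit_point_segment.
  have [hC hS] := flow_frame_derivative Jt0 pI.
  have hB : has_derivative `[a, b] (normal_velocity^~ t) p k1.
    rewrite -[k1]subr0; apply: has_derivativeB; last exact: has_derivative_cst.
    exact: flow_curvature_derivative.
  apply: (@eq_has_derivative _ _ _ (fun q => (- (normal_velocity q t * Sx q t),
      normal_velocity q t * Cx q t))) => //.
    move=> q; rewrite inE => qI; apply/esym.
    apply: has_derivative_derive; first exact: open_time_limit.
    exact: solution_time_derivative.
  have E1 (k B' K' V' C S : R) : - (k * S + B' * K' * V' * C) =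
    - (k * S + B' * (K' * V' * C)) by ring.
  have E2 (k B' K' V' C S : R) : k * C - B' * K' * V' * S =
    k * C + B' * - (K' * V' * S) by ring.
  rewrite E1 E2; apply: has_derivative_pair.
    exact: has_derivativeN (has_derivativeM hB hS).
  exact: has_derivativeM hB hC.
split.
  by have := has_derivative_fst D; rewrite -/(dtime J1 cp p t) E.
by have := has_derivative_snd D; rewrite -/(dtime J1 cp p t) E.
Qed.

End positive_time.

End solution.

(** * Evolution of speed, curvature, tangent and length *)

Section evolution.
Context {R : realType}.
Variables (sa sb : R) (sf : R -> R * R) (a b : R) (T : \bar R).
Variables (c0 : R -> R * R) (c : R -> R -> R * R).
Hypothesis ab : a < b.
Hypothesis sol : apcsf_solution sa sb sf a b T c0 c.

Notation J0 := (time_interval T).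
Notation J1 := (open_time_interval T).
Notation cp := (dspace `[a, b] c).
Notation cpp := (dspace `[a, b] cp).
Notation X := (vx a b c).
Notation Y := (vy a b c).
Notation V := (flow_speed a b c).
Notation V1 := (flow_speed1 a b c).
Notation K := (flow_curvature a b c).
Notation K1 := (flow_curvature1 a b c).
Notation K2 := (flow_curvature2 a b c).
Notation B := (normal_velocity a b c).

Lemma solution_acceleration_time_derivative p t : p \in `[a, b] -> J1 t ->
  let C := X p t / V p t in let S := Y p t / V p t in
  let m := K1 p t * K p t * V p t + B p t * K1 p t * V p t + B p t * K p t * V1 p t in
  has_derivative J1 (ax a b c p) t
    (- (K2 p t * S + K1 p t * (K p t * V p t * C) +
        (m * C + B p t * K p t * V p t * - (K p t * V p t * S)))) /\
  has_derivative J1 (ay a b c p) t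
    (K2 p t * C + K1 p t * - (K p t * V p t * S) -
        (m * S + B p t * K p t * V p t * (K p t * V p t * C))).
Proof.
move=> pI Jt C S m; have Jt0 := open_time_sub Jt.
have [_ _ dt] := solution_smooth sol [:: false; false].
have D := derive_withinP (dt p t pI Jt).
set r1 := - _; set r2 := _ - _.
have E : dtime J1 cpp p t = (r1, r2).
  have := mixed_partial_commute ab sol [:: false] pI Jt; rewrite /= => ->.
  apply: has_derivative_derive; first exact: limit_point_segment.
  have [hC hS] := flow_frame_derivative sol Jt0 pI.
  have hB : has_derivative `[a, b] ((B)^~ t) p (K1 p t).
    rewrite -[K1 p t]subr0; apply: has_derivativeB; last exact: has_derivative_cst.
    exact: (flow_curvature_derivative sol).
  have hK := flow_curvature_derivative sol Jt pI.
  have hK1 := flow_curvature1_derivative sol Jt pI.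
  have hV := flow_speed_derivative sol Jt0 pI.
  apply: (@eq_has_derivative _ _ _ (fun q =>
    (- (K1 q t * (Y q t / V q t) + B q t * K q t * V q t * (X q t / V q t)),
     K1 q t * (X q t / V q t) - B q t * K q t * V q t * (Y q t / V q t)))) => //.
    move=> q; rewrite inE => qI; apply/esym.
    apply: has_derivative_derive; first exact: (open_time_limit Jt).
    have [h1 h2] := solution_velocity_time_derivative ab sol Jt qI.
    exact: has_derivative_pair.
  have hBKV := has_derivativeM (has_derivativeM hB hK) hV.
  have Em : (K1 p t * K p t + B p t * K1 p t) * V p t + B p t * K p t * V1 p t = m.
    by rewrite /m mulrDl.
  rewrite Em in hBKV.
  apply: has_derivative_pair.
    exact: has_derivativeN (has_derivativeD (has_derivativeM hK1 hS) (has_derivativeM hBKV hC)).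
  exact: has_derivativeB (has_derivativeM hK1 hC) (has_derivativeM hBKV hS).
split.
  by have := has_derivative_fst D; rewrite -/(dtime J1 cpp p t) E.
by have := has_derivative_snd D; rewrite -/(dtime J1 cpp p t) E.
Qed.

(** The first two terms in the second rate are the second arclength derivative of the curvature. *)
Lemma flow_evolution p t : p \in `[a, b] -> J1 t ->
  has_derivative J1 (V p) t (- (B p t * K p t * V p t)) /\
  has_derivative J1 (K p) t
    (K2 p t / V p t ^+ 2 - V1 p t * K1 p t / V p t ^+ 3 + B p t * K p t ^+ 2).
Proof.
move=> pI Jt; have Jt0 := open_time_sub Jt.
have [h1 h2] := solution_velocity_time_derivative ab sol Jt pI.
have [h3 h4] := solution_acceleration_time_derivative pI Jt.
exact: (normal_motion_evolution (solution_velocity_neq0 sol pI Jt0) h1 h2 h3 h4).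
Qed.

Lemma flow_tangent_time_derivative p t : p \in `[a, b] -> J1 t ->
  has_derivative J1 (fun s => X p s / V p s) t
    (- (K1 p t / V p t * (Y p t / V p t))) /\
  has_derivative J1 (fun s => Y p s / V p s) t
    (K1 p t / V p t * (X p t / V p t)).
Proof.
move=> pI Jt; have Jt0 := open_time_sub Jt.
have [h1 h2] := solution_velocity_time_derivative ab sol Jt pI.
have n0 := solution_velocity_neq0 sol pI Jt0.
have V0 := flow_speed_gt0 sol pI Jt0.
have gen (x y v k1 g : R) : 0 < v -> (x / v) ^+ 2 + (y / v) ^+ 2 = 1 ->
    (x * (k1 * (x / v) - g * (y / v)) - y * - (k1 * (y / v) + g * (x / v))) / v ^+ 3 * v
    = k1 / v.
  move=> /lt0r_neq0 v0 xy; transitivity (k1 / v * ((x / v) ^+ 2 + (y / v) ^+ 2)).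
    by field.
  by rewrite xy mulr1.
have E := gen _ _ _ (K1 p t) (B p t * K p t * V p t) V0 (frame_unit n0).
have [] := frame_derivative n0 h1 h2.
by rewrite /curvature2 E.
Qed.

(** [B] contains the mean curvature, whose continuity in time is bypassed: by uniqueness the rate
    equals the derivative of the speed computed from the mixed derivative of [c], which is jointly
    continuous. *)
Lemma flow_speed_rate_continuous :
  jointly_continuous `[a, b] J1 (fun p t => - (B p t * K p t * V p t)).
Proof.
have [cX cY cV _ _] := flow_continuous sol.
have [cj _ _] := solution_smooth sol [:: true; false].
have sub := @open_time_sub R T.
have id : `[a, b] `<=` `[a, b] by [].
apply: (@eq_jointly_continuous _ _ _ (fun p t =>
  (X p t * (dtime J1 cp p t).1 + Y p t * (dtime J1 cp p t).2) * (V p t)^-1)).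
  move=> p t pI Jt; have Jt0 := sub _ Jt.
  have [_ _ dt] := solution_smooth sol [:: false].
  have D := derive_withinP (dt p t pI Jt).
  have n0 := solution_velocity_neq0 sol pI Jt0.
  apply: has_derivative_unique (open_time_limit Jt) _ (flow_evolution pI Jt).1.
  exact: (has_derivative_length2 n0 (has_derivative_fst D) (has_derivative_snd D)).
apply: jointly_continuousM; last first.
  apply: jointly_continuousV; last exact: jointly_continuousW cV.
  by move=> p t pI Jt; rewrite gt_eqF// (flow_speed_gt0 sol)//; exact: sub.
apply: jointly_continuousD; apply: jointly_continuousM.
- exact: jointly_continuousW cX.
- exact: jointly_continuous_fst.
- exact: jointly_continuousW cY.
- exact: jointly_continuous_snd.
Qed.

Lemma flow_lengthE t : J0 t ->
  curve_length a b (c^~ t) = \int[lebesgue_measure]_(p in `[a, b]) V p t.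
Proof.
by move=> Jt; apply: eq_Rintegral => p; rewrite inE => pI; exact: (flow_speedE ab sol Jt).
Qed.

Lemma flow_mean_curvatureE t : J0 t -> mean_curvature a b (c^~ t) =
  \int[lebesgue_measure]_(p in `[a, b]) (K p t * V p t) / curve_length a b (c^~ t).
Proof.
move=> Jt; rewrite /mean_curvature.
have -> : \int[lebesgue_measure]_(p in `[a, b])
    (curvature a b (c^~ t) p * speed a b (c^~ t) p) =
  \int[lebesgue_measure]_(p in `[a, b]) (K p t * V p t).
  apply: eq_Rintegral => p; rewrite inE => pI.
  by rewrite (flow_speedE ab sol Jt pI) (flow_curvatureE ab sol Jt pI).
by [].
Qed.

Lemma flow_slices t : J0 t -> [/\ {within `[a, b], continuous ((V)^~ t)},
  {within `[a, b], continuous (fun p => K p t * V p t)} &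
  {within `[a, b], continuous (fun p => K p t * (K p t * V p t))}].
Proof.
move=> Jt; have [_ _ cV cK _] := flow_continuous sol.
have c1 := jointly_continuous_slice Jt cV.
have c2 := jointly_continuous_slice Jt cK.
have c3 : {within `[a, b], continuous (fun p => K p t * V p t)}.
  by move=> p; apply: cvgM; [exact: c2|exact: c1].
by split=> // p; apply: cvgM; [exact: c2|exact: c3].
Qed.

Lemma flow_length_gt0 t : J0 t -> 0 < curve_length a b (c^~ t).
Proof.
move=> Jt; have [cV _ _] := flow_slices Jt.
have [F hF] := exists_antiderivative ab cV.
rewrite flow_lengthE// (integral_antiderivative ab cV hF) subr_gt0.
apply: (increasing_of_derivative ab _ hF) => // p pI.
by apply: (flow_speed_gt0 sol) => //; exact: subset_itv_oo_cc pI.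
Qed.

(** As [kb] is the mean of the curvature, the integral of [B * K * V] equals that of
    [(K - kb) ^+ 2 * V]. *)
Lemma flow_length_rate t : J1 t ->
  \int[lebesgue_measure]_(p in `[a, b]) (- (B p t * K p t * V p t)) <= 0.
Proof.
move=> Jt; have Jt0 := open_time_sub Jt.
have [cV cKV cKKV] := flow_slices Jt0.
have [A1 h1] := exists_antiderivative ab cV.
have [A2 h2] := exists_antiderivative ab cKV.
have [A3 h3] := exists_antiderivative ab cKKV.
have L0 := flow_length_gt0 Jt0.
have kE := flow_mean_curvatureE Jt0.
rewrite (integral_antiderivative ab cKV h2) in kE.
have LE := flow_lengthE Jt0; rewrite (integral_antiderivative ab cV h1) in LE.
set kb := mean_curvature _ _ _ in kE.
set L := curve_length _ _ _ in kE L0 LE.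
have hG p : p \in `[a, b] -> has_derivative `[a, b]
    (fun p => A3 p - (2 * kb) * A2 p + kb ^+ 2 * A1 p) p
    (K p t * (K p t * V p t) - 2 * kb * (K p t * V p t) + kb ^+ 2 * V p t).
  move=> pI; apply: has_derivativeD; last exact: has_derivativeMl (h1 p pI).
  apply: has_derivativeB; first exact: h3.
  exact: has_derivativeMl (h2 p pI).
have Gab : A3 a - 2 * kb * A2 a + kb ^+ 2 * A1 a <=
    A3 b - 2 * kb * A2 b + kb ^+ 2 * A1 b.
  apply: (nondecreasing_of_derivative (ltW ab) _ hG) => // p pI.
  have -> : K p t * (K p t * V p t) - 2 * kb * (K p t * V p t) + kb ^+ 2 * V p t =
    (K p t - kb) ^+ 2 * V p t by ring.
  rewrite mulr_ge0 ?sqr_ge0// ltW// (flow_speed_gt0 sol)//.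
  exact: subset_itv_oo_cc pI.
have hF p : p \in `[a, b] -> has_derivative `[a, b]
    (fun p => - (A3 p - kb * A2 p)) p (- (B p t * K p t * V p t)).
  move=> pI.
  have -> : B p t * K p t * V p t = K p t * (K p t * V p t) - kb * (K p t * V p t).
    by rewrite /normal_velocity -/kb; ring.
  apply: has_derivativeN; apply: has_derivativeB; first exact: h3.
  exact: has_derivativeMl (h2 p pI).
rewrite (integral_antiderivative ab _ hF); last first.
  exact: jointly_continuous_slice Jt flow_speed_rate_continuous.
have kL : A2 b - A2 a = kb * (A1 b - A1 a) by rewrite -LE kE divfK// gt_eqF.
have k2 : kb * (A2 b - A2 a) = kb ^+ 2 * (A1 b - A1 a) by rewrite kL; ring.
move: Gab k2; rewrite -subr_ge0; lra.
Qed.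

(** The rate is available at positive times only; continuity of the length down to time 0 lets the
    mean value theorem cover the whole interval. *)
Lemma flow_length_nonincreasing t : J0 t ->
  curve_length a b (c^~ t) <= curve_length a b (c^~ 0).
Proof.
move=> Jt; have [t0 tT] := Jt.
have [->|tn] := eqVneq t 0; first exact: lexx.
have {}t0 : 0 < t by rewrite lt_neqAle eq_sym tn.
have J00 : J0 0 by split=> //; apply: le_lt_trans tT; rewrite lee_fin ltW.
have Jt1 s : s \in `]0, t[ -> J1 s.
  rewrite in_itv/= => /andP[s0 st]; split=> //.
  by apply: lt_trans tT; rewrite lte_fin.
rewrite (flow_lengthE Jt) (flow_lengthE J00).
pose L s := \int[lebesgue_measure]_(p in `[a, b]) V p s.
have [_ _ cV _ _] := flow_continuous sol.
have cL : {within `[0, t], continuous L}.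
  apply: continuous_subspaceW (integral_continuous ab cV).
  exact: (time_interval_like J00 Jt).
have hL s : s \in `]0, t[ -> is_derive s 1 L
    (\int[lebesgue_measure]_(p in `[a, b]) (- (B p s * K p s * V p s))).
  move=> /Jt1 Js; apply: (has_derivative_is_derive (open_time_nbhs Js)).
  apply: (@derivative_under_integral R a b J1 V (fun p s => - (B p s * K p s * V p s))
    s ab (@open_time_interval_like R T) _ _ _ Js).
  - by apply: jointly_continuousW cV => //; exact: open_time_sub.
  - exact: flow_speed_rate_continuous.
  - by move=> p u pI Ju; have [] := flow_evolution pI Ju.
have [s sI E] := MVT t0 hL cL.
have := flow_length_rate (Jt1 s sI) => rate.
have : L t - L 0 <= 0 by rewrite E subr0 mulr_le0_ge0 ?(ltW t0).
by rewrite subr_le0.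
Qed.

End evolution.

(** * First-order consequences of sliding along a convex curve *)

Section boundary_calculus.
Context {R : realType}.

Lemma derivative_product_ge0 (A : set R) (f1 f2 g1 g2 : R -> R) t l1 l2 m1 m2 :
  limit_point_of A t ->
  has_derivative A f1 t l1 -> has_derivative A f2 t l2 ->
  has_derivative A g1 t m1 -> has_derivative A g2 t m2 ->
  (forall s, A s ->
     0 <= (f1 s - f1 t) * (g1 s - g1 t) + (f2 s - f2 t) * (g2 s - g2 t)) ->
  0 <= l1 * m1 + l2 * m2.
Proof.
move=> /within_dnbhs_proper pf h1 h2 h3 h4 pos.
have H : (fun s => diff_quotient f1 t s * diff_quotient g1 t s +
    diff_quotient f2 t s * diff_quotient g2 t s) @ within A t^' --> l1 * m1 + l2 * m2.
  by apply: cvgD; apply: cvgM.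
apply: cvgr_to_ge H _.
rewrite /prop_near1 /within/=; apply/nbhs_ballP; exists 1 => //= s _ st As.
rewrite /diff_quotient /GRing.scale/=.
have -> : (s - t)^-1 * (f1 s - f1 t) * ((s - t)^-1 * (g1 s - g1 t)) +
    (s - t)^-1 * (f2 s - f2 t) * ((s - t)^-1 * (g2 s - g2 t)) =
  (s - t)^-1 ^+ 2 * ((f1 s - f1 t) * (g1 s - g1 t) + (f2 s - f2 t) * (g2 s - g2 t)).
  by ring.
by rewrite mulr_ge0 ?sqr_ge0// pos.
Qed.

Lemma derivative_lipschitz {V W : normedModType R} (A : set R) (f : R -> V)
    (g : R -> W) t l m (M eta : R) :
  limit_point_of A t -> has_derivative A f t l -> has_derivative A g t m ->
  0 <= M -> 0 < eta ->
  (forall s, A s -> `|g s - g t| < eta -> `|f s - f t| <= M * `|g s - g t|) ->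
  `|l| <= M * `|m|.
Proof.
move=> lA hf hg M0 eta0 lip; rewrite leNgt; apply/negP => lm.
(* The linearisation errors of [f] and [g] together contribute [(M + 1) * e], half of the assumed
   gap. *)
pose e := (`|l| - M * `|m|) / 2 / (M + 1).
have M1 : 0 < M + 1 by rewrite ltr_wpDl.
have e0 : 0 < e by rewrite !divr_gt0// subr_gt0.
have /has_derivative_epsP/(_ _ e0)[d1 d10 P1] := hf.
have /has_derivative_epsP/(_ _ e0)[d2 d20 P2] := hg.
pose d := Num.min (Num.min d1 d2) (eta / (`|m| + e + 1)).
have me : 0 < `|m| + e + 1.
  by have := normr_ge0 m; lra.
have d0 : 0 < d by rewrite !lt_min d10 d20 divr_gt0.
have [s [As st sd]] := lA d d0.
have s1 : `|s - t| < d1 by apply: lt_le_trans sd _; rewrite !ge_min lexx.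
have s2 : `|s - t| < d2 by apply: lt_le_trans sd _; rewrite !ge_min lexx orbT.
have s3 : `|s - t| < eta / (`|m| + e + 1).
  by apply: lt_le_trans sd _; rewrite ge_min lexx orbT.
have st0 : 0 < `|s - t| by rewrite normr_gt0 subr_eq0.
have Hf := P1 s As s1; have Hg := P2 s As s2.
have g1 : `|g s - g t| <= (`|m| + e) * `|s - t|.
  rewrite -[g s - _](subrK ((s - t) *: m)); apply: le_trans (ler_normD _ _) _.
  by rewrite normrZ mulrDl addrC [`|m| * _]mulrC lerD2l.
have g2 : `|g s - g t| < eta.
  apply: le_lt_trans g1 _; move: s3; rewrite ltr_pdivlMr// => s3.
  apply: lt_trans s3; rewrite mulrC ltr_pM2l//; lra.
have f1 : `|s - t| * `|l| <= `|f s - f t| + e * `|s - t|.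
  rewrite -normrZ -[(s - t) *: l](subKr (f s - f t)).
  exact: le_trans (ler_normB _ _) (lerD (lexx _) Hf).
have f2 := lip s As g2.
have f3 : M * `|g s - g t| <= M * ((`|m| + e) * `|s - t|) by rewrite ler_wpM2l.
have f4 : `|s - t| * `|l| <= (M * (`|m| + e) + e) * `|s - t| by lra.
move: f4; rewrite mulrC ler_pM2r// => f4.
have : (M + 1) * e = (`|l| - M * `|m|) / 2 by rewrite /e mulrC divfK// gt_eqF.
lra.
Qed.

Lemma enorm1 (v : R * R) : dot v v = 1 -> enorm v = 1.
Proof. by move=> h; rewrite /enorm h sqrtr1. Qed.

Lemma angle_right (v w : R * R) : dot v v = 1 -> dot w w = 1 ->
  oriented_angle v w (pi / 2) -> w = J v.
Proof.
move=> /enorm1 v1 /enorm1 w1 [_ _]; rewrite v1 w1 invr1 !scale1r => ->.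
by rewrite /Defs.rot cos_pihalf sin_pihalf /J !mul0r !mul1r sub0r addr0.
Qed.

Lemma angle_left (v w : R * R) : dot v v = 1 -> dot w w = 1 ->
  oriented_angle v w (- (pi / 2)) -> w = - J v.
Proof.
move=> /enorm1 v1 /enorm1 w1 [_ _]; rewrite v1 w1 invr1 !scale1r => ->.
rewrite /Defs.rot cosN sinN cos_pihalf sin_pihalf.
by rewrite -[RHS]/(- - v.2, - v.1); congr (_, _); ring.
Qed.

(* The endpoint moves along the support curve with speed B in the direction of
   the normal, which rotates with speed k; the monotonicity of the support
   lines yields the sign, and the Lipschitz bound on the tangents of the support
   curve the size. *)
Lemma endpoint_derivative (A : set R) t (cc : R -> R * R) (tx ty : R -> R)
    (st : R * R -> R * R) (Sigma : set (R * R)) (sg M eta B k : R) :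
  limit_point_of A t -> A t ->
  has_derivative A cc t (- (B * ty t), B * tx t) ->
  has_derivative A tx t (- (k * ty t)) -> has_derivative A ty t (k * tx t) ->
  tx t ^+ 2 + ty t ^+ 2 = 1 -> sg ^+ 2 = 1 -> 0 < M -> 0 < eta ->
  (forall y, Sigma y -> `|y - cc t| < eta ->
     `|st y - st (cc t)| <= M * `|y - cc t|) ->
  (forall x z, Sigma x -> Sigma z -> 0 <= dot (z - x) (J (st x))) ->
  (forall s, A s -> Sigma (cc s) /\ st (cc s) = sg *: J (tx s, ty s)) ->
  0 <= sg * (B * k) /\ `|k| <= M * `|B|.
Proof.
move=> lt At hc hC hS CS sg1 M0 eta0 lip line bd.
have [St stE] := bd t At.
set C := tx t in hc hC hS CS stE; set S := ty t in hc hC hS CS stE.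
split.
  have := @derivative_product_ge0 A (fun s => (cc s).1) (fun s => (cc s).2)
    (fun s => sg * tx s) (fun s => sg * ty s) t
    _ _ _ _ lt (has_derivative_fst hc) (has_derivative_snd hc)
    (has_derivativeMl (k := sg) hC) (has_derivativeMl (k := sg) hS).
  have -> : (- (B * S), B * C).1 * (sg * - (k * S)) + (- (B * S), B * C).2 * (sg * (k * C))
      = sg * (B * k) * (C ^+ 2 + S ^+ 2) by rewrite /=; ring.
  rewrite CS mulr1; apply => s As; have [Ss sE] := bd s As.
  (* Each of two points of the support curve lies on the inner side of the other's tangent; adding
     the two inequalities yields monotonicity of the normal along the motion. *)
  have l1 := line _ _ St Ss; have l2 := line _ _ Ss St.
  rewrite stE in l1; rewrite sE in l2.
  have expand (x x' tt : R * R) : dot (x' - x) (J (sg *: J tt)) =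
     - (sg * ((x'.1 - x.1) * tt.1 + (x'.2 - x.2) * tt.2)).
    have -> : J (sg *: J tt) = (- (sg * tt.1), - (sg * tt.2)).
      by rewrite /J/= /GRing.scale/= mulrN.
    by rewrite /dot/=; ring.
  rewrite expand /= in l1; rewrite expand /= in l2.
  rewrite -/C -/S; lra.
have hT : has_derivative A (fun s => st (cc s)) t
    (sg * - (k * C), sg * - (k * S)).
  apply: (@eq_has_derivative _ _ A (fun s => sg *: J (tx s, ty s))) => //.
    by move=> s; rewrite inE => As; have [_ ->] := bd s As.
  apply: has_derivative_pair.
    exact: (has_derivativeMl (k := sg) (has_derivativeN hS)).
  have -> : (sg * - (k * C), sg * - (k * S)).2 = sg * - (k * S) by [].
  exact: (has_derivativeMl (k := sg) hC).
have H := derivative_lipschitz lt hT hc (ltW M0) eta0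
  (fun s As h => lip _ (bd s As).1 h).
have E1 : `|(sg * - (k * C), sg * - (k * S))| = `|k| * `|(C, S)|.
  have -> : (sg * - (k * C), sg * - (k * S)) = (- (sg * k)) *: (C, S).
    by rewrite -[RHS]/(- (sg * k) * C, - (sg * k) * S); congr (_, _); ring.
  rewrite normrZ normrN normrM.
  have -> : `|sg| = 1.
    by apply/eqP; rewrite -(eqrXn2 (n := 2))// -normrX sg1 normr1 expr1n.
  by rewrite mul1r.
have E2 : `|(- (B * S), B * C)| = `|B| * `|(C, S)|.
  by rewrite !prod_normE/= normrN !normrM maxr_pMr// maxC.
rewrite E1 E2 mulrA in H.
have CS' : dot (C, S) (C, S) = 1 by rewrite /dot/= -!expr2.
have n0 : 0 < `|(C, S)| by apply: lt_le_trans (norm_unit_ge CS'); rewrite invr_gt0.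
by rewrite (ler_pM2r n0) in H.
Qed.

End boundary_calculus.

(** * The boundary condition for the curvature *)

Section boundary.
Context {R : realType}.
Variables (sa sb : R) (sf : R -> R * R) (a b : R) (T : \bar R).
Variables (c0 : R -> R * R) (c : R -> R -> R * R).
Hypothesis hS : support_curve sa sb sf.
Hypothesis ab : a < b.
Hypothesis sol : apcsf_solution sa sb sf a b T c0 c.

Notation J0 := (time_interval T).
Notation J1 := (open_time_interval T).
Notation X := (vx a b c).
Notation Y := (vy a b c).
Notation V := (flow_speed a b c).
Notation V1 := (flow_speed1 a b c).
Notation K := (flow_curvature a b c).
Notation K1 := (flow_curvature1 a b c).
Notation K2 := (flow_curvature2 a b c).
Notation B := (normal_velocity a b c).
Notation Sigma := (sf @` `[sa, sb]).
Notation st := (support_tangent sa sb sf).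

Definition flow_tangent p t : R * R := (X p t / V p t, Y p t / V p t).

Lemma flow_tangent_unit p t : p \in `[a, b] -> J0 t ->
  dot (flow_tangent p t) (flow_tangent p t) = 1.
Proof.
move=> pI Jt; have := frame_unit (solution_velocity_neq0 sol pI Jt).
by rewrite /dot !expr2.
Qed.

Lemma boundary_left t : J0 t -> Sigma (c a t) /\ st (c a t) = J (flow_tangent a t).
Proof.
move=> Jt; have aI : a \in `[a, b] by rewrite in_itv/= lexx ltW.
have [Sa _ ang _] := solution_boundary sol Jt; split=> //.
apply: angle_right (flow_tangent_unit aI Jt) (support_tangent_unit hS Sa) _.
by move: ang; rewrite (flow_tangentE ab sol Jt aI).
Qed.

Lemma boundary_right t : J0 t -> Sigma (c b t) /\ st (c b t) = - J (flow_tangent b t).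
Proof.
move=> Jt; have bI : b \in `[a, b] by rewrite in_itv/= lexx ltW.
have [_ Sb _ ang] := solution_boundary sol Jt; split=> //.
apply: angle_left (flow_tangent_unit bI Jt) (support_tangent_unit hS Sb) _.
by move: ang; rewrite (flow_tangentE ab sol Jt bI).
Qed.

(** The tangent of the arc turns in time at the rate [K1 / V], and the free boundary condition ties
    it to the support tangent at an endpoint moving with speed [B]. *)
Lemma boundary_derivative p sg M t : p \in `[a, b] -> sg ^+ 2 = 1 -> 0 < M ->
  (forall x, Sigma x -> exists2 eta, 0 < eta & forall y, Sigma y ->
     `|y - x| < eta -> `|st y - st x| <= M * `|y - x|) ->
  (forall s, J0 s -> Sigma (c p s) /\ st (c p s) = sg *: J (flow_tangent p s)) ->
  J1 t ->
  0 <= sg * (B p t * K1 p t) /\ `|K1 p t| <= M * `|B p t| * V p t.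
Proof.
move=> pI sg1 M0 lip bd Jt; have Jt0 := open_time_sub Jt.
have hc := solution_time_derivative ab sol Jt pI.
have [hC hS'] := flow_tangent_time_derivative ab sol pI Jt.
have V0 := flow_speed_gt0 sol pI Jt0.
have CS := frame_unit (solution_velocity_neq0 sol pI Jt0).
have [eta eta0 etaP] := lip _ (bd t Jt0).1.
have [h1 h2] := @endpoint_derivative _ J1 t (c p) (fun s => X p s / V p s)
  (fun s => Y p s / V p s) st Sigma sg M eta (B p t) (K1 p t / V p t)
  (open_time_limit Jt) Jt hc hC hS' CS sg1 M0 eta0 etaP (support_line hS)
  (fun s Js => bd s (open_time_sub Js)).
move: V0 h1 h2; move: (V p t) (B p t) (K1 p t) => v B k v0 h1 h2.
have kE : k = k / v * v by rewrite divfK// gt_eqF.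
rewrite kE; split.
  have -> : sg * (B * (k / v * v)) = sg * (B * (k / v)) * v by ring.
  by apply: mulr_ge0 => //; exact: ltW.
by rewrite normrM (gtr0_norm v0) ler_wpM2r// ltW.
Qed.

End boundary.

(** * A maximum principle with nonlocal term and boundary inequalities *)

Section maximum_principle.
Context {R : realType}.

(** The right-hand side is the evolution of the curvature divided by [K], after inserting [q' * K]
    for the first derivative and the lower bound [(q' ^+ 2 - 2 * A) * K] for the second, as at a
    minimum of the weighted curvature. *)
Lemma reaction_lower_bound (A w d k0 l V V1 q' K kb : R) :
  0 <= A -> 0 < V -> V^-1 <= w -> `|V1| <= d -> `|q'| <= A * l -> 0 < K <= k0 ->
  0 <= kb <= k0 ->
  - (2 * A * w ^+ 2 + d * (A * l) * w ^+ 3 + k0 ^+ 2) <=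
  (q' ^+ 2 - 2 * A) / V ^+ 2 - V1 * q' / V ^+ 3 + (K - kb) * K.
Proof.
move=> A0 V0 Vw Vd ql /andP[K0 Kk] /andP[kb0 kbk].
have i0 : 0 < V^-1 by rewrite invr_gt0.
have w0 : 0 <= w by apply: le_trans Vw; exact: ltW.
rewrite -!exprVn; set i := V^-1 in i0 Vw *.
have i2 : i ^+ 2 <= w ^+ 2 by rewrite lerXn2r// nnegrE ltW.
have i3 : i ^+ 3 <= w ^+ 3 by rewrite lerXn2r// nnegrE ltW.
have i20 : 0 <= i ^+ 2 by exact: sqr_ge0.
have i30 : 0 <= i ^+ 3 by rewrite exprn_ge0// ltW.
have t1 : - (2 * A * w ^+ 2) <= (q' ^+ 2 - 2 * A) * i ^+ 2.
  have h1 : 0 <= q' ^+ 2 * i ^+ 2 by rewrite mulr_ge0// sqr_ge0.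
  have h2 : A * i ^+ 2 <= A * w ^+ 2 by rewrite ler_wpM2l.
  lra.
have t2 : V1 * q' * i ^+ 3 <= d * (A * l) * w ^+ 3.
  apply: le_trans (ler_norm _) _; rewrite normrM (ger0_norm i30) normrM.
  by apply: ler_pM => //; apply: ler_pM.
have t3 : - k0 ^+ 2 <= (K - kb) * K.
  have h1 : kb * K <= k0 * k0 by apply: ler_pM => //; exact: ltW.
  have h2 := sqr_ge0 K; rewrite !expr2 in h2 *; lra.
lra.
Qed.

Lemma first_time_at_level (a b t1 l : R) (W : R -> R -> R) :
  jointly_continuous `[a, b] `[0, t1] W ->
  (forall y, y \in `[a, b] -> l < W y 0) ->
  (exists2 z : R * R, z.1 \in `[a, b] /\ z.2 \in `[0, t1] & W z.1 z.2 <= l) ->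
  exists p t, [/\ p \in `[a, b], t \in `]0, t1], W p t = l &
    forall y s, y \in `[a, b] -> 0 < s -> s <= t -> l <= W y s].
Proof.
move=> cW W0 [z0 [z01 z02] Wz0].
pose Z : set (R * R) := [set z | [/\ z.1 \in `[a, b], z.2 \in `[0, t1] & W z.1 z.2 <= l]].
have cM : compact (`[a, b] `*` `[0, t1] : set (R * R)).
  by apply: compact_setX; exact: segment_compact.
have cZ : compact Z.
  apply: (@subclosed_compact _ _ (`[a, b] `*` `[0, t1])) => //; last first.
    by move=> z [z1 z2 _].
  have clM : closed (`[a, b] `*` `[0, t1] : set (R * R)).
    by apply: compact_closed cM; exact: norm_hausdorff.
  move=> z cz.
  have [z1 z2] : (`[a, b] `*` `[0, t1]) z.
    by apply: clM; apply: closure_subset cz => u [].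
  split=> //; rewrite leNgt; apply/negP => Wz.
  have e0 : 0 < W z.1 z.2 - l by rewrite subr_gt0.
  move/jointly_continuousP : (cW) => /(_ _ _ z1 z2 _ e0)[r r0 rP].
  move/closure_planeP : cz => /(_ r r0)[u [[u1 u2 u3] n1 n2]].
  have := rP _ _ u1 u2 n1 n2; rewrite ltr_norml => /andP[? _]; lra.
have csnd : {within Z, continuous (fun z : R * R => z.2)}.
  by apply: continuous_subspaceT => z; exact: cvg_snd.
have [|[p ts] + minZ] := compact_EVT_min _ cZ csnd; first by exists z0.
rewrite inE => -[/= pI tsI Wp].
have ts0 : 0 < ts.
  rewrite lt_neqAle eq_sym; apply/andP; split; last first.
    by move: tsI; rewrite in_itv => /andP[].
  by apply/eqP => ts0; move: Wp; rewrite ts0 leNgt W0.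
have tst1 : ts <= t1 by move: tsI; rewrite in_itv => /andP[].
have before y s : y \in `[a, b] -> 0 <= s -> s < ts -> l < W y s.
  move=> yI s0 sts; rewrite ltNge; apply/negP => Wy.
  have sI : s \in `[0, t1] by rewrite in_itv/= s0/=; lra.
  by have := minZ (y, s); rewrite inE /= => /(_ (And3 yI sI Wy)); lra.
have at_ts y : y \in `[a, b] -> l <= W y ts.
  move=> yI; rewrite leNgt; apply/negP => Wy.
  have e0 : 0 < l - W y ts by rewrite subr_gt0.
  move/jointly_continuousP : (cW) => /(_ _ _ yI tsI _ e0)[r r0 rP].
  have [s [sI s2 s1]] := exists_segment_left (lexx ts) ts0 r0.
  have s0 : 0 <= s by move: sI; rewrite in_itv => /andP[].
  have sI' : s \in `[0, t1] by rewrite in_itv/= s0/=; lra.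
  have := rP y s yI sI'; rewrite subrr normr0 => /(_ r0).
  rewrite ltr0_norm ?subr_lt0// => /(_ _)/wrap[]; first lra.
  rewrite ltr_norml => /andP[_ ?]; have := before y s yI s0 s2; lra.
exists p, ts; split=> //; first by rewrite in_itv/= ts0.
  by apply/eqP; rewrite eq_le Wp at_ts.
move=> y s yI s0; rewrite le_eqVlt => /predU1P[->|sts]; first exact: at_ts.
by apply/ltW/before => //; exact: ltW.
Qed.

Variables (a b t1 M : R) (K V V1 K1 K2 : R -> R -> R) (kb : R -> R).
Hypothesis ab : a < b.
Hypothesis t10 : 0 < t1.
Hypothesis cK : jointly_continuous `[a, b] `[0, t1] K.
Hypothesis cV : jointly_continuous `[a, b] `[0, t1] V.
Hypothesis cV1 : jointly_continuous `[a, b] `[0, t1] V1.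
Hypothesis V0 : forall p t, p \in `[a, b] -> t \in `[0, t1] -> 0 < V p t.
Hypothesis hK : forall p t, p \in `[a, b] -> t \in `]0, t1] ->
  has_derivative `[a, b] (K^~ t) p (K1 p t).
Hypothesis hK1 : forall p t, p \in `[a, b] -> t \in `]0, t1] ->
  has_derivative `[a, b] (K1^~ t) p (K2 p t).
Hypothesis hKt : forall p t, p \in `[a, b] -> t \in `]0, t1] ->
  has_derivative `]0, t1] (K p) t
    (K2 p t / V p t ^+ 2 - V1 p t * K1 p t / V p t ^+ 3 +
     (K p t - kb t) * K p t ^+ 2).
Hypothesis kb_mean : forall t k0, t \in `]0, t1] ->
  (forall p, p \in `[a, b] -> 0 <= K p t <= k0) -> 0 <= kb t <= k0.
Hypothesis M0 : 0 < M.
Hypothesis bda : forall t, t \in `]0, t1] ->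
  0 <= (K a t - kb t) * K1 a t /\ `|K1 a t| <= M * `|K a t - kb t| * V a t.
Hypothesis bdb : forall t, t \in `]0, t1] ->
  0 <= - ((K b t - kb t) * K1 b t) /\ `|K1 b t| <= M * `|K b t - kb t| * V b t.
Hypothesis K0 : forall p, p \in `[a, b] -> 0 < K p 0.

Let aI : a \in `[a, b]. Proof. by rewrite in_itv/= lexx ltW. Qed.
Let bI : b \in `[a, b]. Proof. by rewrite in_itv/= lexx ltW. Qed.

(* At a first time where K exp(L t - A (p - a) (b - p)) falls to a small
   positive level, the weight excludes a boundary minimum if A is large, and the
   evolution equation excludes an interior one if L is large. *)
Lemma positivity_preserved p : p \in `[a, b] -> 0 < K p t1.
Proof.
have weight_bound (x : R) : a <= x <= b -> `|a + b - 2 * x| <= b - a.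
  by move=> /andP[? ?]; rewrite ler_norml; apply/andP; split; lra.
have cVi : jointly_continuous `[a, b] `[0, t1] (fun p t => (V p t)^-1).
  by apply: jointly_continuousV => // q t qI tI; rewrite gt_eqF// V0.
have [k0 k00 k0P] := jointly_continuous_bounded cK.
have [v0 v00 v0P] := jointly_continuous_bounded cV.
have [w w0 wP] := jointly_continuous_bounded cVi.
have [d d0 dP] := jointly_continuous_bounded cV1.
have ba : 0 < b - a by rewrite subr_gt0.
(* The slope of the weight at the ends becomes [M * v0 + 1], one more than the largest ratio of [K1]
   to [K] permitted there by the boundary inequalities. *)
pose A := (M * v0 + 1) / (b - a).
have A0 : 0 < A by rewrite divr_gt0// ltr_wpDl// mulr_ge0// ltW.
have Aba : A * (b - a) = M * v0 + 1 by rewrite /A divfK// gt_eqF.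
(* This compensates the bound of [reaction_lower_bound], and the final 1 makes the inequality
   strict. *)
pose L := 2 * A * w ^+ 2 + d * (A * (b - a)) * w ^+ 3 + k0 ^+ 2 + 1.
pose q (x : R) := A * ((x - a) * (b - x)).
pose q1 (x : R) := A * (a + b - 2 * x).
have hq x : has_derivative `[a, b] q x (q1 x).
  have -> : q1 x = A * ((1 - 0) * (b - x) + (x - a) * (0 - 1)).
    by rewrite /q1; ring.
  apply: has_derivativeMl; apply: has_derivativeM; apply: has_derivativeB;
    solve [exact: has_derivative_cst | exact: has_derivative_id].
have hq1 x : has_derivative `[a, b] q1 x (- (2 * A)).
  have -> : - (2 * A) = A * (0 - 2 * 1) by ring.
  apply: has_derivativeMl; apply: has_derivativeB; first exact: has_derivative_cst.
  by apply: has_derivativeMl; exact: has_derivative_id.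
pose E x := expR (- q x).
have E0 x : 0 < E x by exact: expR_gt0.
have hE x : has_derivative `[a, b] E x (E x * - q1 x).
  exact: has_derivative_exp (has_derivativeN (hq x)).
have cE : {within `[a, b], continuous E}.
  exact: (has_derivative_continuous (fun x _ => hE x)).
pose G t := expR (L * t).
have G0 t : 0 < G t by exact: expR_gt0.
have hG S t : has_derivative S G t (G t * (L * 1)).
  exact: has_derivative_exp (has_derivativeMl (has_derivative_id S t)).
have cG : {within `[0, t1], continuous G}.
  exact: (has_derivative_continuous (fun x _ => hG _ x)).
pose W x t := K x t * E x * G t.
have cW : jointly_continuous `[a, b] `[0, t1] W.
  apply: jointly_continuousM; last exact: jointly_continuous_right.
  by apply: jointly_continuousM => //; exact: jointly_continuous_left.
have I0 : 0 \in `[0, t1] by rewrite in_itv/= lexx ltW.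
have [m mI mP] := EVT_min (ltW ab) (jointly_continuous_slice I0 cW).
have Wm : 0 < W m 0 by rewrite !mulr_gt0 ?K0.
pose del := W m 0 / 2.
have del0 : 0 < del by rewrite divr_gt0.
suff H x t : x \in `[a, b] -> t \in `[0, t1] -> del < W x t.
  move=> pI; have t1I : t1 \in `[0, t1] by rewrite in_itv/= lexx ltW.
  have := lt_trans del0 (H p t1 pI t1I); rewrite /W -mulrA pmulr_lgt0//.
  by rewrite mulr_gt0.
move=> xI tI; rewrite ltNge; apply/negP => Wx.
have [|p0 [ts [p0I tsI' Wdel before]]] :=
    first_time_at_level cW _ (ex_intro2 _ _ (x, t) (conj xI tI) Wx).
  by move=> y yI; apply: lt_le_trans (mP y yI); rewrite ltr_pdivrMr// ltr_pMr// ltr1n.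
have /andP[ts0 tst1] : 0 < ts <= t1 by move: tsI'; rewrite in_itv.
have tsI : ts \in `[0, t1] by rewrite in_itv/= tst1 ltW.
have at_ts y : y \in `[a, b] -> del <= W y ts by move=> yI; exact: before _ (lexx ts).
have Kpos y : y \in `[a, b] -> 0 < K y ts.
  move=> yI; have := lt_le_trans del0 (at_ts y yI).
  by rewrite /W -mulrA pmulr_lgt0// mulr_gt0.
have Kk y : y \in `[a, b] -> K y ts <= k0.
  by move=> yI; apply: le_trans (ler_norm _) _; exact: k0P.
have kbk : 0 <= kb ts <= k0.
  by apply: kb_mean => // y yI; rewrite ltW ?Kpos//= Kk.
pose u y := K y ts * E y.
have umin y : y \in `[a, b] -> u p0 <= u y.
  by move=> yI; have := at_ts y yI; rewrite -Wdel /W /u ler_pM2r.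
have hu y : y \in `[a, b] -> has_derivative `[a, b] u y ((K1 y ts - K y ts * q1 y) * E y).
  move=> yI; have := has_derivativeM (hK yI tsI') (hE y).
  suff -> : K1 y ts * E y + K y ts * (E y * - q1 y) = (K1 y ts - K y ts * q1 y) * E y by [].
  by ring.
have q1a : q1 a = M * v0 + 1 by rewrite -Aba /q1; ring.
have q1b : q1 b = - (M * v0 + 1) by rewrite -Aba /q1; ring.
have KV y (yI : y \in `[a, b]) : `|K1 y ts| <= M * `|K y ts - kb ts| * V y ts ->
    kb ts <= K y ts -> `|K1 y ts| <= M * v0 * K y ts.
  move=> h1 h2; apply: le_trans h1 _; rewrite ger0_norm ?subr_ge0//.
  have -> : M * v0 * K y ts = M * K y ts * v0 by ring.
  have vv := V0 yI tsI.
  apply: ler_pM => //; [|exact: ltW| |].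
  - by rewrite mulr_ge0 ?subr_ge0// ltW.
  - by rewrite ler_pM2l// lerBlDr lerDl; case/andP: kbk.
  - by apply: le_trans (ler_norm _) _; exact: v0P.
have [D1 D2] := derivative_at_min_segment p0I umin (hu p0 p0I).
(* A minimum at [a] requires [K1] to be at least [(M * v0 + 1) * K], hence positive. The sign
   condition then gives [kb <= K], and the size condition bounds [K1] by [M * v0 * K]. The end [b]
   is the mirror image. *)
have [pa|pa] := eqVneq p0 a.
  have [B1 B2] := bda tsI'.
  have Ka := Kpos a aI.
  have dge : 0 <= (K1 a ts - K a ts * q1 a) * E a.
    by rewrite -pa; apply: D1; rewrite pa.
  move: dge; rewrite pmulr_lge0// subr_ge0 q1a => dge.
  have K1a : 0 < K1 a ts.
    by apply: lt_le_trans dge; rewrite mulr_gt0// ltr_wpDl// mulr_ge0// ltW.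
  have := KV a aI B2; move: B1; rewrite pmulr_lge0// subr_ge0 => B1 /(_ B1).
  rewrite gtr0_norm//; lra.
have [pb|pb] := eqVneq p0 b.
  have [B1 B2] := bdb tsI'.
  have Kb := Kpos b bI.
  have dle : (K1 b ts - K b ts * q1 b) * E b <= 0.
    by rewrite -pb; apply: D2; rewrite pb.
  move: dle; rewrite pmulr_lle0// subr_le0 q1b => dle.
  have pos : 0 < K b ts * (M * v0 + 1) by rewrite mulr_gt0// ltr_wpDl// mulr_ge0// ltW.
  have K1b : K1 b ts < 0 by lra.
  have := KV b bI B2; move: B1; rewrite -mulrN pmulr_lge0 ?oppr_gt0// subr_ge0 => B1 /(_ B1).
  rewrite ltr0_norm//; lra.
have p0oo : p0 \in `]a, b[.
  by rewrite in_itv/= !lt_neqAle pb eq_sym pa/=; move: p0I; rewrite in_itv.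
have hu1 : has_derivative `[a, b] (fun y => (K1 y ts - K y ts * q1 y) * E y) p0
   ((K2 p0 ts - (K1 p0 ts * q1 p0 + K p0 ts * - (2 * A))) * E p0 +
    (K1 p0 ts - K p0 ts * q1 p0) * (E p0 * - q1 p0)).
  apply: has_derivativeM (hE p0); apply: has_derivativeB; first exact: hK1.
  exact: has_derivativeM (hK p0I tsI') (hq1 p0).
(* At an interior minimum [K1 = K * q1], and [K2] is at least [K * (q1 ^+ 2 - 2 * A)]. *)
have [] := second_derivative_at_min p0oo hu hu1 umin.
move/eqP; rewrite mulf_eq0 (gt_eqF (E0 p0)) orbF subr_eq0 => /eqP K1E.
rewrite -K1E subrr mul0r addr0 pmulr_lge0// K1E => K2E.
have Kp0 := Kpos p0 p0I; have Vp0 := V0 p0I tsI.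
set Kt := K2 p0 ts / V p0 ts ^+ 2 - V1 p0 ts * K1 p0 ts / V p0 ts ^+ 3 +
     (K p0 ts - kb ts) * K p0 ts ^+ 2.
have pos : 0 < Kt + L * K p0 ts.
  have q1l : `|q1 p0| <= A * (b - a).
    rewrite normrM gtr0_norm// ler_pM2l//.
    have /andP[ap bp] : a <= p0 <= b by move: p0I; rewrite in_itv.
    by apply: weight_bound; rewrite ap.
  have wV : (V p0 ts)^-1 <= w by apply: le_trans (ler_norm _) _; exact: wP.
  have KK : 0 < K p0 ts <= k0 by rewrite Kp0 Kk.
  have lb := reaction_lower_bound (ltW A0) Vp0 wV (dP _ _ p0I tsI) q1l KK kbk.
  have K2l : K p0 ts * ((q1 p0 ^+ 2 - 2 * A) / V p0 ts ^+ 2) <= K2 p0 ts / V p0 ts ^+ 2.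
    rewrite mulrA ler_pM2r ?invr_gt0 ?exprn_gt0//.
    by move: K2E; rewrite subr_ge0 expr2; lra.
  have lb' := ler_wpM2l (ltW Kp0) lb.
  have -> : Kt + L * K p0 ts = K p0 ts + (K2 p0 ts / V p0 ts ^+ 2 -
      K p0 ts * ((q1 p0 ^+ 2 - 2 * A) / V p0 ts ^+ 2)) +
    (K p0 ts * ((q1 p0 ^+ 2 - 2 * A) / V p0 ts ^+ 2 - V1 p0 ts * q1 p0 / V p0 ts ^+ 3 +
       (K p0 ts - kb ts) * K p0 ts) -
     K p0 ts * - (2 * A * w ^+ 2 + d * (A * (b - a)) * w ^+ 3 + k0 ^+ 2)).
    by rewrite /Kt K1E /L; ring.
  by rewrite -addrA ltr_pwDl// addr_ge0// subr_ge0.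
(* Up to [ts] the weighted curvature at [p0] stays above its value at [ts], so its derivative from
   the left is nonpositive, against [pos]. *)
have hW : has_derivative `]0, ts] (fun s => K p0 s * G s) ts
    (Kt * G ts + K p0 ts * (G ts * (L * 1))).
  apply: has_derivativeM (hG _ ts).
  apply: has_derivative_subset (hKt p0I tsI').
  by move=> s /=; rewrite !in_itv/= => /andP[-> sts]; exact: le_trans tst1.
have tsS : ts \in `]0, ts] by rewrite in_itv/= ts0 lexx.
have Smin s : s \in `]0, ts] -> K p0 ts * G ts <= K p0 s * G s.
  rewrite in_itv/= => /andP[s0 sts].
  have := before p0 s p0I s0 sts; rewrite -Wdel /W.
  by rewrite mulrAC [leRHS]mulrAC ler_pM2r.
have [_ D3] := derivative_at_min tsS Smin hW.
have : Kt * G ts + K p0 ts * (G ts * (L * 1)) <= 0.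
  have ts2 : ts / 2 < ts by rewrite ltr_pdivrMr// ltr_pMr// ltr1n.
  apply: D3 => e e0; have [y [+ yts ye]] := exists_segment_left (lexx ts) ts2 e0.
  rewrite in_itv/= => /andP[y0 _]; exists y; split=> //=.
  by rewrite in_itv/= ltW// andbT (lt_le_trans _ y0)// divr_gt0.
have -> : Kt * G ts + K p0 ts * (G ts * (L * 1)) = (Kt + L * K p0 ts) * G ts by ring.
by rewrite leNgt mulr_gt0.
Qed.

End maximum_principle.

(** * Geometric quantities depend only on the curve over its interval *)

Section congruence.
Context {R : realType}.

Lemma eq_derive_within {V : normedModType R} (A : set R) (f g : R -> V) x :
  {in A, f =1 g} -> A x -> derive_within A f x = derive_within A g x.
Proof.
move=> fg Ax; rewrite /derive_within; congr lim.
have E : \forall y \near within A x^', diff_quotient f x y = diff_quotient g x y.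
  rewrite /prop_near1/= /within/=; apply: nearW => y Ay.
  by rewrite /diff_quotient !fg// inE.
apply/seteqP; split; apply: near_eq_cvg => //.
by apply: filterS E.
Qed.

Lemma eq_speed (a b : R) (f g : R -> R * R) p : {in `[a, b]%classic, f =1 g} ->
  p \in `[a, b] -> speed a b f p = speed a b g p.
Proof. by move=> fg pI; rewrite /speed (eq_derive_within fg). Qed.

Lemma eq_curvature (a b : R) (f g : R -> R * R) p : {in `[a, b]%classic, f =1 g} ->
  p \in `[a, b] -> curvature a b f p = curvature a b g p.
Proof.
move=> fg pI.
have t q : q \in `[a, b] -> darc a b f f q = darc a b g g q.
  by move=> qI; rewrite /darc (eq_speed fg qI) (eq_derive_within fg).
have E1 : tangent a b f p = tangent a b g p by exact: t.
have tt : {in `[a, b]%classic, darc a b f f =1 darc a b g g}.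
  by move=> q; rewrite inE => qI; exact: t.
have E2 := eq_derive_within tt pI.
have E3 : darc a b f (darc a b f f) p = darc a b g (darc a b g g) p :=
  congr2 (fun (s : R) (w : R * R) => s^-1 *: w) (eq_speed fg pI) E2.
by rewrite /curvature /normal E1 E3.
Qed.

Lemma eq_curve_length (a b : R) (f g : R -> R * R) : {in `[a, b]%classic, f =1 g} ->
  curve_length a b f = curve_length a b g.
Proof.
by move=> fg; apply: eq_Rintegral => p; rewrite inE => pI; exact: eq_speed.
Qed.

End congruence.

(** * Displacement, turning and the direction of the chord *)

Section arcs.
Context {R : realType}.
Variables (a b : R) (f1 f2 v ph k A : R -> R).
Hypothesis ab : a < b.
Hypothesis v0 : forall p, p \in `[a, b] -> 0 < v p.
Hypothesis hf1 : forall p, p \in `[a, b] ->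
  has_derivative `[a, b] f1 p (v p * cos (ph p)).
Hypothesis hf2 : forall p, p \in `[a, b] ->
  has_derivative `[a, b] f2 p (v p * sin (ph p)).

Let aI : a \in `[a, b]. Proof. by rewrite in_itv/= lexx ltW. Qed.
Let bI : b \in `[a, b]. Proof. by rewrite in_itv/= lexx ltW. Qed.

Lemma displacement_le_length p q x y :
  (forall p, p \in `[a, b] -> has_derivative `[a, b] A p (v p)) ->
  p \in `[a, b] -> q \in `[a, b] -> p <= q -> x ^+ 2 + y ^+ 2 = 1 ->
  (f1 q - f1 p) * x + (f2 q - f2 p) * y <= A b - A a.
Proof.
move=> hA pI qI pq xy.
have cs u : cos (ph u) * x + sin (ph u) * y <= 1.
  have := cos2Dsin2 (ph u); have := sqr_ge0 (cos (ph u) - x).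
  have := sqr_ge0 (sin (ph u) - y); rewrite !sqrrB; lra.
have hG u : u \in `[a, b] -> has_derivative `[a, b]
    (fun u => A u - (x * f1 u + y * f2 u)) u
    (v u - (x * (v u * cos (ph u)) + y * (v u * sin (ph u)))).
  move=> uI; apply: has_derivativeB; first exact: hA.
  by apply: has_derivativeD; apply: has_derivativeMl; [exact: hf1|exact: hf2].
have G : A p - (x * f1 p + y * f2 p) <= A q - (x * f1 q + y * f2 q).
  apply: (nondecreasing_of_derivative pq _ hG); first exact: segment_subset_itv.
  move=> u uI; have {}uI : u \in `[a, b].
    by apply: (segment_subset_itv pI qI); exact: subset_itv_oo_cc uI.
  have -> : v u - (x * (v u * cos (ph u)) + y * (v u * sin (ph u))) =
    v u * (1 - (cos (ph u) * x + sin (ph u) * y)) by ring.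
  by rewrite mulr_ge0 ?subr_ge0// ltW// v0.
have A1 : A a <= A p.
  apply: (nondecreasing_of_derivative _ _ hA).
  - by move: pI; rewrite in_itv => /andP[].
  - exact: segment_subset_itv.
  - move=> u uI; rewrite ltW// v0//; apply: (segment_subset_itv aI pI).
    exact: subset_itv_oo_cc uI.
have A2 : A q <= A b.
  apply: (nondecreasing_of_derivative _ _ hA).
  - by move: qI; rewrite in_itv => /andP[].
  - exact: segment_subset_itv.
  - move=> u uI; rewrite ltW// v0//; apply: (segment_subset_itv qI bI).
    exact: subset_itv_oo_cc uI.
lra.
Qed.

Hypothesis k0 : forall p, p \in `[a, b] -> 0 < k p.
Hypothesis hph : forall p, p \in `[a, b] -> has_derivative `[a, b] ph p (k p).

Let w1 := f1 b - f1 a.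
Let w2 := f2 b - f2 a.
Let turn := ph b - ph a.

Let ph_inc u w : u \in `[a, b] -> w \in `[a, b] -> u < w -> ph u < ph w.
Proof.
move=> uI wI uw; apply: (increasing_of_derivative uw _ hph).
  exact: segment_subset_itv.
by move=> z zuw; apply: k0; apply: (segment_subset_itv uI wI); exact: subset_itv_oo_cc zuw.
Qed.

(* The endpoints are in the right order: if the turning exceeds pi, this is a
   consequence of the support lines at the endpoints. *)
Lemma chord_sides : 0 < turn < pi *+ 2 -> cos turn < 0 ->
  (pi < turn -> [/\ w1 * cos (ph a) + w2 * sin (ph a) <= 0,
     w1 * cos (ph b) + w2 * sin (ph b) <= 0 & (w1 != 0) || (w2 != 0)]) ->
  0 < w2 * cos (ph a) - w1 * sin (ph a) /\
  w2 * cos (ph b) - w1 * sin (ph b) < 0.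
Proof.
move=> /andP[t0 t2] ct H.
have [tpi|tpi] := leP turn pi.
  have hh q p : p \in `[a, b] -> has_derivative `[a, b]
      (fun p => cos (ph q) * f2 p - sin (ph q) * f1 p) p (v p * sin (ph p - ph q)).
    move=> pI.
    have -> : v p * sin (ph p - ph q) =
        cos (ph q) * (v p * sin (ph p)) - sin (ph q) * (v p * cos (ph p)).
      by rewrite sinB; ring.
    by apply: has_derivativeB; apply: has_derivativeMl; [exact: hf2|exact: hf1].
  have oo p : p \in `]a, b[ -> [/\ p \in `[a, b], ph a < ph p & ph p < ph b].
    move=> pab; have pI : p \in `[a, b] by exact: subset_itv_oo_cc pab.
    move: pab; rewrite in_itv/= => /andP[ap pb].
    by split=> //; exact: ph_inc.
  split.
    have : cos (ph a) * f2 a - sin (ph a) * f1 a < cos (ph a) * f2 b - sin (ph a) * f1 b.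
      apply: (increasing_of_derivative ab _ (fun p => @hh a p)) => // p /oo[pI p1 p2].
      rewrite mulr_gt0 ?v0//; apply: sin_gt0_pi.
      by move: tpi; rewrite /turn => tpi; apply/andP; split; lra.
    by rewrite /w1 /w2; lra.
  have : - (cos (ph b) * f2 a - sin (ph b) * f1 a) < - (cos (ph b) * f2 b - sin (ph b) * f1 b).
    apply: (@increasing_of_derivative _ `[a, b]
      (fun p => - (cos (ph b) * f2 p - sin (ph b) * f1 p))
      (fun p => - (v p * sin (ph p - ph b))) a b ab) => //.
      by move=> p pI; exact: has_derivativeN (hh b p pI).
    move=> p /oo[pI p1 p2]; rewrite -mulrN -sinN opprB.
    rewrite mulr_gt0 ?v0//; apply: sin_gt0_pi.
    by move: tpi; rewrite /turn => tpi; apply/andP; split; lra.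
  by rewrite /w1 /w2; lra.
have [h1 h2 n0] := H tpi.
have st : sin turn < 0.
  have : 0 < sin (turn - pi) by apply: sin_gt0_pi; move: t2; rewrite mulr2n; lra.
  by rewrite sinB sinpi cospi mulr0 subr0; lra.
have pbE : ph b = ph a + turn by rewrite /turn addrC subrK.
(* Coordinates of the chord in the frame at [a]. Here [turn] has negative sine and cosine, so the
   two support inequalities force [u2] to be nonnegative, and [u2 = 0] would make the chord
   vanish. *)
pose u1 := w1 * cos (ph a) + w2 * sin (ph a).
pose u2 := w2 * cos (ph a) - w1 * sin (ph a).
have e1 : w1 * cos (ph b) + w2 * sin (ph b) = u1 * cos turn + u2 * sin turn.
  by rewrite pbE cosD sinD /u1 /u2; ring.
have e2 : w2 * cos (ph b) - w1 * sin (ph b) = u2 * cos turn - u1 * sin turn.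
  by rewrite pbE cosD sinD /u1 /u2; ring.
have nn : 0 < u1 ^+ 2 + u2 ^+ 2.
  have -> : u1 ^+ 2 + u2 ^+ 2 = (w1 ^+ 2 + w2 ^+ 2) * (cos (ph a) ^+ 2 + sin (ph a) ^+ 2).
    by rewrite /u1 /u2; ring.
  rewrite cos2Dsin2 mulr1 lt_neqAle addr_ge0 ?sqr_ge0// andbT eq_sym.
  by rewrite paddr_eq0 ?sqr_ge0// !sqrf_eq0 negb_and.
rewrite e1 in h2; rewrite e2 -/u2 -/u1 in h1 *.
have u2p : 0 < u2.
  rewrite lt_neqAle; apply/andP; split; last first.
    by rewrite leNgt; apply/negP => u20; nra.
  apply/eqP => u20; move: h2 nn; rewrite -u20 mul0r addr0 expr0n/= addr0.
  rewrite (nmulr_lle0 _ ct) => u10 nn0.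
  have u1z : u1 = 0 by apply/eqP; rewrite eq_le u10 andbT.
  by rewrite u1z expr0n/= ltxx in nn0.
by split=> //; nra.
Qed.

(** The first sign places the angle [x] from the initial tangent to the chord in []0, pi[]. The
    second says [sin (x - turn) < 0], which by the range of [turn] means that [turn] lies between
    [x] and [x + pi]. *)
Lemma chord_direction : 0 < turn < pi *+ 2 -> cos turn < 0 ->
  0 < w2 * cos (ph a) - w1 * sin (ph a) ->
  w2 * cos (ph b) - w1 * sin (ph b) < 0 ->
  exists rho ch, [/\ 0 < rho, w1 = rho * cos ch, w2 = rho * sin ch,
    ph a < ch < ph a + pi & ph b - pi < ch < ph b].
Proof.
move=> /andP[t0 t2] ct P Q.
have pbE : ph b = ph a + turn by rewrite /turn addrC subrK.
pose u1 := w1 * cos (ph a) + w2 * sin (ph a).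
pose u2 := w2 * cos (ph a) - w1 * sin (ph a).
have e1 : w1 = u1 * cos (ph a) - u2 * sin (ph a).
  transitivity (w1 * (cos (ph a) ^+ 2 + sin (ph a) ^+ 2)).
    by rewrite cos2Dsin2 mulr1.
  by rewrite /u1 /u2; ring.
have e2 : w2 = u1 * sin (ph a) + u2 * cos (ph a).
  transitivity (w2 * (cos (ph a) ^+ 2 + sin (ph a) ^+ 2)).
    by rewrite cos2Dsin2 mulr1.
  by rewrite /u1 /u2; ring.
have n0 : 0 < u1 ^+ 2 + u2 ^+ 2 by rewrite ltr_wpDl ?sqr_ge0// exprn_gt0.
pose rho := length2 u1 u2.
have r0 : 0 < rho by exact: length2_gt0.
have CS := frame_unit n0; rewrite -/rho in CS.
pose x := acos (u1 / rho).
have y0 : 0 < u2 / rho by rewrite divr_gt0.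
have x1 : -1 < u1 / rho < 1.
  have : 0 < (u2 / rho) ^+ 2 by rewrite exprn_gt0.
  by move=> ?; apply/andP; split; nra.
have [x1a x1b] : -1 < u1 / rho /\ u1 / rho < 1 by move/andP: x1.
have cx : cos x = u1 / rho by rewrite /x acosK// in_itv/= !ltW.
have xpi : 0 < x < pi.
  by rewrite /x acos_gt0 ?acos_ltpi ?(ltW x1a) ?(ltW x1b) ?x1a ?x1b.
have sx : sin x = u2 / rho.
  apply/eqP; rewrite -(eqrXn2 (n := 2))//; first last.
  - exact: ltW.
  - by apply/ltW/sin_gt0_pi.
  - by have := cos2Dsin2 x; rewrite cx => ?; apply/eqP; lra.
have u1E : u1 = rho * cos x by rewrite cx mulrC divfK// gt_eqF.
have u2E : u2 = rho * sin x by rewrite sx mulrC divfK// gt_eqF.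
exists rho, (ph a + x); split=> //.
- by rewrite e1 u1E u2E cosD; ring.
- by rewrite e2 u1E u2E sinD; ring.
- by case/andP: xpi => ? ?; apply/andP; split; lra.
have Q' : sin (x - turn) < 0.
  have : w2 * cos (ph b) - w1 * sin (ph b) = rho * sin (x - turn).
    rewrite pbE sinB cosD sinD e1 e2 u1E u2E.
    transitivity (rho * (sin x * cos turn - cos x * sin turn) *
      (cos (ph a) ^+ 2 + sin (ph a) ^+ 2)); first by ring.
    by rewrite cos2Dsin2 mulr1.
  by move=> E; move: Q; rewrite E pmulr_rlt0.
(* Within one full turn, a negative cosine means an angle between [pi / 2] and [3 pi / 2]; so
   [x - turn] cannot wrap around. *)
have t3 : pi / 2 < turn.
  rewrite ltNge; apply/negP => h; move: ct; apply/negP; rewrite -leNgt.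
  by apply: cos_ge0_pihalf; have := pi_gt0 R; move=> ?; apply/andP; split; lra.
have t4 : turn < pi + pi / 2.
  rewrite ltNge; apply/negP => h; move: ct; apply/negP; rewrite -leNgt.
  have -> : turn = (turn - pi *+ 2) + pi *+ 2 by rewrite subrK.
  rewrite mulr2n addrA !cosDpi opprK; apply: cos_ge0_pihalf.
  by move: t2; rewrite mulr2n => ?; apply/andP; split; lra.
case/andP: xpi => x0 xpi.
rewrite pbE; apply/andP; split.
- rewrite -addrA ltrD2l ltNge; apply/negP => h.
  move: Q'; apply/negP; rewrite -leNgt.
  have -> : x - turn = - (turn - x - pi + pi) by ring.
  by rewrite sinN sinDpi opprK; apply: sin_ge0_pi; apply/andP; split; lra.
- rewrite ltrD2l ltNge; apply/negP => h.
  move: Q'; apply/negP; rewrite -leNgt.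
  by apply: sin_ge0_pi; apply/andP; split; lra.
Qed.

End arcs.

(** * Positivity, total turning and convexity along the flow *)

Section free_boundary_flow.
Context {R : realType}.
Variables (sa sb : R) (sf : R -> R * R) (a b : R) (T : \bar R).
Variables (c0 : R -> R * R) (c : R -> R -> R * R).
Hypothesis hS : support_curve sa sb sf.
Hypothesis ab : a < b.
Hypothesis sol : apcsf_solution sa sb sf a b T c0 c.
Hypothesis k0 : forall p, p \in `[a, b] -> 0 < curvature a b c0 p.

Notation J0 := (time_interval T).
Notation J1 := (open_time_interval T).
Notation X := (vx a b c).
Notation Y := (vy a b c).
Notation V := (flow_speed a b c).
Notation V1 := (flow_speed1 a b c).
Notation K := (flow_curvature a b c).
Notation K1 := (flow_curvature1 a b c).
Notation K2 := (flow_curvature2 a b c).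
Notation Sigma := (sf @` `[sa, sb]).
Notation st := (support_tangent sa sb sf).

Let aI : a \in `[a, b]. Proof. by rewrite in_itv/= lexx ltW. Qed.
Let bI : b \in `[a, b]. Proof. by rewrite in_itv/= lexx ltW. Qed.

Lemma time_interval0 : J0 0.
Proof. by split; [exact: lexx|exact: solution_time sol]. Qed.

Lemma initial_curve_eq : {in `[a, b]%classic, c^~ 0 =1 c0}.
Proof. by move=> p; rewrite inE => pI; exact: solution_initial sol p pI. Qed.

Lemma initial_curvature_gt0 p : p \in `[a, b] -> 0 < K p 0.
Proof.
move=> pI; rewrite -(flow_curvatureE ab sol time_interval0 pI).
by rewrite (eq_curvature initial_curve_eq pI); exact: k0.
Qed.

Lemma mean_curvature_bounds t l : J0 t ->
  (forall p, p \in `[a, b] -> 0 <= K p t <= l) ->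
  0 <= mean_curvature a b (c^~ t) <= l.
Proof.
move=> Jt kl; have [cV cKV _] := flow_slices sol Jt.
have [A1 h1] := exists_antiderivative ab cV.
have [A2 h2] := exists_antiderivative ab cKV.
have L0 := flow_length_gt0 ab sol Jt.
have kE := flow_mean_curvatureE ab sol Jt.
have LE := flow_lengthE ab sol Jt.
rewrite (integral_antiderivative ab cKV h2) in kE.
rewrite (integral_antiderivative ab cV h1) in LE.
rewrite kE divr_ge0 ?(ltW L0)//=; last first.
  rewrite subr_ge0; apply: (nondecreasing_of_derivative (ltW ab) _ h2) => // p pI.
  have {}pI : p \in `[a, b] by exact: subset_itv_oo_cc pI.
  have V0 := flow_speed_gt0 sol pI Jt.
  by have /andP[? _] := kl p pI; rewrite mulr_ge0// ltW.
rewrite (ler_pdivrMr _ _ L0) LE.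
have hG p : p \in `[a, b] -> has_derivative `[a, b]
    (fun p => l * A1 p - A2 p) p (l * V p t - K p t * V p t).
  move=> pI; apply: has_derivativeB; last exact: h2.
  exact: has_derivativeMl (h1 p pI).
have : l * A1 a - A2 a <= l * A1 b - A2 b.
  apply: (nondecreasing_of_derivative (ltW ab) _ hG) => // p pI.
  have {}pI : p \in `[a, b] by exact: subset_itv_oo_cc pI.
  have V0 := flow_speed_gt0 sol pI Jt.
  have /andP[_ ?] := kl p pI.
  by rewrite -mulrBl mulr_ge0 ?subr_ge0// ltW.
lra.
Qed.

Lemma curvature_stays_positive t p : J0 t -> p \in `[a, b] -> 0 < K p t.
Proof.
move=> Jt pI; have [t0 tT] := Jt.
have [->|tn] := eqVneq t 0; first exact: initial_curvature_gt0.
have {}t0 : 0 < t by rewrite lt_neqAle eq_sym tn.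
have sub0 : `[0, t] `<=` J0 by exact: (time_interval_like time_interval0 Jt).
have sub1 : `]0, t] `<=` J1.
  move=> s /=; rewrite in_itv/= => /andP[s0 st]; split=> //.
  by apply: le_lt_trans tT; rewrite lee_fin.
have subI : `[a, b] `<=` `[a, b] by [].
have [_ _ cV cK cV1] := flow_continuous sol.
have [M M0 lip] := support_tangent_lipschitz hS.
apply: (@positivity_preserved R a b t M K V V1 K1 K2
  (fun s => mean_curvature a b (c^~ s)) ab t0
  (jointly_continuousW subI sub0 cK) (jointly_continuousW subI sub0 cV)
  (jointly_continuousW subI sub0 cV1)
  (fun p s pI sI => flow_speed_gt0 sol pI (sub0 _ sI))
  (fun p s pI sI => flow_curvature_derivative sol (sub1 _ sI) pI)
  (fun p s pI sI => flow_curvature1_derivative sol (sub1 _ sI) pI)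
  (fun p s pI sI => has_derivative_subset sub1 (flow_evolution ab sol pI (sub1 _ sI)).2)
  (fun s l sI => @mean_curvature_bounds s l (open_time_sub (sub1 _ sI)))
  M0 _ _ initial_curvature_gt0 p pI).
(* The support tangent is the normal of the arc at [a] and its opposite at [b]; this sign gives the
   two ends opposite boundary inequalities. *)
- move=> s sI.
  have bd u : J0 u -> Sigma (c a u) /\ st (c a u) = 1 *: J (flow_tangent a b c a u).
    by move=> Ju; rewrite scale1r; exact: (boundary_left hS ab sol Ju).
  have := boundary_derivative hS ab sol aI (expr1n _ 2) M0 lip bd (sub1 _ sI).
  by rewrite mul1r.
- move=> s sI.
  have bd u : J0 u -> Sigma (c b u) /\ st (c b u) = -1 *: J (flow_tangent a b c b u).
    by move=> Ju; rewrite scaleN1r; exact: (boundary_right hS ab sol Ju).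
  have m1 : (-1 : R) ^+ 2 = 1 by rewrite sqrrN expr1n.
  have := boundary_derivative hS ab sol bI m1 M0 lip bd (sub1 _ sI).
  by rewrite mulN1r.
Qed.

(** The angle is found for one time only. Its total increment is a curvature integral, and this is
    the quantity followed in time. *)
Lemma frame_angle t : J0 t -> exists ph : R -> R, [/\
  forall p, p \in `[a, b] -> has_derivative `[a, b] ph p (K p t * V p t),
  forall p, p \in `[a, b] ->
    X p t / V p t = cos (ph p) /\ Y p t / V p t = sin (ph p) &
  ph b - ph a = \int[lebesgue_measure]_(p in `[a, b]) (K p t * V p t)].
Proof.
move=> Jt; have [_ cKV _] := flow_slices sol Jt.
have [ps hps] := exists_antiderivative ab cKV.
have h p (pI : p \in `[a, b]) := flow_frame_derivative sol Jt pI.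
have [th thP] := turning_angle ab (fun p pI => (h p pI).1) (fun p pI => (h p pI).2) hps
  (frame_unit (solution_velocity_neq0 sol aI Jt)).
exists (fun p => th + ps p); split=> //.
- move=> p pI; rewrite -[K p t * V p t]add0r.
  by apply: has_derivativeD; [exact: has_derivative_cst|exact: hps].
- rewrite (integral_antiderivative ab cKV hps); ring.
Qed.

Lemma frame_velocity t ph p : J0 t -> p \in `[a, b] ->
  (forall p, p \in `[a, b] ->
    X p t / V p t = cos (ph p) /\ Y p t / V p t = sin (ph p)) ->
  has_derivative `[a, b] (fun q => (c q t).1) p (V p t * cos (ph p)) /\
  has_derivative `[a, b] (fun q => (c q t).2) p (V p t * sin (ph p)).
Proof.
move=> Jt pI phP; have [<- <-] := phP p pI.
have Vn : V p t != 0 by rewrite gt_eqF// (flow_speed_gt0 sol pI Jt).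
have h := solution_space_derivative sol pI Jt.
have -> : V p t * (X p t / V p t) = X p t by rewrite mulrC (divfK Vn).
have -> : V p t * (Y p t / V p t) = Y p t by rewrite mulrC (divfK Vn).
by split; [exact: has_derivative_fst h|exact: has_derivative_snd h].
Qed.

Lemma flow_displacement t p q x y : J0 t -> p \in `[a, b] -> q \in `[a, b] ->
  p <= q -> x ^+ 2 + y ^+ 2 = 1 ->
  ((c q t).1 - (c p t).1) * x + ((c q t).2 - (c p t).2) * y <=
  curve_length a b (c^~ t).
Proof.
move=> Jt pI qI pq xy; have [ph [hph phP _]] := frame_angle Jt.
have [cV _ _] := flow_slices sol Jt.
have [A1 h1] := exists_antiderivative ab cV.
rewrite (flow_lengthE ab sol Jt) (integral_antiderivative ab cV h1).
apply: (@displacement_le_length R a b (fun q => (c q t).1) (fun q => (c q t).2)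
  (V^~ t) ph A1 ab _ _ _ p q x y h1 pI qI pq xy).
- by move=> u uI; exact: (flow_speed_gt0 sol uI Jt).
- by move=> u uI; exact: (frame_velocity Jt uI phP).1.
- by move=> u uI; exact: (frame_velocity Jt uI phP).2.
Qed.

Lemma flow_endpoints_close t : J0 t ->
  `|c b t - c a t| <= curve_length a b (c^~ t).
Proof.
move=> Jt; apply/norm_plane_le.
have d x y := @flow_displacement t a b x y Jt aI bI (ltW ab).
have u1 : (1 : R) ^+ 2 + 0 ^+ 2 = 1 by rewrite expr1n expr0n addr0.
have u2 : (-1 : R) ^+ 2 + 0 ^+ 2 = 1 by rewrite sqrrN.
have u3 : (0 : R) ^+ 2 + 1 ^+ 2 = 1 by rewrite addrC.
have u4 : (0 : R) ^+ 2 + (-1) ^+ 2 = 1 by rewrite sqrrN.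
have := d _ _ u1; have := d _ _ u2; have := d _ _ u3; have := d _ _ u4.
rewrite !mulr0 !mulr1 !mulrN1 !addr0 !add0r => h4 h3 h2 h1.
by split; rewrite ler_norml; apply/andP; split; rewrite /=; lra.
Qed.

Lemma boundary_left_angle t ph : J0 t ->
  (forall p, p \in `[a, b] ->
    X p t / V p t = cos (ph p) /\ Y p t / V p t = sin (ph p)) ->
  st (c a t) = (- sin (ph a), cos (ph a)).
Proof.
move=> Jt phP; have [_ ->] := boundary_left hS ab sol Jt.
have [h1 h2] := phP a aI.
exact: (congr2 (fun x y : R => (- y, x)) h1 h2).
Qed.

Lemma boundary_right_angle t ph : J0 t ->
  (forall p, p \in `[a, b] ->
    X p t / V p t = cos (ph p) /\ Y p t / V p t = sin (ph p)) ->
  st (c b t) = (sin (ph b), - cos (ph b)).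
Proof.
move=> Jt phP; have [_ ->] := boundary_right hS ab sol Jt.
have [h1 h2] := phP b bI; rewrite -[sin (ph b)]opprK.
exact: (congr2 (fun x y : R => (- - y, - x)) h1 h2).
Qed.

(** The support tangents are the normal at [a] and the opposite of the normal at [b], so their inner
    product is minus the cosine of the turning. *)
Lemma endpoint_tangents_dot t ph : J0 t ->
  (forall p, p \in `[a, b] ->
    X p t / V p t = cos (ph p) /\ Y p t / V p t = sin (ph p)) ->
  0 < dot (st (c a t)) (st (c b t)) -> cos (ph b - ph a) < 0.
Proof.
move=> Jt phP; rewrite (boundary_left_angle Jt phP) (boundary_right_angle Jt phP).
by rewrite /dot /= cosB; lra.
Qed.

Hypothesis inj : {in `[a, b] &, injective c0}.
Hypothesis outer : forall p, p \in `]a, b[ -> outer_domain Sigma (c0 p).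

(** The direction opposite to the arc at an endpoint is the inner normal of the support curve. A
    point of the arc met in that direction would be at a distance less than [r0], since displacement
    is at most the length, hence in the strip excluded by the second hypothesis. *)
Lemma initial_turning_lt r0 : curve_length a b c0 < r0 ->
  (forall x r, Sigma x -> 0 < r <= r0 ->
     ~ outer_domain Sigma (x + r *: J (st x)) /\ ~ Sigma (x + r *: J (st x))) ->
  \int[lebesgue_measure]_(p in `[a, b]) (K p 0 * V p 0) < pi *+ 2.
Proof.
have key (u v r k : R) : u - v = - (r * k) -> v + r * - k = u.
  by rewrite mulrN => <-; rewrite addrC subrK.
have key' (u v r k : R) : u - v = - (r * k) -> u + r * k = v.
  by move=> E; rewrite -[r * k]opprK -E opprB addrC subrK.
move=> Lr inner; have Jt := time_interval0.
have [ph [hph phP <-]] := frame_angle Jt.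
have cE p : p \in `[a, b] -> c p 0 = c0 p by exact: solution_initial sol p.
have LE : curve_length a b (c^~ 0) = curve_length a b c0.
  exact: eq_curve_length initial_curve_eq.
have [cV _ _] := flow_slices sol Jt.
have cph : {within `[a, b], continuous ph} by exact: has_derivative_continuous hph.
have notin p : p \in `[a, b] -> ~ outer_domain Sigma (c p 0) -> ~ Sigma (c p 0) -> False.
  move=> pI no ns.
  have [pa|pa] := eqVneq p a; first by apply: ns; rewrite pa; exact: (boundary_left hS ab sol Jt).1.
  have [pb|pb] := eqVneq p b; first by apply: ns; rewrite pb; exact: (boundary_right hS ab sol Jt).1.
  have poo : p \in `]a, b[.
    by rewrite in_itv/= !lt_neqAle pb eq_sym pa/=; move: pI; rewrite in_itv.
  by have := outer poo; rewrite -(cE p pI); exact: no.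
have := @embedded_turning_lt R a b ab (fun q => (c q 0).1) (fun q => (c q 0).2)
  (V^~ 0) ph (fun p pI => flow_speed_gt0 sol pI Jt) cV cph
  (fun p pI => (frame_velocity Jt pI phP).1) (fun p pI => (frame_velocity Jt pI phP).2).
move=> /(_ _ _ _)/wrap[].
- move=> s t sI tI E1 E2.
  have E : c s 0 = c t 0 by rewrite [LHS]surjective_pairing E1 E2 -surjective_pairing.
  by rewrite (cE s sI) (cE t tI) in E; exact: (inj sI tI E).
- move=> t r tI rr E1 E2.
  have [Sa _] := boundary_left hS ab sol Jt.
  have sE := boundary_left_angle Jt phP.
  have CS := cos2Dsin2 (ph a).
  have at_ : a <= t by move: tI; rewrite in_itv => /andP[].
  have rL : r < r0.
    apply: le_lt_trans Lr; rewrite -LE.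
    have := @flow_displacement 0 a t (- cos (ph a)) (- sin (ph a)) Jt aI tI at_.
    rewrite !sqrrN CS => /(_ erefl); rewrite E1 E2.
    suff -> : - (r * cos (ph a)) * - cos (ph a) + - (r * sin (ph a)) * - sin (ph a) =
      r * (cos (ph a) ^+ 2 + sin (ph a) ^+ 2) by rewrite CS mulr1.
    by ring.
  have [] := inner (c a 0) r Sa; first by rewrite rr ltW.
  suff -> : c a 0 + r *: J (st (c a 0)) = c t 0 by exact: notin.
  rewrite sE [RHS]surjective_pairing /J.
  rewrite -[LHS]/((c a 0).1 + r * - cos (ph a), (c a 0).2 + r * - sin (ph a)).
  by congr (_, _); exact: key.
- move=> s r sI rr E1 E2.
  have [Sb _] := boundary_right hS ab sol Jt.
  have sE := boundary_right_angle Jt phP.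
  have CS := cos2Dsin2 (ph b).
  have sb_ : s <= b by move: sI; rewrite in_itv => /andP[].
  have rL : r < r0.
    apply: le_lt_trans Lr; rewrite -LE.
    have := @flow_displacement 0 s b (- cos (ph b)) (- sin (ph b)) Jt sI bI sb_.
    rewrite !sqrrN CS => /(_ erefl); rewrite E1 E2.
    suff -> : - (r * cos (ph b)) * - cos (ph b) + - (r * sin (ph b)) * - sin (ph b) =
      r * (cos (ph b) ^+ 2 + sin (ph b) ^+ 2) by rewrite CS mulr1.
    by ring.
  have [] := inner (c b 0) r Sb; first by rewrite rr ltW.
  suff -> : c b 0 + r *: J (st (c b 0)) = c s 0 by exact: notin.
  rewrite sE [RHS]surjective_pairing /J.
  rewrite -[LHS]/((c b 0).1 + r * - - cos (ph b), (c b 0).2 + r * sin (ph b)).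
  by rewrite opprK; congr (_, _); exact: key'.
- by move=> h; apply: le_lt_trans (ler_norm _) h.
Qed.

Variables (C1 r0 : R).
Hypothesis LC1 : curve_length a b c0 < C1.
Hypothesis Lr0 : curve_length a b c0 < r0.
Hypothesis close : forall x y, Sigma x -> Sigma y -> `|x - y| < C1 ->
  0 < dot (st x) (st y).
Hypothesis inner : forall x r, Sigma x -> 0 < r <= r0 ->
  ~ outer_domain Sigma (x + r *: J (st x)) /\ ~ Sigma (x + r *: J (st x)).

Lemma endpoint_support_tangents t : J0 t -> 0 < dot (st (c a t)) (st (c b t)).
Proof.
move=> Jt; apply: close.
- exact: (boundary_left hS ab sol Jt).1.
- exact: (boundary_right hS ab sol Jt).1.
- rewrite distrC; apply: le_lt_trans (flow_endpoints_close Jt) _.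
  apply: le_lt_trans (flow_length_nonincreasing ab sol Jt) _.
  by rewrite (eq_curve_length initial_curve_eq).
Qed.

Let Phi t := \int[lebesgue_measure]_(p in `[a, b]) (K p t * V p t).

Lemma total_turning_cos t : J0 t -> cos (Phi t) < 0.
Proof.
move=> Jt; have [ph [_ phP E]] := frame_angle Jt; rewrite /Phi -E.
exact: (endpoint_tangents_dot Jt phP (endpoint_support_tangents Jt)).
Qed.

Lemma total_turning_gt0 t : J0 t -> 0 < Phi t.
Proof.
move=> Jt; have [ph [hph _ E]] := frame_angle Jt; rewrite /Phi -E subr_gt0.
apply: (increasing_of_derivative ab _ hph) => // p pI.
have {}pI : p \in `[a, b] by exact: subset_itv_oo_cc pI.
by rewrite mulr_gt0 ?(curvature_stays_positive Jt pI) ?(flow_speed_gt0 sol pI Jt).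
Qed.

(* The cosine of the total turning stays negative, so that the total turning
   cannot leave the interval between 0 and 2 pi in which it starts. *)
Lemma total_turning_lt t : J0 t -> Phi t < pi *+ 2.
Proof.
move=> Jt; have t0 : 0 <= t by case: Jt.
have sub0 : `[0, t] `<=` J0 by exact: (time_interval_like time_interval0 Jt).
have [_ _ cV cK _] := flow_continuous sol.
have cPhi : {within `[0, t], continuous (fun s => Phi s - pi)}.
  have h := continuous_subspaceW sub0 (integral_continuous ab (jointly_continuousM cK cV)).
  by move=> s; apply: cvgB; [exact: h|exact: cvg_cst].
have I0 : 0 \in `[0, t] by rewrite in_itv/= lexx.
have It : t \in `[0, t] by rewrite in_itv/= lexx t0.
have := continuous_angle_barrier cPhi I0 It.
move=> /(_ _ _)/wrap[].
- have p0 := total_turning_gt0 time_interval0.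
  have p1 := initial_turning_lt Lr0 inner.
  rewrite -/(Phi 0) mulr2n in p1.
  by rewrite ltr_norml; apply/andP; split; lra.
- move=> s sI; apply/eqP => h; have := total_turning_cos (sub0 _ sI).
  by move: h; rewrite cosB cospi sinpi; lra.
- by rewrite ltr_norml mulr2n => /andP[_ ?]; lra.
Qed.

Lemma flow_convex t : J0 t -> traces_out_convex_domain a b (c^~ t).
Proof.
move=> Jt; have [ph [hph phP E]] := frame_angle Jt.
have V0 p : p \in `[a, b] -> 0 < V p t by move=> pI; exact: (flow_speed_gt0 sol pI Jt).
have KV0 p : p \in `[a, b] -> 0 < K p t * V p t.
  by move=> pI; rewrite mulr_gt0 ?V0//; exact: curvature_stays_positive.
have h1 p (pI : p \in `[a, b]) := (frame_velocity Jt pI phP).1.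
have h2 p (pI : p \in `[a, b]) := (frame_velocity Jt pI phP).2.
have tr : 0 < ph b - ph a < pi *+ 2.
  by rewrite E (total_turning_gt0 Jt) (total_turning_lt Jt).
have ct : cos (ph b - ph a) < 0 by rewrite E; exact: total_turning_cos.
have [] := chord_sides ab V0 h1 h2 KV0 hph tr ct.
  (* Each endpoint lies on the inner side of the support line at the other one; this gives the two
     inequalities on the chord. *)
  move=> tpi.
  have [Sa _] := boundary_left hS ab sol Jt.
  have [Sb _] := boundary_right hS ab sol Jt.
  have aE := boundary_left_angle Jt phP; have bE := boundary_right_angle Jt phP.
  have := support_line hS Sa Sb; rewrite aE.
  have := support_line hS Sb Sa; rewrite bE.
  rewrite /dot /J/= => l2 l1; split; [lra|lra|].
  rewrite -negb_and; apply/negP => /andP[]; rewrite !subr_eq0 => /eqP e1 /eqP e2.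
  (* Coinciding endpoints would share their support tangent, so the turning would have cosine [-1],
     impossible strictly between [pi] and [2 pi]. *)
  have cab : c a t = c b t by rewrite [LHS]surjective_pairing -e1 -e2 -surjective_pairing.
  have c1 : cos (ph b - ph a) = -1.
    have := support_tangent_unit hS Sa; rewrite {2}cab aE bE.
    by rewrite /dot /J/= cosB; lra.
  have : 0 < sin (ph b - ph a - pi).
    by apply: sin_gt0_pi; move: tr; rewrite mulr2n => /andP[? ?]; apply/andP; split; lra.
  rewrite sinB cospi sinpi mulr0 subr0 mulrN1 oppr_gt0.
  have := cos2Dsin2 (ph b - ph a); rewrite c1 => h3.
  have -> : sin (ph b - ph a) = 0 by apply/eqP; rewrite -sqrf_eq0; apply/eqP; lra.
  by rewrite ltxx.
move=> P Q.
have [rho [ch [r00 w1 w2 cha chb]]] :=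
  @chord_direction R a b (fun q => (c q t).1) (fun q => (c q t).2) ph tr ct P Q.
have tr2 : ph b - ph a < pi *+ 2 by case/andP: tr.
exact: (convex_closure_of_arc ab V0 KV0 h1 h2 hph tr2 r00 w1 w2 cha chb).
Qed.

End free_boundary_flow.

Unset Implicit Arguments.

Theorem theorem5p6 (R : realType) (sa sb : R) (sf : R -> R * R)
    (hS : support_curve sa sb sf) :
  exists C : R, 0 < C /\
  forall (a b : R) (T : \bar R) (c0 : R -> R * R) (c : R -> R -> R * R),
    initial_curve sa sb sf a b c0 ->
    apcsf_solution sa sb sf a b T c0 c ->
    (forall p, p \in `[a, b] -> 0 < curvature a b c0 p) ->
    {in `[a, b] &, injective c0} ->
    (forall p, p \in `]a, b[ -> outer_domain (sf @` `[sa, sb]) (c0 p)) ->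
    curve_length a b c0 < support_width sa sb sf ->
    curve_length a b c0 < C ->
    forall t : R, time_interval T t ->
      traces_out_convex_domain a b (c^~ t).
Proof.
have [C1 C10 close] := support_tangents_close hS.
have [r0 r00 inner] := support_inner hS.
exists (Num.min C1 r0); split; first by rewrite lt_min C10.
move=> a b T c0 c ini sol k0 inj outer _ + t Jt.
rewrite lt_min => /andP[LC1 Lr0].
exact: (flow_convex hS (initial_lt ini) sol k0 inj outer LC1 Lr0 close inner Jt).
Qed.
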